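(* Let $n\ge1$, let $F$ be an $n$-perturbation on $H^2(\mathbb{D})$, and let $\mathcal{M}$ be a nonzero closed subspace of $H^2(\mathbb{D})$. Then $\mathcal{M}$ is invariant under $S_n = M_z + F$ if and only if there exist an inner function $\theta \in H^\infty(\mathbb{D})$ and polynomials $p_0,\dots,p_{n-1},q_0,\dots,q_{n-1} \in \mathbb{C}[z]$ such that \[\mathcal{M} = (\mathbb{C}\varphi_0 \oplus \mathbb{C}\varphi_1 \oplus \cdots \oplus \mathbb{C}\varphi_{n-1}) \oplus z^n\theta H^2(\mathbb{D}),\] where $\varphi_i = z^i p_i \theta - q_i$ for all $i = 0, \ldots, n-1$, and \[S_n\varphi_j \in (\mathbb{C}\varphi_{j+1} \oplus \cdots \oplus \mathbb{C}\varphi_{n-1})\oplus z^n\theta H^2(\mathbb{D})\] for all $j = 0, \ldots, n-2$, and $S_n\varphi_{n-1} = z^n p_{n-1}\theta$.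
   Context: $H^2(\mathbb{D})$ is the Hardy space on the open unit disc, $H^\infty(\mathbb{D})$ the bounded analytic functions on $\mathbb{D}$, and $M_z$ the unilateral shift on $H^2(\mathbb{D})$. All operators are bounded. A linear operator $F$ on $H^2(\mathbb{D})$ is an $n$-perturbation if (a) $Fz^m = 0$ for all $m \ge n$; (b) $F(z^m H^2(\mathbb{D})) \subseteq z^{m+1}\mathbb{C}[z]$ for all $m \ge 0$; and (c) $M_z + F$ is left-invertible. The symbol $\oplus$ denotes orthogonal direct sum. *)

(* Defs.v *)
From mathcomp Require Import all_boot all_order all_algebra.
From mathcomp Require Import all_classical all_reals all_analysis.
From mathcomp.real_closed Require Import complex.
Import Order.TTheory GRing.Theory Num.Theory numFieldNormedType.Exports.

Set Implicit Arguments.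
Unset Strict Implicit.
Unset Printing Implicit Defensive.

Local Open Scope ring_scope.
Local Open Scope classical_set_scope.

(* Conventions: the complex field is C := R[i] for an arbitrary R : realType.
   H^2(D) is modelled, via the (isometric) Taylor-coefficient identification
   f(z) = sum_k f_k z^k, as the space of square-summable coefficient sequences
   f : nat -> C.  All "vectors" below are coefficient sequences. *)

Section Hardy.
Context {R : realType}.
Local Notation C := R[i].

Definition cmod (z : C) : R := Num.sqrt (complex.Re z ^+ 2 + complex.Im z ^+ 2).

Definition cseries_to (c : nat -> C) (l : C) : Prop :=
  (fun N => cmod (\sum_(k < N) c k - l)) @ \oo --> (0 : R).

Definition is_H2 (f : nat -> C) : Prop :=
  cvg (series (fun k => cmod (f k) ^+ 2) @ \oo).

Definition h2norm (f : nat -> C) : R :=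
  Num.sqrt (limn (series (fun k => cmod (f k) ^+ 2))).

Definition h2orth (f g : nat -> C) : Prop :=
  cseries_to (fun k => f k * Num.conj (g k)) 0.

Definition coefs (p : {poly C}) : nat -> C := fun k => p`_k.

Definition zpow (m : nat) : nat -> C := fun k => (k == m)%:R.

Definition cmul (a b : nat -> C) : nat -> C :=
  fun k => \sum_(j < k.+1) a j * b (k - j)%N.

Definition Mz (f : nat -> C) : nat -> C :=
  fun k => if k is k'.+1 then f k' else 0.

Definition bounded_op (T : (nat -> C) -> (nat -> C)) : Prop :=
  [/\ forall f, is_H2 f -> is_H2 (T f),
      forall (a : C) f g, is_H2 f -> is_H2 g ->
        T (fun k => a * f k + g k) = (fun k => a * T f k + T g k)
    & exists B : R, forall f, is_H2 f -> h2norm (T f) <= B * h2norm f].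

Definition left_invertible (T : (nat -> C) -> (nat -> C)) : Prop :=
  exists L, bounded_op L /\ forall f, is_H2 f -> L (T f) = f.

Definition Sop (F : (nat -> C) -> (nat -> C)) (f : nat -> C) : nat -> C :=
  fun k => Mz f k + F f k.

Definition n_perturbation (n : nat) (F : (nat -> C) -> (nat -> C)) : Prop :=
  [/\ bounded_op F,
      forall m, (n <= m)%N -> F (zpow m) = (fun _ => 0),
      (* (b) F (z^m H^2) \subseteq z^(m+1) C[z] *)
      forall m f, is_H2 f -> (forall k, (k < m)%N -> f k = 0) ->
        exists p : {poly C}, F f = coefs p /\ forall k, (k < m.+1)%N -> p`_k = 0
    &
      left_invertible (Sop F)].

Definition closed_subspace (M : set (nat -> C)) : Prop :=
  [/\ forall f, M f -> is_H2 f,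
      M (fun _ => 0),
      forall (a : C) f g, M f -> M g -> M (fun k => a * f k + g k)
    & forall (u : nat -> nat -> C) f, (forall i, M (u i)) -> is_H2 f ->
        (fun i => h2norm (fun k => u i k - f k)) @ \oo --> (0 : R) -> M f].

Definition Hinf_fun (c : nat -> C) (theta_fun : C -> C) : Prop :=
  (forall z : C, cmod z < 1 -> cseries_to (fun k => c k * z ^+ k) (theta_fun z))
  /\ exists B : R, forall z : C, cmod z < 1 -> cmod (theta_fun z) <= B.

Definition inner (c : nat -> C) : Prop :=
  exists theta_fun, Hinf_fun c theta_fun /\
    {ae (@lebesgue_measure R), forall t : R, `[0, 2 * pi] t ->
       exists l : C,
         cmod (theta_fun (Complex (r * cos t) (r * sin t)) - l)
            @[r --> (1 : R)^'-] --> (0 : R)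
         /\ cmod l = 1}.

End Hardy.

(* Main.v *)
Require Import Defs.
From mathcomp Require Import all_boot all_order all_algebra.
From mathcomp Require Import all_classical all_reals all_analysis.
From mathcomp.real_closed Require Import complex.
From mathcomp Require Import measurable_realfun ring lra.
Import Order.TTheory GRing.Theory Num.Theory numFieldNormedType.Exports.

(** Write [S = M_z + F] and [M_i] for the elements of [M] divisible by [z^i]. The operator [F]
    kills [z^n H^2], so [S] is the shift there; since [S] is injective and [S M_i] is contained
    in [M_(i+1)], the space [M_n] is [z^n] times a nonzero shift-invariant subspace, and Beurling's
    theorem gives [M_n = z^n theta H^2]. Each [M_i / M_(i+1)] has dimension at most one; let
    [phi_i] span the orthogonal complement of [M_(i+1)] in [M_i]. Then [S^(n-i) phi_i] lies in
    [z^n theta H^2] and differs from [z^(n-i) phi_i] by a polynomial, so that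
    [phi_i = z^i theta h - q] with [q] a polynomial; orthogonality to [z^n theta z^j] for large
    [j] forces [h] to be a polynomial as well.

    In coefficient space Beurling's theorem yields [theta] with orthonormal shifts [z^k theta].
    Testing against the reproducing kernel gives [|theta| <= 1] on the disc. The partial Fourier
    sums of [theta] converge in [L^1] along a subsequence to a boundary function whose Poisson
    integral is [theta]; at its Lebesgue points the radial limit exists, and it has modulus one
    because its [L^2] norm is that of [theta], namely one. *)

Set Implicit Arguments.
Unset Strict Implicit.
Unset Printing Implicit Defensive.
Local Open Scope ring_scope.
Local Open Scope classical_set_scope.

(** * Integrals of continuous functions *)

(** Beurling's theorem only supplies coefficients with orthonormal shifts, whereas [inner] asks for
    radial limits almost everywhere; this gap is why so much of the development is Fourier analysis
    on the circle. The bound on the disc limits the boundary modulus to at most one, and its mean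
    square then forces equality. Convergence in L^1 does not carry squares to the limit, so the mean
    square is recovered by pairing the boundary function with partial sums, which are bounded. On
    the operator side, left-invertibility is what makes [S] injective, and this keeps S^n f, hence
    M_n, nonzero. The coefficients of h are the inner products of theta h with z^j theta, which is
    how orthogonality of phi_i to M_(i+1) can annihilate all but finitely many of them. A generator
    phi_i is allowed to be zero, so no case distinction on the dimension of M_i / M_(i+1) reaches
    the theorem. *)

Section Integrals.
Context {R : realType}.
Implicit Types f g h : R -> R.
Local Notation mu := (@lebesgue_measure R).

Lemma continuous_integrable_itv f a b :
  continuous f -> mu.-integrable `[a, b] (EFin \o f).
Proof.
move=> cf; apply: continuous_compact_integrable; first exact: segment_compact.
exact: continuous_subspaceT.
Qed.

Lemma integrable_mul_continuous f g a b : continuous g ->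
  mu.-integrable `[a, b] (EFin \o f) ->
  mu.-integrable `[a, b] (EFin \o (fun x => g x * f x)).
Proof.
move=> cg fi.
have [M [_ bg]] : exists M, M \is Num.real /\
    forall x, M < x -> forall y, `[a, b] y -> `|g y| <= x.
  have /compact_bounded[M [Mr bM]] : compact (g @` `[a, b]).
    apply: continuous_compact; last exact: segment_compact.
    exact: continuous_subspaceT.
  by exists M; split => // x Mx y aby; apply: bM => //; exists y.
have mg : measurable_fun `[a, b] g.
  by apply: measurable_funTS; exact: continuous_measurable_fun.
have mf : measurable_fun `[a, b] f by apply/measurable_EFinP; case/integrableP : fi.
(* Compactness bounds [g] only by numbers strictly above [M], and [M] may be negative; [|M| + 1] is
   above [M] and nonnegative. *)
have K0 : 0 <= `|M| + 1 by rewrite addr_ge0.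
apply: (@le_integrable _ _ R mu `[a, b]%classic _ (EFin \o (fun x =>
  g x * f x)) (EFin \o (fun x => (`|M| + 1) * f x))) => //.
- exact/measurable_EFinP/measurable_funM.
- move=> x abx /=; rewrite lee_fin !normrM ler_wpM2r//.
  by rewrite (ger0_norm K0) (bg (`|M| + 1))// (le_lt_trans (ler_norm _))// ltrDl.
- have -> : EFin \o (fun x => (`|M| + 1) * f x) =
     (fun x => (`|M| + 1)%:E * (EFin \o f) x)%E by apply/funext => x; rewrite /= EFinM.
  exact: integrableZl.
Qed.

Lemma integrable_EFinD f g (D : set R) : measurable D ->
  mu.-integrable D (EFin \o f) -> mu.-integrable D (EFin \o g) ->
  mu.-integrable D (EFin \o (fun x => f x + g x)).
Proof.
move=> mD fi gi.
rewrite (_ : EFin \o _ = (EFin \o f) \+ (EFin \o g))%E; first exact: integrableD.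
by apply/funext => x /=; rewrite EFinD.
Qed.

Lemma integrable_EFinB f g (D : set R) : measurable D ->
  mu.-integrable D (EFin \o f) -> mu.-integrable D (EFin \o g) ->
  mu.-integrable D (EFin \o (fun x => f x - g x)).
Proof.
move=> mD fi gi.
rewrite (_ : EFin \o _ = (EFin \o f) \- (EFin \o g))%E; first exact: integrableB.
by apply/funext => x /=; rewrite EFinB.
Qed.

Lemma continuous_sum n (F : nat -> R -> R) : (forall k, continuous (F k)) ->
  continuous (fun x => \sum_(k < n) F k x).
Proof.
move=> cF; rewrite (_ : (fun x => _) = \sum_(k < n) F k); last first.
  by apply/funext => x; rewrite fct_sumE.
apply: (big_ind (fun g => continuous g)).
- exact: cst_continuous.
- by move=> f g cf cg x; apply: cvgD; [exact: cf|exact: cg].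
- by move=> k _; exact: cF.
Qed.

Lemma Rintegral_sum n (F : nat -> R -> R) a b : (forall k, continuous (F k)) ->
  (\int[mu]_(x in `[a, b]) (\sum_(k < n) F k x) =
   \sum_(k < n) \int[mu]_(x in `[a, b]) F k x)%R.
Proof.
move=> cF; elim: n => [|n IH].
  under eq_Rintegral do rewrite big_ord0.
  by rewrite big_ord0 Rintegral_cst ?mul0r.
under eq_Rintegral do rewrite big_ord_recr.
rewrite big_ord_recr/= -IH RintegralD//.
- exact/continuous_integrable_itv/continuous_sum.
- exact: continuous_integrable_itv.
Qed.

Lemma Rintegral_FTC f (F : R -> R) a b : a < b -> continuous f ->
  (forall x : R, is_derive x 1 F (f x)) ->
  (\int[mu]_(x in `[a, b]) f x = F b - F a)%R.
Proof.
move=> ab cf dF; have cF : continuous F.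
  move=> x; apply: differentiable_continuous; apply/derivable1_diffP.
  by have [] := dF x.
rewrite /Rintegral (@continuous_FTC2 _ f F)//.
- exact: continuous_subspaceT.
- split.
  + by move=> x _; have [] := dF x.
  + apply: cvg_at_right_filter; exact: cF.
  + apply: cvg_at_left_filter; exact: cF.
- by move=> x _; rewrite derive1E; have [_ ->] := dF x.
Qed.

Lemma continuous_cosl (w c : R) : continuous (fun t => cos (w * t + c)).
Proof.
move=> x; apply: continuous_comp; last exact: continuous_cos.
by apply: cvgD; [exact: mulrl_continuous|exact: cvg_cst].
Qed.

Lemma continuous_sinl (w c : R) : continuous (fun t => sin (w * t + c)).
Proof.
move=> x; apply: continuous_comp; last exact: continuous_sin.
by apply: cvgD; [exact: mulrl_continuous|exact: cvg_cst].
Qed.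

(** The antiderivative sin(k t + c)/k takes equal values at both ends of a period. The base point
    [x] is free because periods centred at t and the period from 0 are both used; the phase [c] is
    free because shifting it turns cosines into sines. *)
Lemma Rintegral_cos k x c : (0 < k)%N ->
  (\int[mu]_(t in `[x, (x + pi *+ 2)]) cos (k%:R * t + c) = 0)%R.
Proof.
move=> k0; have k0' : k%:R != 0 :> R by rewrite pnatr_eq0 -lt0n.
have dF (t : R) : is_derive t 1 (fun t =>
  k%:R^-1 * sin (k%:R * t + c)) (cos (k%:R * t + c)).
  by apply: is_derive_eq; rewrite /GRing.scale/=; field.
have ab : x < x + pi *+ 2 by rewrite ltrDl mulrn_wgt0 ?pi_gt0.
rewrite (Rintegral_FTC ab (@continuous_cosl _ _) dF).
have -> : k%:R * (x + pi *+ 2) + c = k%:R * x + c + pi *+ 2 *+ k.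
  by rewrite -[pi *+ 2 *+ k]mulr_natl; ring.
by rewrite (periodicn (@sinD2pi R)) subrr.
Qed.

Lemma Rintegral_sin k x c : (0 < k)%N ->
  (\int[mu]_(t in `[x, (x + pi *+ 2)]) sin (k%:R * t + c) = 0)%R.
Proof.
move=> k0; rewrite -(@Rintegral_cos k x (c - pi / 2) k0).
by apply: eq_Rintegral => t _; rewrite addrA cosBpihalf.
Qed.

End Integrals.

(** * Limits in mean *)

Section L1.
Context {R : realType}.
Implicit Types f g h : R -> R.
Local Notation mu := (@lebesgue_measure R).

Lemma integrable_Rintegral f (D : set R) : measurable D ->
  mu.-integrable D (EFin \o f) ->
  (\int[mu]_(x in D) (f x)%:E = (\int[mu]_(x in D) f x)%R%:E)%E.
Proof. by move=> mD fi; rewrite /Rintegral fineK//; exact: integrable_fin_num. Qed.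

Lemma integrable_EFin_norm f (D : set R) : measurable D ->
  mu.-integrable D (EFin \o f) -> mu.-integrable D (EFin \o (fun x => `|f x|)).
Proof. by move=> mD fi; exact: (integrable_abse fi). Qed.

Lemma ae_imply (P Q : R -> Prop) : (forall x, P x -> Q x) ->
  {ae mu, forall x, P x} -> {ae mu, forall x, Q x}.
Proof.
move=> PQ [N [mN N0 s]]; exists N; split => // x nQ; apply: s => Px.
exact/nQ/PQ.
Qed.

Lemma ae_conj (P Q : R -> Prop) : {ae mu, forall x, P x} ->
  {ae mu, forall x, Q x} -> {ae mu, forall x, P x /\ Q x}.
Proof.
move=> nP nQ; have := negligibleU nP nQ; apply: negligibleS => x nPQ.
by have [Px|?] := pselect (P x); [right => Qx; exact: nPQ|left].
Qed.

Lemma continuous_sqr f : continuous f -> continuous (fun x => f x ^+ 2).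
Proof.
move=> cf; have -> : (fun x => f x ^+ 2) = (fun x => f x * f x).
  by apply/funext => x; rewrite expr2.
by move=> x; apply: cvgM; exact: cf.
Qed.

(** A Riesz-Fischer argument: the differences are summable in L^1, so their sum is finite almost
    everywhere, the telescoping series converges there, and the same sum dominates the sequence. *)
Lemma L1_limit (f : nat -> R -> R) a b : a <= b -> (forall k, continuous (f k)) ->
  (forall k, \int[mu]_(x in `[a, b]) ((f k.+1 x - f k x) ^+ 2) <= 4^-1 ^+ k)%R ->
  exists2 g : R -> R, mu.-integrable `[a, b] (EFin \o g) &
    (fun k => \int[mu]_(x in `[a, b]) `|f k x - g x|)%R @ \oo --> (0 : R).
Proof.
move=> leab cf bf.
pose D : set R := `[a, b]; have mD : measurable D by exact: measurable_itv.
pose h : nat -> R -> R := fun k x => `|f k.+1 x - f k x|.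
have h0 k x : 0 <= h k x by rewrite /h.
have ch k : continuous (h k).
  move=> x; apply: cvg_norm; apply: cvgB; exact: cf.
have hi k : mu.-integrable D (EFin \o h k) by exact: continuous_integrable_itv.
(* From 2u <= 2^-k + 2^k u^2, integrated: the constant 2^-k contributes (b - a) 2^-k, and the square
   contributes at most 2^k 4^-k = 2^-k. *)
pose C := (b - a) + 1.
have C0 : 0 <= C by rewrite /C; lra.
have hle k : (\int[mu]_(x in D) h k x <= C * 2^-1 ^+ k)%R.
  have c3 : continuous (fun x => (f k.+1 x - f k x) ^+ 2).
    by move=> x; apply: continuous_sqr => y; apply: cvgB; exact: cf.
  have c2 : continuous (fun x => 2 ^+ k * (f k.+1 x - f k x) ^+ 2).
    by move=> x; apply: cvgM; [exact: cvg_cst|exact: c3].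
  have p0 : 0 < 2 ^+ k :> R by rewrite exprn_gt0.
  apply: (@le_trans _ _ (\int[mu]_(x in D) (2^-1 ^+ k + 2 ^+ k * (f k.+1 x - f k x)
    ^+ 2))%R).
    apply: le_Rintegral => //.
      apply: continuous_integrable_itv => x; apply: cvgD; first exact: cvg_cst.
      exact: c2.
    move=> x _; rewrite /h -[leRHS]/(_ + _ * _) -[X in _ <=
      _ + _ * X]real_normK ?num_real//.
    set u := `| _ |; rewrite exprVn.
    have : 0 <= (2 ^+ k)^-1 * (1 - 2 ^+ k * u) ^+ 2.
      by rewrite mulr_ge0 ?sqr_ge0// invr_ge0 ltW.
    have -> : (2 ^+ k)^-1 * (1 - 2 ^+ k * u) ^+ 2 =
      (2 ^+ k)^-1 - u *+ 2 + 2 ^+ k * u ^+ 2.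
      by field; rewrite lt0r_neq0.
    have : 0 <= u by rewrite /u.
    lra.
  rewrite RintegralD//; last 2 first.
  - by apply: continuous_integrable_itv => x; exact: cvg_cst.
  - exact: continuous_integrable_itv.
  rewrite Rintegral_cst// RintegralZl//; last exact: continuous_integrable_itv.
  have := bf k; rewrite -/D => bfk.
  have -> : fine (mu D) = b - a.
    by rewrite /D lebesgue_measure_itv/= lte_fin; case: ifPn => //= nab;
      (have -> : a = b by apply/le_anti; rewrite leab leNgt nab); rewrite subrr.
  rewrite /C mulrDl mul1r mulrC lerD2l.
  rewrite (le_trans (ler_wpM2l (ltW p0) bfk))// -exprMn.
  by have -> : 2 * 4^-1 = 2^-1 :> R by lra.
pose G x := (\sum_(0 <= k <oo) (h k x)%:E)%E.
have mh k : measurable_fun D (EFin \o h k) by case/integrableP : (hi k).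
have G0 x : (0 <= G x)%E by apply: nneseries_ge0 => k _ _; exact: h0.
have mG : measurable_fun D G.
  apply: (eq_measurable_fun (fun x => \sum_(i <oo | i \in xpredT) (h i x)%:E)%E).
    by move=> x _; apply: eq_eseriesl.
  by apply: ge0_emeasurable_sum => [k x _ _|k _]; [exact: h0|exact: mh].
have iG : (\int[mu]_(x in D) G x < +oo)%E.
  rewrite /G integral_nneseries//; last by move=> k x _; exact: h0.
  apply: (@le_lt_trans _ _ (2 * C)%:E); last by rewrite ltry.
  apply: lime_le.
    by apply: is_cvg_nneseries => k _ _; apply: integral_ge0 => x _; exact: h0.
  apply: nearW => m.
  under eq_bigr do rewrite (integrable_Rintegral mD (hi _)).
  rewrite sumEFin lee_fin.
  apply: (@le_trans _ _ (series (geometric C 2^-1) m)).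
    by rewrite /series/=; apply: ler_sum => k _; exact: hle.
  rewrite (le_trans (geometric_le_lim _ _ _ _))//.
  - by rewrite ger0_norm//; lra.
  - have -> : (1 - 2^-1)^-1 = 2 :> R by (have -> : 1 - 2^-1 = 2^-1 :> R by lra);
      rewrite invrK.
    by rewrite mulrC.
have Gi : mu.-integrable D G.
  by apply/integrableP; split => //; under eq_integral do rewrite gee0_abs//.
have f0i : mu.-integrable D (EFin \o (fun x => `|f 0%N x|)).
  by apply: integrable_EFin_norm => //; exact: continuous_integrable_itv.
(* An upper limit is measurable without any knowledge of where the sequence converges, and equals
   the limit where it does. *)
pose g x := fine (limn_esup (fun k => (f k x)%:E)).
have bnd k x : (`|f k x|%:E <= `|f 0%N x|%:E + G x)%E.
  apply: (@le_trans _ _ (`|f 0%N x|%:E + \sum_(0 <= j < k) (h j x)%:E)%E); last first.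
    by rewrite leeD2l//; apply: nneseries_lim_ge => j _ _; exact: h0.
  rewrite sumEFin -EFinD lee_fin.
  elim: k => [|k IH]; first by rewrite big_geq// addr0.
  rewrite big_nat_recr//= addrA -{1}(subrK (f k x) (f k.+1 x)) (le_trans (ler_normD
    _ _))//.
  by rewrite addrC lerD.
have cvgfg : {ae mu, forall x, D x -> (fun k => (f k x)%:E) @ \oo --> (g x)%:E}.
  have Gfin : {ae mu, forall x, D x -> G x \is a fin_num}.
    by apply: integrable_ae Gi; exact: measurable_itv.
  apply: ae_imply Gfin => x /[apply] Gx.
  suff cx : cvgn (f ^~ x).
    have cE : cvgn (fun k => (f k x)%:E) by apply/cvg_ex;
      exists (limn (f ^~ x))%:E; apply/fine_cvgP; split; [exact: nearW|].
    have -> : (g x)%:E = limn (fun k => (f k x)%:E).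
      rewrite /g is_cvg_limn_esupE//.
      have /cvg_lim -> // : (fun k => (f k x)%:E) @ \oo --> (limn (f ^~ x))%:E.
      by apply/fine_cvgP; split; [exact: nearW|].
    by [].
  have : cvgn (series (fun k => f k.+1 x - f k x)).
    apply: normed_cvg; apply: nondecreasing_is_cvgn.
      apply: nondecreasing_series => k _ _; exact: normr_ge0.
    exists (fine (G x)) => _ [k _ <-].
    rewrite -lee_fin fineK// /series/= -sumEFin.
    by apply: nneseries_lim_ge => j _ _; exact: h0.
  rewrite (_ : series _ = (fun k => f k x - f 0%N x)); last first.
    by apply/funext => k; rewrite /series/= telescope_sumr.
  move=> /cvg_ex[l cl]; apply/cvg_ex; exists (l + f 0%N x).
  have -> : f ^~ x = (fun k => f k x - f 0%N x + f 0%N x).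
    by apply/funext => k; rewrite subrK.
  by apply: cvgD => //; exact: cvg_cst.
have mf k : measurable_fun D (EFin \o f k).
  apply/measurable_EFinP; apply: measurable_funTS; exact: continuous_measurable_fun.
have mg : measurable_fun D (EFin \o g).
  apply/measurable_EFinP; apply: (measurableT_comp (fine_measurable measurableT)).
  exact: (measurable_fun_limn_esup (f := fun k x => (f k x)%:E)).
have dom : mu.-integrable D (fun x => `|f 0%N x|%:E + G x)%E.
  by apply: integrableD => //; exact: measurable_itv.
have [|gi cv _] := @dominated_convergence _ _ _ mu D (measurable_itv _)
  (fun k x => (f k x)%:E) (EFin \o g) _ mf mg cvgfg dom.
  by apply: aeW => x k _; exact: bnd.
exists g => //.
have := cv; rewrite (_ : (fun n => _) =
  (fun n => (\int[mu]_(x in D) `|f n x - g x|)%:E)); last first.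
  apply/funext => k.
  rewrite -integrable_Rintegral//=.
  apply: integrable_EFin_norm => //; apply: integrable_EFinB => //.
  exact: continuous_integrable_itv.
by move/fine_cvgP => [].
Qed.

End L1.

(** * Trigonometric sums and the Poisson kernel *)

Section Trig.
Context {R : realType}.
Local Notation mu := (@lebesgue_measure R).
Implicit Types (a b : nat -> R) (r s t x y c d : R).

(** The real part, at z = r e^(it), of a partial sum of the power series with coefficients a_k + i
    b_k. *)
Definition trig a b (N : nat) r t : R :=
  \sum_(k < N) r ^+ k * (a k * cos (k%:R * t) - b k * sin (k%:R * t)).

Lemma continuous_cosn (k : nat) : continuous (fun t : R => cos (k%:R * t)).
Proof.
have -> : (fun t : R => cos (k%:R * t)) = (fun t => cos (k%:R * t + 0)).
  by apply/funext => t; rewrite addr0.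
exact: continuous_cosl.
Qed.

Lemma continuous_sinn (k : nat) : continuous (fun t : R => sin (k%:R * t)).
Proof.
have -> : (fun t : R => sin (k%:R * t)) = (fun t => sin (k%:R * t + 0)).
  by apply/funext => t; rewrite addr0.
exact: continuous_sinl.
Qed.

Lemma continuous_trig_term (u v : R) (k : nat) :
  continuous (fun t : R => u * cos (k%:R * t) - v * sin (k%:R * t)).
Proof.
move=> t; apply: cvgB; apply: cvgM; do ?exact: cvg_cst.
- exact: continuous_cosn.
- exact: continuous_sinn.
Qed.

Lemma continuous_trig a b N r : continuous (trig a b N r).
Proof.
apply: (continuous_sum (F := fun k t =>
  r ^+ k * (a k * cos (k%:R * t) - b k * sin (k%:R * t)))).
move=> k t; apply: cvgM; first exact: cvg_cst.
exact: continuous_trig_term.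
Qed.

Lemma Rintegral_cst_period x (c : R) :
  (\int[mu]_(t in `[x, (x + pi *+ 2)]) c = c * (pi *+ 2))%R.
Proof.
rewrite Rintegral_cst//; congr *%R.
have := @lebesgue_measure_itv R `[x, (x + pi *+ 2)]%O; rewrite /= lte_fin.
by rewrite ltrDl mulrn_wgt0 ?pi_gt0// => ->; rewrite /= addrAC subrr add0r.
Qed.

Lemma Rintegral_cos_sub (j k : nat) x :
  (\int[mu]_(t in `[x, (x + pi *+ 2)]) cos (j%:R * t - k%:R * t) =
   (j == k)%:R * (pi *+ 2))%R.
Proof.
have [jk|kj|->] := ltngtP j k.
- rewrite mul0r -[RHS](@Rintegral_cos _ (k - j) x 0) ?subn_gt0//.
  apply: eq_Rintegral => t _; rewrite addr0 -cosN; congr cos.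
  by rewrite natrB 1?ltnW//; ring.
- rewrite mul0r -[RHS](@Rintegral_cos _ (j - k) x 0) ?subn_gt0//.
  apply: eq_Rintegral => t _; rewrite addr0; congr cos.
  by rewrite natrB 1?ltnW//; ring.
- under eq_Rintegral do rewrite subrr cos0.
  by rewrite Rintegral_cst_period.
Qed.

Lemma Rintegral_sin_sub (j k : nat) x :
  (\int[mu]_(t in `[x, (x + pi *+ 2)]) sin (j%:R * t - k%:R * t) = 0)%R.
Proof.
have [jk|kj|->] := ltngtP j k.
- transitivity (-1 * \int[mu]_(t in `[x, (x + pi *+ 2)]) sin ((k - j)%:R * t +
    0))%R; last first.
    by rewrite Rintegral_sin ?subn_gt0// mulr0.
  rewrite -RintegralZl//; last exact/continuous_integrable_itv/continuous_sinl.
  apply: eq_Rintegral => t _; rewrite addr0 mulN1r -sinN; congr sin.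
  by rewrite natrB 1?ltnW//; ring.
- rewrite -[RHS](@Rintegral_sin _ (j - k) x 0) ?subn_gt0//.
  apply: eq_Rintegral => t _; rewrite addr0; congr sin.
  by rewrite natrB 1?ltnW//; ring.
- under eq_Rintegral do rewrite subrr sin0.
  by rewrite Rintegral_cst// mul0r.
Qed.

Lemma continuous_cos_sub (j k : nat) : continuous (fun t : R =>
  cos (j%:R * t - k%:R * t)).
Proof.
have -> : (fun t : R => cos (j%:R * t - k%:R * t)) =
  (fun t => cos ((j%:R - k%:R) * t + 0)).
  by apply/funext => t; congr cos; ring.
exact: continuous_cosl.
Qed.

Lemma continuous_sin_sub (j k : nat) : continuous (fun t : R =>
  sin (j%:R * t - k%:R * t)).
Proof.
have -> : (fun t : R => sin (j%:R * t - k%:R * t)) =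
  (fun t => sin ((j%:R - k%:R) * t + 0)).
  by apply/funext => t; congr sin; ring.
exact: continuous_sinl.
Qed.

(* [trig b (- a)] is the conjugate of [trig a b]: together they are the real and
   imaginary parts of [\sum_(k < N) (a k + i b k) z ^ k]. *)
Lemma trig_parseval a b M N x : (M <= N)%N ->
  (\int[mu]_(t in `[x, (x + pi *+ 2)])
     (trig a b M 1 t * trig a b N 1 t +
      trig b (fun k => - a k) M 1 t * trig b (fun k => - a k) N 1 t) =
   (pi *+ 2) * \sum_(k < M) (a k ^+ 2 + b k ^+ 2))%R.
Proof.
move=> MN.
(* With c = a + i b this is the real part of c_j conj(c_k) e^(i(j-k)t). Only j = k survives
   integration, and [M <= N] guarantees that every j < M meets its diagonal term. *)
pose G (j k : nat) t : R := (a j * a k + b j * b k) * cos (j%:R * t - k%:R * t) +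
  (a j * b k - b j * a k) * sin (j%:R * t - k%:R * t).
have cG j k : continuous (G j k).
  move=> t; apply: cvgD; apply: cvgM; do ?exact: cvg_cst.
  - exact: continuous_cos_sub.
  - exact: continuous_sin_sub.
transitivity (\int[mu]_(t in `[x, (x + pi *+ 2)]) (\sum_(j < M) \sum_(k < N) G j k
  t))%R.
  apply: eq_Rintegral => t _; rewrite /trig !mulr_suml -big_split/=.
  apply: eq_bigr => j _; rewrite !mulr_sumr -big_split/=; apply: eq_bigr => k _.
  by rewrite !expr1n /G cosB sinB; ring.
rewrite (@Rintegral_sum _ M (fun j t => \sum_(k < N) G j k t)); last first.
  by move=> j; exact: continuous_sum.
rewrite mulr_sumr; apply: eq_bigr => j _; rewrite (@Rintegral_sum _ N (G j))//.
have jN : (j < N)%N by exact: leq_trans MN.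
have GE k : (\int[mu]_(t in `[x, (x + pi *+ 2)]) G j k t =
  (a j * a k + b j * b k) * ((j == k :> nat)%:R * (pi *+ 2)))%R.
  rewrite RintegralD//; last 2 first.
  - apply: continuous_integrable_itv => t; apply: cvgM; first exact: cvg_cst.
    exact: continuous_cos_sub.
  - apply: continuous_integrable_itv => t; apply: cvgM; first exact: cvg_cst.
    exact: continuous_sin_sub.
  rewrite !RintegralZl//; last 2 first.
  - exact/continuous_integrable_itv/continuous_sin_sub.
  - exact/continuous_integrable_itv/continuous_cos_sub.
  by rewrite Rintegral_cos_sub Rintegral_sin_sub mulr0 addr0.
rewrite (bigD1 (Ordinal jN))//= GE eqxx mul1r big1 ?addr0.
  by ring.
move=> k kj; rewrite GE; have /negbTE -> : (j != k :> nat).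
  by rewrite eq_sym; apply: contra kj => /eqP kj; apply/eqP/val_inj.
by rewrite mul0r mulr0.
Qed.

(** The kernel carries no factor 1/(2 pi): its integral over a period is 2 pi, whence the factors
    [pi *+ 2] below. *)
Definition poisson r s : R := (1 - r ^+ 2) / (1 - 2 * r * cos s + r ^+ 2).

Lemma poisson_den r s : 0 <= r < 1 -> (1 - r) ^+ 2 <= 1 - 2 * r * cos s + r ^+ 2.
Proof.
move=> /andP[r0 r1]; have := ler_wpM2l r0 (cos_le1 s); nra.
Qed.

Lemma poisson_den_gt0 r s : 0 <= r < 1 -> 0 < 1 - 2 * r * cos s + r ^+ 2.
Proof.
move=> r01; apply: lt_le_trans (poisson_den s r01).
by case/andP: r01 => r0 r1; rewrite exprn_gt0// subr_gt0.
Qed.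

Lemma poisson_ge0 r s : 0 <= r < 1 -> 0 <= poisson r s.
Proof.
move=> r01; rewrite divr_ge0 ?(ltW (poisson_den_gt0 s r01))//.
by case/andP: r01 => r0 r1; rewrite subr_ge0 expr_le1// ltW.
Qed.

(** Clearing the denominator gives a relation linear in the kernel; integrated against cosines it
    becomes a three-term recurrence for the Fourier coefficients. *)
Lemma poissonE r s : 0 <= r < 1 ->
  (1 + r ^+ 2) * poisson r s - 2 * r * (cos s * poisson r s) = 1 - r ^+ 2.
Proof.
move=> r01; rewrite /poisson; field.
by have := poisson_den_gt0 s r01; rewrite lt0r => /andP[].
Qed.

Lemma poisson_le r s : 0 <= r < 1 -> poisson r s <= 2 / (1 - r).
Proof.
move=> r01; have p0 := poisson_den_gt0 s r01; have := poisson_den s r01.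
case/andP: r01 => r0 r1 le; rewrite /poisson ler_pdivrMr//.
have d0 : 0 < 1 - r by lra.
apply: (@le_trans _ _ (2 / (1 - r) * (1 - r) ^+ 2)).
  rewrite expr2 mulrA divfK ?lt0r_neq0//.
  rewrite -subr_ge0 (_ : _ - _ = (1 - r) ^+ 2); last ring.
  exact: sqr_ge0.
by rewrite ler_wpM2l// divr_ge0// ltW.
Qed.

Lemma continuous_poisson r t : 0 <= r < 1 -> continuous (fun y => poisson r (y - t)).
Proof.
move=> r01 y; apply: cvgM; first exact: cvg_cst.
apply: cvgV; first by rewrite lt0r_neq0// poisson_den_gt0.
apply: cvgD; last exact: cvg_cst.
apply: cvgB; first exact: cvg_cst.
apply: cvgM; first exact: cvg_cst.
have cc : continuous (fun y => cos (y - t)).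
  have -> : (fun y => cos (y - t)) = (fun y => cos (1 * y - t)).
    by apply/funext => ?; rewrite mul1r.
  exact: continuous_cosl.
exact: cc.
Qed.

(* The characteristic roots are [r] and [1 / r]; boundedness excludes the second. *)
Lemma bounded_recurrence (r B : R) (I : nat -> R) : 0 <= r < 1 ->
  (forall k, `|I k| <= B) ->
  (forall k, (1 + r ^+ 2) * I k.+1 = r * (I k.+2 + I k)) ->
  forall k, I k = r ^+ k * I 0%N.
Proof.
move=> /andP[r0 r1] IB rec.
pose J k := I k.+1 - r * I k.
have rJ k : J k = r * J k.+1 by rewrite /J; have := rec k; nra.
have rJm m k : J k = r ^+ m * J (k + m)%N.
  elim: m => [|m IH]; first by rewrite mul1r addn0.
  by rewrite IH (rJ (k + m)%N) exprSr mulrA addnS.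
have JB k : `|J k| <= B + B.
  rewrite (le_trans (ler_normB _ _))// lerD// normrM ger0_norm//.
  by rewrite (le_trans _ (IB k))// ler_piMl// ltW.
have J0 k : J k = 0.
  apply/normr0_eq0/le_anti; rewrite normr_ge0 andbT.
  have c : (fun m => (B + B) * r ^+ m) @ \oo --> (0 : R).
    by apply: cvg_geometric; rewrite ger0_norm.
  rewrite -(cvg_lim (@Rhausdorff R) c); apply: limr_ge; first exact: cvgP c.
  apply: nearW => m.
  rewrite (rJm m k) normrM (ger0_norm (exprn_ge0 m r0)) mulrC.
  by rewrite ler_wpM2r ?exprn_ge0.
elim=> [|k IH]; first by rewrite mul1r.
by rewrite exprS -mulrA -IH; apply/eqP; rewrite -subr_eq0; apply/eqP; exact: J0.
Qed.

(** The Fourier coefficients of the kernel are found without expanding it in a series: they satisfy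
    the recurrence of [bounded_recurrence], and the relation [poissonE] fixes the initial value. *)
Lemma poisson_cos r t (k : nat) d : 0 <= r < 1 ->
  (\int[mu]_(y in `[(t - pi), (t - pi + pi *+ 2)])
     (poisson r (y - t) * cos (k%:R * y + d)) =
   (pi *+ 2) * (r ^+ k * cos (k%:R * t + d)))%R.
Proof.
(* The cosine is cos(k(y - t) + c), so multiplication by cos(y - t) moves k by one in either
   direction and leaves [c] unchanged. *)
move=> r01; pose E c (k : nat) y := poisson r (y - t) * cos (k%:R * y + (c - k%:R * t)).
pose D : set R := `[(t - pi), (t - pi + pi *+ 2)].
have mD : measurable D by exact: measurable_itv.
have cE c k' : continuous (E c k').
  move=> y; apply: cvgM; first exact: continuous_poisson.
  exact: continuous_cosl.
have iE c k' : mu.-integrable D (EFin \o E c k') by exact: continuous_integrable_itv.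
have iZ (u : R) (f : R -> R) : continuous f ->
  mu.-integrable D (EFin \o (fun y => u * f y)).
  by move=> cf; apply: continuous_integrable_itv => y; apply: cvgM;
    [exact: cvg_cst|exact: cf].
pose I c k' := (\int[mu]_(y in D) E c k' y)%R.
have cosS c k' y : 2 * (cos (y - t) * cos (k'.+1%:R * y + (c - k'.+1%:R * t))) =
   cos (k'.+2%:R * y + (c - k'.+2%:R * t)) + cos (k'%:R * y + (c - k'%:R * t)).
  have -> : k'.+2%:R * y + (c - k'.+2%:R * t) =
    (k'.+1%:R * y + (c - k'.+1%:R * t)) + (y - t).
    by rewrite -[k'.+2]addn1 natrD; ring.
  have -> : k'%:R * y + (c - k'%:R * t) = (k'.+1%:R * y + (c - k'.+1%:R * t)) - (y - t).
    by rewrite -[k'.+1]addn1 natrD; ring.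
  set A := _ + (c - k'.+1%:R * t); set B := y - t; rewrite (cosD A B) (cosB A B); ring.
have rec c k' : (1 + r ^+ 2) * I c k'.+1 = r * (I c k'.+2 + I c k').
  have H : (\int[mu]_(y in D) ((1 - r ^+ 2) * cos (k'.+1%:R * y + (c - k'.+1%:R *
    t))) = 0)%R.
    rewrite RintegralZl//; last exact/continuous_integrable_itv/continuous_cosl.
    by rewrite Rintegral_cos// mulr0.
  apply/eqP; rewrite -subr_eq0 -H -RintegralD// -!RintegralZl//; last first.
    by apply: continuous_integrable_itv => y; apply: cvgD; exact: cE.
  rewrite -RintegralB//; last 2 first.
  - exact: iZ.
  - by apply: iZ => y; apply: cvgD; exact: cE.
  apply/eqP; apply: eq_Rintegral => y _.
  by rewrite /E -mulrDr -cosS -(poissonE (y - t) r01); ring.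
have IB c k' : `|I c k'| <= 2 / (1 - r) * (pi *+ 2).
  have r1 : 0 <= 2 / (1 - r) by case/andP: r01 => ? ?; rewrite divr_ge0//; lra.
  rewrite (le_trans (le_normr_Rintegral _ (iE c k')))//.
  have -> : 2 / (1 - r) * (pi *+ 2) = (\int[mu]_(y in D) (2 / (1 - r)))%R.
    by rewrite Rintegral_cst_period.
  apply: le_Rintegral => //.
  - exact: integrable_EFin_norm.
  - by apply: continuous_integrable_itv => y; exact: cvg_cst.
  move=> y _; rewrite normrM ger0_norm ?poisson_ge0//.
  rewrite -[leRHS]mulr1 ler_pM ?poisson_ge0 ?poisson_le//.
  by rewrite ler_norml cos_geN1 cos_le1.
have IE c k' := bounded_recurrence r01 (IB c) (rec c) k'.
(* Integrating [poissonE] gives (1 + r^2) I_0 - 2 r I_1 = (1 - r^2) 2 pi, and I_1 = r I_0 makes the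
   left side (1 - r^2) I_0. *)
have I00 : I 0 0%N = pi *+ 2.
  have H : (1 + r ^+ 2) * I 0 0%N - 2 * r * I 0 1%N = (1 - r ^+ 2) * (pi *+ 2).
    transitivity (\int[mu]_(y in D) (1 - r ^+ 2))%R; last first.
      by rewrite Rintegral_cst_period.
    rewrite -!RintegralZl// -RintegralB//; last 2 first.
    - exact: iZ.
    - exact: iZ.
    apply: eq_Rintegral => y _; rewrite /E -(poissonE (y - t) r01).
    rewrite !mul0r subr0 addr0 cos0 !mul1r add0r; ring.
  have r2 : 1 - r ^+ 2 != 0.
    by case/andP: r01 => r0 r1; rewrite lt0r_neq0// subr_gt0 expr_lt1.
  apply: (mulfI r2); rewrite -H (IE 0 1%N) expr1; ring.
have I0 c : I c 0%N = cos c * (pi *+ 2).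
  rewrite -I00 -RintegralZl//; apply: eq_Rintegral => y _.
  by rewrite /E !mul0r !subr0 !add0r cos0; ring.
(* The phase k t + d undoes the centring at t. *)
transitivity (I (k%:R * t + d) k); last by rewrite IE I0; ring.
apply: eq_Rintegral => y _; congr (_ * cos _); ring.
Qed.

Lemma poisson_trig a b N r t : 0 <= r < 1 ->
  (\int[mu]_(y in `[(t - pi), (t - pi + pi *+ 2)])
     (poisson r (y - t) * trig a b N 1 y) = (pi *+ 2) * trig a b N r t)%R.
Proof.
move=> r01.
pose P d (k : nat) y := poisson r (y - t) * cos (k%:R * y + d).
have cP d k : continuous (P d k).
  move=> y; apply: cvgM; first exact: continuous_poisson.
  exact: continuous_cosl.
have cZ (u : R) (f : R -> R) : continuous f -> continuous (fun y => u * f y).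
  by move=> cf y; apply: cvgM; [exact: cvg_cst|exact: cf].
transitivity (\int[mu]_(y in `[(t - pi), (t - pi + pi *+ 2)])
    (\sum_(k < N) (a k * P 0 k y + b k * P (pi / 2) k y)))%R.
  apply: eq_Rintegral => y _; rewrite mulr_sumr; apply: eq_bigr => k _.
  by rewrite /P expr1n addr0 cosDpihalf; ring.
rewrite (@Rintegral_sum _ N (fun k y => a k * P 0 k y + b k * P (pi / 2) k y));
  last first.
  by move=> k y; apply: cvgD; exact: cZ.
rewrite mulr_sumr; apply: eq_bigr => k _.
rewrite RintegralD//; last 2 first.
- exact/continuous_integrable_itv/cZ.
- exact/continuous_integrable_itv/cZ.
rewrite !RintegralZl//; do ?exact: continuous_integrable_itv.
by rewrite !poisson_cos// addr0 cosDpihalf; ring.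
Qed.

End Trig.

(** * Poisson integrals at Lebesgue points *)

Section PoissonLimit.
Context {R : realType}.
Local Notation mu := (@lebesgue_measure R).
Implicit Types (r s t x y c d : R).

(** Near 0 the cosine exceeds 1/2, so the mean value theorem gives sin u >= u/2 for u = |s|/2; then
    1 - cos s = 2 sin(u)^2 >= 2 (|s|/4)^2 = s^2/8. *)
Lemma cos_quadratic : exists2 d : R, 0 < d &
  forall s, `|s| < d -> s ^+ 2 / 8 <= 1 - cos s.
Proof.
have : \forall s \near (0 : R), 2^-1 < cos s.
  have c0 : cos s @[s --> (0 : R)] --> (1 : R) by rewrite -[X in _ --> X]cos0;
    exact: continuous_cos.
  by apply: (cvgr_gt _ c0); lra.
move=> /nbhs_ballP[d /= d0 Hd]; exists d => // s sd.
have cs : cos s = cos `|s| by have [_|_] := ler0P s; rewrite ?cosN.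
pose u := `|s| / 2.
have u0 : 0 <= u by rewrite /u divr_ge0.
have su : u / 2 <= sin u.
  have [->|un0] := eqVneq u 0; first by rewrite mul0r sin0.
  have u1 : 0 < u by rewrite lt0r un0.
  have [|c] := @MVT R sin cos 0 u u1 (fun x _ => is_derive_sin x).
    exact/continuous_subspaceT/continuous_sin.
  rewrite in_itv/= => /andP[c0 cu]; rewrite sin0 !subr0 => ->.
  have : ball (0 : R) d c.
    by rewrite -ball_normE/= sub0r normrN gtr0_norm//; rewrite /u in cu;
      have := normr_ge0 s; lra.
  by move=> /Hd; nra.
have -> : cos s = 1 - 2 * sin u ^+ 2.
  rewrite cs (_ : `|s| = u + u); last by rewrite /u; lra.
  by rewrite cosD -!expr2 cos2sin2; ring.
have -> : s ^+ 2 = (2 * u) ^+ 2 by rewrite -[LHS]real_normK ?num_real//;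
  congr (_ ^+ 2); rewrite /u; lra.
by nra.
Qed.

(** The denominator is (1 - r)^2 + 2 r (1 - cos s), and 2 r >= 1. This gives a lower bound free of
    r, which (1 - r)^2 does not. *)
Lemma poisson_den_cos r s : 2^-1 <= r -> 1 - cos s <= 1 - 2 * r * cos s + r ^+ 2.
Proof.
move=> r2; rewrite -subr_ge0.
have -> : 1 - 2 * r * cos s + r ^+ 2 - (1 - cos s) =
  (1 - r) ^+ 2 + (2 * r - 1) * (1 - cos s).
  by ring.
by rewrite addr_ge0 ?sqr_ge0// mulr_ge0//; have := cos_le1 s; lra.
Qed.

Lemma oneB_sqr_le r : 1 - r ^+ 2 <= 2 * (1 - r).
Proof.
rewrite -subr_ge0 (_ : _ - _ = (1 - r) ^+ 2); last by ring.
exact: sqr_ge0.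
Qed.

Lemma poisson_le_den r s (m : R) : 2^-1 <= r < 1 -> 0 < m -> m <= 1 - cos s ->
  poisson r s <= 2 * (1 - r) / m.
Proof.
move=> /andP[r2 r1] m0 mc; have r01 : 0 <= r < 1 by apply/andP; lra.
rewrite /poisson ler_pdivrMr ?poisson_den_gt0// mulrAC ler_pdivlMr//.
have := poisson_den_cos s r2; set D := (X in _ <= X) => cD.
have mD : m <= D by exact: le_trans cD.
apply: (@le_trans _ _ (2 * (1 - r) * m));
  first by rewrite ler_wpM2r ?(ltW m0)// oneB_sqr_le.
by rewrite ler_wpM2l//; lra.
Qed.

(** The decay of the kernel away from its peak. The constant 16 is 2 * 8: the 2 from 1 - r^2 <= 2 (1
    - r), the 8 from the quadratic bound on the cosine. *)
Lemma poisson_sqr r s : 2^-1 <= r < 1 -> s ^+ 2 / 8 <= 1 - cos s ->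
  poisson r s * s ^+ 2 <= 16 * (1 - r).
Proof.
move=> /andP[r2 r1] sc; have r01 : 0 <= r < 1 by apply/andP; lra.
rewrite /poisson mulrAC ler_pdivrMr ?poisson_den_gt0//.
have := poisson_den_cos s r2; set D := (X in _ <= X) => cD.
have sD : s ^+ 2 <= 8 * D by lra.
have D0 : 0 <= D by apply: le_trans cD; have := cos_le1 s; lra.
apply: (@le_trans _ _ ((1 - r ^+ 2) * (8 * D))).
  by rewrite ler_wpM2l// subr_ge0 expr_le1// ltW//; lra.
by rewrite mulrA ler_wpM2r//; have := oneB_sqr_le r; lra.
Qed.

Lemma dyadic_bracket (e d : R) : 0 < e -> e <= d ->
  exists J, 2 ^+ J * e <= d < 2 ^+ J.+1 * e.
Proof.
move=> e0 ed.
have ex : exists J, d < 2 ^+ J * e.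
  have [n dn] : exists n : nat, d / e < n%:R.
    by exists (Num.bound (d / e));
      rewrite archi_boundP// divr_ge0// ltW// (lt_le_trans e0).
  exists n; rewrite -ltr_pdivrMr// (lt_le_trans dn)// -natrX ler_nat.
  exact/ltnW/ltn_expl.
have [J dJ mJ] := ex_minnP ex.
case: J dJ mJ => [|J] dJ mJ; first by move: dJ; rewrite expr0 mul1r ltNge ed.
exists J; rewrite dJ andbT leNgt; apply/negP => /mJ; by rewrite ltnn.
Qed.

(** * Kernels of height 2/eta with quadratic decay, integrated against a function of small means *)

Section Dyadic.
Variables (t eta delta eps : R) (g K : R -> R).
Hypotheses (eta0 : 0 < eta) (eps0 : 0 <= eps).
Hypotheses (mg : measurable_fun setT g) (mK : measurable_fun setT K).
Hypotheses (g0 : forall y, 0 <= g y) (K0 : forall y, 0 <= K y).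
Hypothesis Keta : forall y, K y <= 2 / eta.
Hypothesis Ksqr : forall y, `|y - t| < delta -> K y * (y - t) ^+ 2 <= 16 * eta.
Hypothesis gint : forall h, 0 < h -> h <= delta ->
  (\int[mu]_(y in ball t h) (g y)%:E <= (eps * 2 * h)%:E)%E.

Let mKg (D : set R) : measurable_fun D (fun y => (K y * g y)%:E).
Proof. by apply/measurable_EFinP/measurable_funTS; exact: measurable_funM. Qed.

Let mgE (D : set R) : measurable_fun D (fun y => (g y)%:E).
Proof. by apply/measurable_EFinP/measurable_funTS. Qed.

Lemma le_integral_const (D : set (measurableTypeR R)) (c : R) : measurable D ->
  0 <= c ->
  (forall y, D y -> K y <= c) ->
  (\int[mu]_(y in D) (K y * g y)%:E <= c%:E * \int[mu]_(y in D) (g y)%:E)%E.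
Proof.
move=> mD c0 Kc.
have <- : (\int[mu]_(y in D) (c%:E * (g y)%:E) = c%:E * \int[mu]_(y in D) (g y)%:E)%E.
  apply: (@ge0_integralZl_EFin _ _ R mu D mD) => //; last exact: mgE.
  by move=> y _; rewrite lee_fin.
apply: (@ge0_le_integral _ _ R mu D mD) => //.
- by move=> y _; rewrite lee_fin mulr_ge0.
- exact: mKg.
- by apply: measurable_funeM; exact: mgE.
- by move=> y Dy; rewrite -EFinM lee_fin ler_wpM2r// Kc.
Qed.

Lemma le_integral_split (A B : set (measurableTypeR R)) : measurable A ->
  measurable B ->
  (\int[mu]_(y in B) (K y * g y)%:E <=
   \int[mu]_(y in A) (K y * g y)%:E + \int[mu]_(y in B `\` A) (K y * g y)%:E)%E.
Proof.
move=> mA mB.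
have Kg0 y : (0 <= (K y * g y)%:E)%E by rewrite lee_fin mulr_ge0.
have mBA : measurable (B `\` A) by exact: measurableD.
have <- : (\int[mu]_(y in A `|` (B `\` A)) (K y * g y)%:E =
   \int[mu]_(y in A) (K y * g y)%:E + \int[mu]_(y in B `\` A) (K y * g y)%:E)%E.
  apply: (@ge0_integral_setU _ _ R mu) => //; first exact: mKg.
  by apply/disj_setPS => y [Ay [_]].
apply: (@ge0_subset_integral _ _ R mu) => //.
- exact: measurableU.
- exact: mKg.
- by move=> y By; have [Ay|nAy] := pselect (A y); [left|right].
Qed.

(* Each dyadic shell [2^J eta <= |y - t| < 2^(J+1) eta] contributes [64 eps / 2^J]. *)
Lemma dyadic_integral J : 2 ^+ J * eta <= delta ->
  (\int[mu]_(y in ball t (2 ^+ J * eta)) (K y * g y)%:E <=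
     (eps * (132 - 128 / 2 ^+ J))%:E)%E.
Proof.
elim: J => [|J IH] Jd.
  (* On the innermost ball the height 2/eta meets a mass of at most 2 eps eta, giving 4 eps = eps
     (132 - 128). The 128 is the sum of 64/2^J over all shells. *)
  rewrite expr0 mul1r in Jd *.
  apply: (le_trans (le_integral_const (c := 2 / eta) _ _ _)) => //.
  - exact: measurable_ball.
  - by rewrite divr_ge0// ltW.
  apply: (le_trans (lee_wpmul2l _ (gint eta0 Jd))).
    by rewrite lee_fin divr_ge0// ltW.
  rewrite -EFinM lee_fin le_eqVlt; apply/orP; left; apply/eqP; field.
  by rewrite lt0r_neq0.
set h := 2 ^+ J * eta.
have p0 : 0 < 2 ^+ J :> R by rewrite exprn_gt0.
have h0 : 0 < h by rewrite mulr_gt0.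
have hE : 2 ^+ J.+1 * eta = 2 * h by rewrite exprS -mulrA.
rewrite hE in Jd *.
have hd : h <= delta by lra.
apply: (le_trans (@le_integral_split (ball t h) _ _ _)); do ?exact: measurable_ball.
(* Outside the ball of radius h the kernel is at most 16 eta/h^2, while the mass of [g] on the shell
   is at most that of the ball of radius 2h. *)
apply: (@le_trans _ _ ((eps * (132 - 128 / 2 ^+ J))%:E + (16 * eta / h ^+ 2 * (eps
  * 2 * (2 * h)))%:E)%E).
  apply: leeD; first exact: IH.
  apply: (le_trans (le_integral_const (c := 16 * eta / h ^+ 2) _ _ _)).
  - by apply: measurableD; exact: measurable_ball.
  - by rewrite divr_ge0 ?sqr_ge0// mulr_ge0// ltW.
  - move=> y [+ +]; rewrite -!ball_normE/= distrC => y2 /negP; rewrite -leNgt => y1.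
    rewrite ler_pdivlMr ?exprn_gt0//.
    apply: (le_trans _ (Ksqr (lt_le_trans y2 Jd))).
    rewrite ler_wpM2l// -[leRHS]real_normK ?num_real//.
    by rewrite lerXn2r ?nnegrE ?(ltW h0).
  rewrite [leRHS]EFinM lee_wpmul2l ?lee_fin//.
    by rewrite divr_ge0 ?sqr_ge0// mulr_ge0// ltW.
  apply: le_trans (gint (_ : 0 < 2 * h) Jd); last by rewrite mulr_gt0.
  apply: ge0_subset_integral => //; do ?exact: measurable_ball.
  - by apply: measurableD; exact: measurable_ball.
  - exact: mgE.
  - by move=> y _; rewrite lee_fin.
rewrite -EFinD lee_fin le_eqVlt; apply/orP; left; apply/eqP.
rewrite (exprS _ J) /h; move: p0; set p := 2 ^+ J => p0; field.
by rewrite !lt0r_neq0.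
Qed.

End Dyadic.

(** The dyadic bound stays below 132 eps, so eps = e/264 spends half of the allowed error. *)
Lemma near_budget (e x : R) : 0 < e -> 0 < x -> e / 264 * (132 - x) <= e / 2.
Proof. by move=> e0 x0; rewrite mulrBr; have := mulr_gt0 e0 x0; lra. Qed.

(** The other half pays for the points away from t; here u = 1 - r and [G] is the total mass,
    increased by one because it may vanish. *)
Lemma far_budget (u c e G : R) : 0 < c -> 0 <= u -> 0 <= G ->
  u <= c * e / (4 * (G + 1)) -> 2 * u / c * G <= e / 2.
Proof.
move=> c0 u0 G0; have G1 : 0 < 4 * (G + 1) by lra.
by rewrite ler_pdivlMr// => H; rewrite mulrAC ler_pdivrMr//; lra.
Qed.

Lemma lebesgue_pt_ball (f : R -> R) t (e : R) : 0 < e -> lebesgue_pt f t ->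
  exists2 d : R, 0 < d & forall h, 0 < h -> h < d ->
    (\int[mu]_(y in ball t h) `|f y - f t|%:E <= (e * 2 * h)%:E)%E.
Proof.
move=> e0 /fine_cvgP[fin /cvgr0_norm_lt/(_ e e0) lt].
have : \forall h \near (0 : R)^'+, davg f t h \is a fin_num /\ `|fine (davg f t h)| < e.
  by apply: filterS2 fin lt => h.
move=> /nbhs_ballP[d /= d0 Hd]; exists d => // h h0 hd.
have [] := Hd h _ h0; first by rewrite -ball_normE/= sub0r normrN gtr0_norm.
move=> fi; rewrite ger0_norm ?fine_ge0 ?davg_ge0// => lte.
have : (davg f t h <= e%:E)%E by rewrite -(fineK fi) lee_fin ltW.
rewrite /davg /iavg (lebesgue_measure_ball _ (ltW h0)) inver mulrn_eq0/= gt_eqF//.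
rewrite lee_pdivrMl ?mulrn_wgt0// -EFinM => H.
rewrite (_ : e * 2 * h = h *+ 2 * e); last by rewrite -mulr_natl; ring.
exact: H.
Qed.

(** The period is cut at a radius comparable to a fixed d. Inside, small means of |f - f t| are
    played against the decay of the kernel; outside, the kernel tends to 0 uniformly as r tends to
    1. *)
Lemma poisson_approx (f : R -> R) t (e : R) : 0 < e -> measurable_fun setT f ->
  mu.-integrable `[(t - pi), (t - pi + pi *+ 2)] (EFin \o f) -> lebesgue_pt f t ->
  \forall r \near (1 : R)^'-,
    (\int[mu]_(y in `[(t - pi)%R, (t - pi + pi *+ 2)%R])
       (poisson r (y - t) * `|f y - f t|)%:E <= e%:E)%E.
Proof.
move=> e0 mf fi lp.
pose I : set R := `[(t - pi), (t - pi + pi *+ 2)].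
have mI : measurable I by exact: measurable_itv.
pose g y := `|f y - f t|.
have mg : measurable_fun setT g.
  by apply: measurableT_comp => //; apply: measurable_funB.
have gi : mu.-integrable I (EFin \o g).
  apply: integrable_EFin_norm => //; apply: integrable_EFinB => //.
  by apply: continuous_integrable_itv => y; exact: cvg_cst.
have [d0 d0_gt0 Hd0] := cos_quadratic.
have e1 : 0 < e / 264 by rewrite divr_gt0 ?ltr0n.
have [d1 d1_gt0 Hd1] := lebesgue_pt_ball e1 lp.
have [d [d_gt0 dd0 dd1 dle1]] : exists d, [/\ 0 < d, d < d0, d < d1 & d < 1].
  have m1 : Num.min (Num.min d0 d1) 1 <= 1 by rewrite ge_min lexx orbT.
  have m2 : Num.min (Num.min d0 d1) 1 <= d0 by rewrite !ge_min lexx.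
  have m3 : Num.min (Num.min d0 d1) 1 <= d1 by rewrite !ge_min lexx orbT.
  have : 0 < Num.min (Num.min d0 d1) 1 by rewrite !lt_min d0_gt0 d1_gt0 ltr01.
  by move=> m0; exists (Num.min (Num.min d0 d1) 1 / 2); split; lra.
have dpi : d / 2 <= pi by have := @pi_ge2 R; lra.
(* Since the cosine decreases on [0, pi], 1 - cos s >= c for d/2 <= |s| <= pi. *)
have [c c0 cE] : exists2 c, 0 < c & c = 1 - cos (d / 2).
  exists (1 - cos (d / 2)) => //.
  apply: lt_le_trans (Hd0 (d / 2) _); first by rewrite divr_gt0// exprn_gt0// divr_gt0.
  by rewrite gtr0_norm ?divr_gt0//; lra.
have [G G0 GE] : exists2 G, 0 <= G & (\int[mu]_(y in I) (g y)%:E = G%:E)%E.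
  exists (\int[mu]_(y in I) g y)%R; last exact: integrable_Rintegral.
  by apply: Rintegral_ge0 => y _; rewrite /g.
have k0 : 0 < c * e / (4 * (G + 1)) by rewrite divr_gt0 ?mulr_gt0//; lra.
near=> r.
have r2 : 2^-1 <= r by near: r; apply: nbhs_left_ge; lra.
have r1 : r < 1 by near: r; exact: nbhs_left_lt.
have rd : 1 - r <= d.
  rewrite lerBlDr addrC -lerBlDr; near: r; apply: nbhs_left_ge.
  by rewrite ltrBlDr ltrDl.
have rk : 1 - r <= c * e / (4 * (G + 1)).
  rewrite lerBlDr addrC -lerBlDr; near: r; apply: nbhs_left_ge.
  by rewrite ltrBlDr ltrDl.
have r01 : 0 <= r < 1 by rewrite r1 andbT (le_trans _ r2).
have r21 : 2^-1 <= r < 1 by rewrite r2.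
have eta0 : 0 < 1 - r by rewrite subr_gt0.
pose K y := poisson r (y - t).
have mK : measurable_fun setT K by apply: continuous_measurable_fun;
  exact: continuous_poisson.
have K0 y : 0 <= K y by exact: poisson_ge0.
have g0 y : 0 <= g y by rewrite /g.
(* The cut is at h = 2^J (1 - r), with d/2 < h <= d: small enough for the local bounds, and large
   enough that [c], chosen before r, controls the rest. *)
have [J /andP[Jd dJ]] := dyadic_bracket eta0 rd.
have [h hE] : exists h, h = 2 ^+ J * (1 - r) by exists (2 ^+ J * (1 - r)).
rewrite -hE in Jd.
have dh : d / 2 < h by rewrite ltr_pdivrMr// mulrC hE mulrA -exprS.
apply: (le_trans (le_integral_split mg mK g0 K0 (measurable_ball t h) mI)).
have near_part : (\int[mu]_(y in ball t h) (K y * g y)%:E <= (e / 2)%:E)%E.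
  rewrite hE in Jd *.
  apply: (@le_trans _ _ (e / 264 * (132 - 128 / 2 ^+ J))%:E); last first.
    by rewrite lee_fin near_budget// divr_gt0// exprn_gt0.
  apply: (dyadic_integral (delta := d)) => //.
  - by move=> y; exact: poisson_le.
  - by move=> y yd; apply: poisson_sqr => //; apply: Hd0; exact: lt_trans yd dd0.
  - by move=> h' h'0 h'd; apply: Hd1 => //; exact: le_lt_trans h'd dd1.
have far_part : (\int[mu]_(y in I `\` ball t h) (K y * g y)%:E <= (e / 2)%:E)%E.
  have mID : measurable (I `\` ball t h) by apply: measurableD => //;
    exact: measurable_ball.
  apply: (le_trans (@le_integral_const g K mg mK g0 K0 _ (2 * (1 - r) / c) mID _ _)).
  - by rewrite divr_ge0 ?mulr_ge0// ltW.
  - move=> y [Iy]; rewrite -ball_normE/= distrC => /negP; rewrite -leNgt => hy.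
    apply: poisson_le_den => //; rewrite cE lerD2l lerN2.
    have -> : cos (y - t) = cos `|y - t| by have [_|_] := ler0P (y - t); rewrite ?cosN.
    have yp : `|y - t| <= pi.
      by move: Iy; rewrite /I/= in_itv/= -mulr_natl => /andP[? ?];
        rewrite ler_norml; apply/andP; lra.
    apply: ltW; rewrite ltr_cos ?in_itv/=.
    + exact: lt_le_trans hy.
    + by rewrite divr_ge0 ?(ltW d_gt0)//=.
    + by rewrite normr_ge0.
  apply: (@le_trans _ _ ((2 * (1 - r) / c)%:E * G%:E)%E).
    rewrite lee_wpmul2l ?lee_fin//.
      by rewrite divr_ge0 ?mulr_ge0// ltW.
    rewrite -GE; apply: ge0_subset_integral => //.
    - by apply/measurable_EFinP/measurable_funTS.
    - by move=> y _; rewrite lee_fin.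
  by rewrite -EFinM lee_fin far_budget// ltW.
by rewrite [e]splitr EFinD leeD.
Unshelve. all: by end_near. Qed.

End PoissonLimit.

(** * Radial limits *)

Section Fatou.
Context {R : realType}.
Local Notation mu := (@lebesgue_measure R).
Implicit Types (a b : nat -> R) (r s t x y c d : R).

Lemma cvg0_bound (u v : nat -> R) : (forall n, `|u n| <= v n) ->
  v @ \oo --> (0 : R) -> u @ \oo --> (0 : R).
Proof.
move=> uv v0; apply/norm_cvg0P.
apply: (@squeeze_cvgr _ _ _ _ (fun=> 0) v) => //; last exact: cvg_cst.
by apply: nearW => n; rewrite normr_ge0 uv.
Qed.

Lemma rcvg_unique (u : nat -> R) (l l' : R) : u @ \oo --> l -> u @ \oo --> l' -> l = l'.
Proof.
by move=> c c'; rewrite -(cvg_lim (@Rhausdorff R) c);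
  exact: (cvg_lim (@Rhausdorff R) c').
Qed.

Lemma eq_cvgn (u v : nat -> R) (l : R) : (forall n, u n = v n) ->
  u @ \oo --> l -> v @ \oo --> l.
Proof. by move=> /funext ->. Qed.

Lemma cvg_le0 (u : nat -> R) (x : R) : (forall n, x <= u n) ->
  u @ \oo --> (0 : R) -> x <= 0.
Proof.
move=> xu u0; rewrite -(cvg_lim (@Rhausdorff R) u0); apply: limr_ge;
  first exact: cvgP u0.
exact: nearW.
Qed.

(** Adding the square of the conjugate difference completes the integrand to a squared modulus,
    which Parseval evaluates as S_N - 2 S_M + S_M times 2 pi. *)
Lemma trig_sub_sqr a b M N x : (M <= N)%N ->
  (\int[mu]_(t in `[x, (x + pi *+ 2)]) ((trig a b N 1 t - trig a b M 1 t) ^+ 2) <=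
   (pi *+ 2) * (\sum_(k < N) (a k ^+ 2 + b k ^+ 2) - \sum_(k < M) (a k ^+ 2 + b k
     ^+ 2)))%R.
Proof.
move=> MN; pose U := trig a b; pose V := trig b (fun k => - a k).
pose Q M N t := U M 1 t * U N 1 t + V M 1 t * V N 1 t.
have cQ M' N' : continuous (Q M' N').
  by move=> t; apply: cvgD; apply: cvgM; exact: continuous_trig.
have cZ (u : R) (f : R -> R) : continuous f -> continuous (fun y => u * f y).
  by move=> cf y; apply: cvgM; [exact: cvg_cst|exact: cf].
apply: (@le_trans _ _ (\int[mu]_(t in `[x, (x + pi *+ 2)]) (Q N N t + - 2 * Q M N t
  + Q M M t)))%R.
  apply: le_Rintegral => //.
  - apply: continuous_integrable_itv; apply: continuous_sqr => t.
    by apply: cvgB; exact: continuous_trig.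
  - apply: continuous_integrable_itv => t.
    by apply: cvgD; [apply: cvgD; [|exact: cZ]|]; exact: cQ.
  move=> t _; rewrite /Q -subr_ge0.
  have -> : U N 1 t * U N 1 t + V N 1 t * V N 1 t + - 2 * (U M 1 t * U N 1 t + V M
    1 t * V N 1 t) +
    (U M 1 t * U M 1 t + V M 1 t * V M 1 t) - (trig a b N 1 t - trig a b M 1 t) ^+ 2 =
    (V N 1 t - V M 1 t) ^+ 2 by rewrite /U; ring.
  exact: sqr_ge0.
rewrite RintegralD//; last 2 first.
- apply: continuous_integrable_itv => t.
  by apply: cvgD; [|exact: cZ]; exact: cQ.
- exact: continuous_integrable_itv.
rewrite RintegralD//; last 2 first.
- exact: continuous_integrable_itv.
- by apply: continuous_integrable_itv; exact: cZ.
rewrite RintegralZl//; last exact: continuous_integrable_itv.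
rewrite !trig_parseval//.
by rewrite le_eqVlt; apply/orP; left; apply/eqP; ring.
Qed.

Lemma Rintegral_cat (f : R -> R) x y z : x <= y -> y <= z -> continuous f ->
  (\int[mu]_(t in `[x, z]) f t =
    \int[mu]_(t in `[x, y]) f t + \int[mu]_(t in `[y, z]) f t)%R.
Proof.
move=> xy yz cf.
have fi : mu.-integrable `[x, z] (EFin \o f) by exact: continuous_integrable_itv.
have := @Rintegral_itvB R f (BLeft x) (BRight z) y fi.
rewrite !bnd_simp => /(_ xy yz) H.
rewrite -(@Rintegral_itv_obnd_cbnd R y (BRight z)); last first.
  by apply: integrableS fi => //; apply: subset_itvr; rewrite bnd_simp.
by rewrite -H addrC subrK.
Qed.

(** The interval [-pi, 3 pi] contains [t - pi, t + pi] for every t in [0, 2 pi], so the boundary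
    functions need no periodic extension. One subsequence serves both parts, since (a, b) and (b,
    -a) have the same squared moduli. *)
Lemma boundary_functions a b : cvgn (series (fun k => a k ^+ 2 + b k ^+ 2)) ->
  exists (n_ : nat -> nat) (u v : R -> R), [/\ forall k, (k <= n_ k)%N,
    [/\ measurable_fun setT u, mu.-integrable `[- pi, (- pi + pi *+ 4)] (EFin \o u) &
       (fun k => \int[mu]_(x in `[- pi, (- pi + pi *+ 4)]) `|trig a b (n_ k) 1 x -
         u x|)%R
         @ \oo --> (0 : R)] &
    [/\ measurable_fun setT v, mu.-integrable `[- pi, (- pi + pi *+ 4)] (EFin \o v) &
       (fun k => \int[mu]_(x in `[- pi, (- pi + pi *+ 4)])
          `|trig b (fun k => - a k) (n_ k) 1 x - v x|)%R @ \oo --> (0 : R)]].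
Proof.
set S := series _ => cS; pose D : set R := `[- pi, (- pi + pi *+ 4)].
have SE N : S N = \sum_(k < N) (a k ^+ 2 + b k ^+ 2) by rewrite /S/series/= big_mkord.
have ndS : nondecreasing_seq S.
  by apply: nondecreasing_series => k _ _; rewrite addr_ge0 ?sqr_ge0.
have p4 : 0 < pi *+ 4 :> R by rewrite mulrn_wgt0 ?pi_gt0.
(* A period costs a factor 2 pi and the interval is two periods long: tails below 4^-k/(4 pi) give
   the 4^-k that [L1_limit] asks for. *)
have /choice[K HK] : forall k, exists n, forall N, (n <= N)%N ->
  limn S - S N <= 4^-1 ^+ k / (pi *+ 4).
  move=> k.
  have e0 : 0 < 4^-1 ^+ k / (pi *+ 4) :> R by rewrite divr_gt0// exprn_gt0// invr_gt0.
  have /cvgrPdist_le/(_ _ e0)[N _ HN] := cS.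
  by exists N => M NM; rewrite (le_trans (ler_norm _))// HN.
(* Summing the thresholds makes the sequence monotone and puts it beyond both k and [K k]. *)
pose n_ k := (\sum_(j < k.+1) (K j).+1)%N.
have n_le k : (k.+1 <= n_ k)%N.
  rewrite /n_; elim: k => [|k IH]; first by rewrite big_ord_recr/= big_ord0.
  by rewrite big_ord_recr/= -addn1 leq_add.
have n_K k : (K k <= n_ k)%N
  by rewrite /n_ big_ord_recr/= (leq_trans (leqnSn _))// leq_addl.
have n_mono k : (n_ k <= n_ k.+1)%N
  by rewrite [X in (_ <= X)%N]/n_ big_ord_recr/= leq_addr.
have L (a' b' : nat -> R) : (forall k, a' k ^+ 2 + b' k ^+ 2 = a k ^+ 2 + b k ^+ 2) ->
  exists u, [/\ measurable_fun setT u, mu.-integrable D (EFin \o u) &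
       (fun k => \int[mu]_(x in D) `|trig a' b' (n_ k) 1 x - u x|)%R @ \oo --> (0 : R)].
  move=> ab.
  have [|||g gi cg] := @L1_limit R (fun k =>
    trig a' b' (n_ k) 1) (- pi) (- pi + pi *+ 4).
  - by rewrite lerDl ltW.
  - by move=> k; exact: continuous_trig.
  - move=> k; pose f x := (trig a' b' (n_ k.+1) 1 x - trig a' b' (n_ k) 1 x) ^+ 2.
    have cf : continuous f.
      by apply: continuous_sqr => t; apply: cvgB; exact: continuous_trig.
    have p2 : 0 <= pi *+ 2 :> R by rewrite mulrn_wge0 ?pi_ge0.
    have E4 : - pi + pi *+ 4 = - pi + pi *+ 2 + pi *+ 2 :> R by rewrite -addrA -mulrnDr.
    rewrite E4 (@Rintegral_cat f _ (- pi + pi *+ 2))//; do ?by rewrite lerDl.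
    have H x : (\int[mu]_(t in `[x, (x + pi *+ 2)]) f t <= 4^-1 ^+ k / 2)%R.
      apply: (le_trans (trig_sub_sqr a' b' x (n_mono k))).
      under eq_bigr do rewrite ab.
      under [X in _ - X]eq_bigr do rewrite ab.
      rewrite -!SE.
      have H1 : S (n_ k.+1) - S (n_ k) <= 4^-1 ^+ k / (pi *+ 4).
        by apply: le_trans (HK k _ (n_K k)); rewrite lerD2r;
          exact: nondecreasing_cvgn_le.
      apply: (le_trans (ler_wpM2l p2 H1)).
      have -> : pi *+ 4 = 2 * (pi *+ 2) :> R
        by rewrite -mulr_natl -[in RHS]mulr_natl; ring.
      have : pi *+ 2 != 0 :> R by rewrite mulrn_eq0/= gt_eqF ?pi_gt0.
      move: (pi *+ 2) (4^-1 ^+ k) => p q p0.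
      by rewrite le_eqVlt; apply/orP; left; apply/eqP; field.
    by rewrite [leRHS]splitr lerD.
  (* Extension by zero makes the limit measurable on the whole line. *)
  exists (g \_ D); split.
  - have mD : measurable D by exact: measurable_itv.
    apply/(measurable_restrictT g mD).
    by apply/measurable_EFinP; case/integrableP : gi.
  - apply: eq_integrable gi => //.
    by move=> x Dx; rewrite /= patchE Dx.
  - have -> // : (fun k => \int[mu]_(x in D) `|trig a' b' (n_ k) 1 x - (g \_ D) x|)%R =
      (fun k => \int[mu]_(x in D) `|trig a' b' (n_ k) 1 x - g x|)%R.
    by apply/funext => k; apply: eq_Rintegral => x Dx; rewrite patchE Dx.
have [u [mu_ iu cu]] := L a b (fun=> erefl).
have [|v [mv iv cv]] := L b (fun k => - a k) _.
  by move=> k; rewrite sqrrN addrC.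
exists n_, u, v; split=> // k; exact: ltnW.
Qed.

Lemma Rintegral_dist_cvg0 (D E : set (measurableTypeR R)) (f : nat -> R ->
  R) (u : R -> R) :
  measurable D -> measurable E -> E `<=` D ->
  (forall k, mu.-integrable D (EFin \o f k)) -> mu.-integrable D (EFin \o u) ->
  (fun k => \int[mu]_(x in D) `|f k x - u x|)%R @ \oo --> (0 : R) ->
  (fun k => \int[mu]_(x in E) `|f k x - u x|)%R @ \oo --> (0 : R).
Proof.
move=> mD mE ED fi ui; apply: cvg0_bound => k.
have iD : mu.-integrable D (EFin \o (fun x => `|f k x - u x|)).
  by apply: integrable_EFin_norm => //; exact: integrable_EFinB.
have iE : mu.-integrable E (EFin \o (fun x => `|f k x - u x|)).
  exact: integrableS iD.
rewrite ger0_norm; last by apply: Rintegral_ge0.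
rewrite -lee_fin -!integrable_Rintegral//.
by apply: (@ge0_subset_integral _ _ R mu) => //; case/integrableP : iD.
Qed.

(** For fixed r < 1 the kernel is bounded by 2/(1 - r), so the Poisson integral is continuous for
    the L^1 distance and passes from the partial sums to [u]. *)
Lemma poisson_boundary a b (n_ : nat -> nat) (u : R -> R) r t (w : R) :
  0 <= r < 1 -> (forall k, (k <= n_ k)%N) ->
  let I := `[(t - pi), (t - pi + pi *+ 2)] in
  mu.-integrable I (EFin \o u) ->
  (fun k => \int[mu]_(x in I) `|trig a b (n_ k) 1 x - u x|)%R @ \oo --> (0 : R) ->
  (fun N => trig a b N r t) @ \oo --> w ->
  (\int[mu]_(y in I) (poisson r (y - t) * u y) = (pi *+ 2) * w)%R.
Proof.
move=> r01 nk I ui cu cw.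
have mI : measurable I by exact: measurable_itv.
have pi' (f : R -> R) : mu.-integrable I (EFin \o f) ->
    mu.-integrable I (EFin \o (fun y => poisson r (y - t) * f y)).
  by move=> fi; apply: integrable_mul_continuous => //; exact: continuous_poisson.
have ti k : mu.-integrable I (EFin \o trig a b (n_ k) 1).
  by apply: continuous_integrable_itv; exact: continuous_trig.
have c1 : (fun k => (pi *+ 2) * trig a b (n_ k) r t - \int[mu]_(y in I) (poisson r
  (y - t) * u y))%R
    @ \oo --> (0 : R).
  apply: (@cvg0_bound _ (fun k =>
    2 / (1 - r) * \int[mu]_(x in I) `|trig a b (n_ k) 1 x - u x|)%R).
    move=> k; rewrite -poisson_trig// -RintegralB//; do ?exact: pi'.
    have -> : (\int[mu]_(x in I) (poisson r (x - t) * trig a b (n_ k) 1 x - poisson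
      r (x - t) * u x) =
       \int[mu]_(x in I) (poisson r (x - t) * (trig a b (n_ k) 1 x - u x)))%R.
      by apply: eq_Rintegral => x _; rewrite mulrBr.
    have di : mu.-integrable I (EFin \o (fun x => trig a b (n_ k) 1 x - u x)).
      exact: integrable_EFinB.
    apply: (le_trans (le_normr_Rintegral _ (pi' _ di))) => //.
    rewrite -RintegralZl//; last exact: integrable_EFin_norm.
    apply: le_Rintegral => //.
    - by apply: integrable_EFin_norm => //; exact: pi'.
    - apply: integrable_mul_continuous; first exact: cst_continuous.
      exact: integrable_EFin_norm.
    - move=> x _; rewrite normrM ler_wpM2r// ger0_norm ?poisson_ge0//.
      exact: poisson_le.
  by rewrite -[X in _ --> X](mulr0 (2 / (1 - r))); apply: cvgM => //; exact: cvg_cst.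
have c2 : (fun k => (pi *+ 2) * trig a b (n_ k) r t - \int[mu]_(y in I) (poisson r
  (y - t) * u y))%R
    @ \oo --> (pi *+ 2) * w - \int[mu]_(y in I) (poisson r (y - t) * u y)%R.
  apply: cvgB; last exact: cvg_cst.
  apply: cvgM; first exact: cvg_cst.
  apply: (cvg_comp n_ (fun N => trig a b N r t)) cw.
  move=> P [N _ HN]; exists N => // k /= Nk; apply: HN => /=; exact: leq_trans (nk k).
by have /eqP := rcvg_unique c2 c1; rewrite subr_eq0 => /eqP <-.
Qed.

Lemma window_subset t : 0 <= t -> t <= 2 * pi ->
  `[(t - pi), (t - pi + pi *+ 2)] `<=` `[- pi, (- pi + pi *+ 4)].
Proof.
move=> t0 t2 y; rewrite /= !in_itv/= -!(mulr_natl pi) => /andP[? ?].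
by apply/andP; lra.
Qed.

Lemma window_mem t : `[(t - pi), (t - pi + pi *+ 2)]%classic t.
Proof. by have := @pi_gt0 R; rewrite /= in_itv/= -mulr_natl => ?; apply/andP; lra. Qed.

Lemma period_subset : `[0, (0 + pi *+ 2)] `<=` `[- pi, (- pi + pi *+ 4) : R].
Proof.
have := @pi_gt0 R; move=> pi0 y.
by rewrite /= !in_itv/= -!(mulr_natl pi) => /andP[? ?]; apply/andP; lra.
Qed.

(** The kernel has mass 2 pi, so 2 pi (W r t - u t) is the Poisson integral of u - u t, which is
    small near a Lebesgue point. *)
Lemma radial_limit a b (n_ : nat -> nat) (u : R -> R) (W : R -> R -> R) :
  (forall k, (k <= n_ k)%N) ->
  measurable_fun setT u -> mu.-integrable `[- pi, (- pi + pi *+ 4)] (EFin \o u) ->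
  (fun k => \int[mu]_(x in `[- pi, (- pi + pi *+ 4)]) `|trig a b (n_ k) 1 x - u x|)%R
     @ \oo --> (0 : R) ->
  (forall r t, 0 <= r < 1 -> (fun N => trig a b N r t) @ \oo --> W r t) ->
  {ae mu, forall t, `[0, 2 * pi] t -> W r t @[r --> (1 : R)^'-] --> u t}.
Proof.
move=> nk mu_ ui cu cW.
pose D : set R := `[- pi, (- pi + pi *+ 4)].
(* Lebesgue differentiation wants local integrability on the line; on the period around t the
   extension agrees with [u]. *)
pose f := u \_ D.
have mD : measurable D by exact: measurable_itv.
have mf : measurable_fun setT f.
  by apply/(measurable_restrictT u mD); exact: measurable_funTS mu_.
have ti k : mu.-integrable D (EFin \o trig a b (n_ k) 1).
  by apply: continuous_integrable_itv; exact: continuous_trig.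
have /lebesgue_differentiation := integrable_locally_restrict mD ui.
apply: ae_imply => t lp; rewrite /= in_itv/= => /andP[t0 t2].
pose I : set R := `[(t - pi), (t - pi + pi *+ 2)].
have ID : I `<=` D by exact: window_subset.
have fE y : I y -> f y = u y by move=> /ID Dy; rewrite /f patchE mem_set.
have It : I t by exact: window_mem.
have uI : mu.-integrable I (EFin \o u) by apply: integrableS ui => //;
  exact: measurable_itv.
have fI : mu.-integrable I (EFin \o f).
  apply: eq_integrable uI; first exact: measurable_itv.
  by move=> y /set_mem Iy; rewrite /= fE.
have cI : (fun k => \int[mu]_(x in I) `|trig a b (n_ k) 1 x - u x|)%R @ \oo --> (0 : R).
  by apply: (Rintegral_dist_cvg0 (D := D)) => //; exact: measurable_itv.
apply/cvgrPdist_le => e e0.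
have mI : measurable I by exact: measurable_itv.
near=> r.
have r1 : r < 1 by near: r; exact: nbhs_left_lt.
have r0 : 0 <= r by near: r; apply: nbhs_left_ge.
have r01 : 0 <= r < 1 by rewrite r0.
have ap : (\int[mu]_(y in I) (poisson r (y - t) * `|f y - f t|)%:E <= e%:E)%E.
  by near: r; exact: poisson_approx.
have H1 := poisson_boundary r01 nk uI cI (cW r t r01).
have pi' (g : R -> R) : mu.-integrable I (EFin \o g) ->
    mu.-integrable I (EFin \o (fun y => poisson r (y - t) * g y)).
  by move=> gi; apply: integrable_mul_continuous => //; exact: continuous_poisson.
have ci : mu.-integrable I (EFin \o (fun=> u t)).
  by apply: continuous_integrable_itv => y; exact: cvg_cst.
have H2 : (\int[mu]_(y in I) (poisson r (y - t) * u t) = (pi *+ 2) * u t)%R.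
  rewrite RintegralZr//; last by apply: continuous_integrable_itv;
    exact: continuous_poisson.
  congr *%R; have := @poisson_cos R r t 0 0 r01.
  rewrite mul0r addr0 cos0 expr0 !mulr1 => <-.
  by apply: eq_Rintegral => y _; rewrite mul0r addr0 cos0 mulr1.
have p2 : 1 <= pi *+ 2 :> R
  by rewrite mulr2n (le_trans _ (lerD (@pi_ge2 R) (@pi_ge0 R)))// addr0 ler1n.
have di : mu.-integrable I (EFin \o (fun y => u y - u t)) by exact: integrable_EFinB.
have H3 : (pi *+ 2) * `|u t - W r t| <= e.
  rewrite -[X in X * _]ger0_norm ?(le_trans _ p2)// -normrM mulrBr -H1 -H2 distrC
    -RintegralB//; do ?exact: pi'.
  have -> : (\int[mu]_(x in I) (poisson r (x - t) * u x - poisson r (x - t) * u t) =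
       \int[mu]_(x in I) (poisson r (x - t) * (u x - u t)))%R.
    by apply: eq_Rintegral => x _; rewrite mulrBr.
  apply: (le_trans (le_normr_Rintegral _ (pi' _ di))) => //.
  rewrite -lee_fin -integrable_Rintegral//;
    last by apply: integrable_EFin_norm => //; exact: pi'.
  apply: le_trans ap; rewrite le_eqVlt; apply/orP; left; apply/eqP.
  apply: eq_integral => y /set_mem Iy; rewrite !fE//.
  by rewrite normrM (ger0_norm (poisson_ge0 _ r01)).
(* The factor 2 pi is at least 1 and may be dropped. *)
apply: le_trans H3; rewrite ler_peMl//.
Unshelve. all: by end_near. Qed.

Lemma trig_bound a b N t : `|trig a b N 1 t| <= \sum_(k < N) (`|a k| + `|b k|).
Proof.
rewrite (le_trans (ler_norm_sum _ _ _))//; apply: ler_sum => k _.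
rewrite expr1n mul1r (le_trans (ler_normB _ _))// !normrM lerD//.
- by rewrite ler_piMr// ler_norml cos_geN1 cos_le1.
- by rewrite ler_piMr// ler_norml sin_geN1 sin_le1.
Qed.

Lemma Rintegral_mul_cvg (D : set (measurableTypeR R)) (g u : R -> R) (f : nat ->
  R -> R) (B : R) :
  measurable D -> (forall x, `|g x| <= B) ->
  (forall k, mu.-integrable D (EFin \o f k)) -> mu.-integrable D (EFin \o u) ->
  (forall k, mu.-integrable D (EFin \o (fun x => g x * f k x))) ->
  mu.-integrable D (EFin \o (fun x => g x * u x)) ->
  (fun k => \int[mu]_(x in D) `|f k x - u x|)%R @ \oo --> (0 : R) ->
  (fun k => \int[mu]_(x in D) (g x * f k x))%R @ \oo -->
    (\int[mu]_(x in D) (g x * u x))%R.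
Proof.
move=> mD gB fi ui gfi gui cu; apply/subr_cvg0.
apply: (@cvg0_bound _ (fun k => B * \int[mu]_(x in D) `|f k x - u x|)%R).
  move=> k; rewrite -RintegralB//.
  have di : mu.-integrable D (EFin \o (fun x => g x * f k x - g x * u x)).
    exact: integrable_EFinB.
  have d2 : mu.-integrable D (EFin \o (fun x => `|f k x - u x|)).
    by apply: integrable_EFin_norm => //; exact: integrable_EFinB.
  apply: (le_trans (le_normr_Rintegral _ di)) => //.
  rewrite -RintegralZl//; apply: le_Rintegral => //.
  - exact: integrable_EFin_norm.
  - rewrite (_ : EFin \o _ =
      (fun x => B%:E * (EFin \o (fun x => `|f k x - u x|%R)) x)%E).
      exact: integrableZl.
    by apply/funext => x; rewrite /= EFinM.
  - by move=> x _; rewrite -mulrBr normrM ler_wpM2r.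
by rewrite -[X in _ --> X](mulr0 B); apply: cvgM => //; exact: cvg_cst.
Qed.

(** The nonnegative function 1 - (u^2 + v^2) has integral at most 0. As L^1 convergence says nothing
    about the integral of u^2 + v^2, one factor in each square is first replaced by a partial
    sum. *)
Lemma unimodular_limit a b (n_ : nat -> nat) (u v : R -> R) :
  (forall k, (k <= n_ k)%N) ->
  series (fun k => a k ^+ 2 + b k ^+ 2) @ \oo --> (1 : R) ->
  measurable_fun setT u -> measurable_fun setT v ->
  (forall t, u t ^+ 2 + v t ^+ 2 <= 1) ->
  let J := `[0, (0 + pi *+ 2)] in
  (fun k => \int[mu]_(x in J) `|trig a b (n_ k) 1 x - u x|)%R @ \oo --> (0 : R) ->
  (fun k => \int[mu]_(x in J) `|trig b (fun k => - a k) (n_ k) 1 x - v x|)%R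
     @ \oo --> (0 : R) ->
  {ae mu, forall t, J t -> u t ^+ 2 + v t ^+ 2 = 1}.
Proof.
move=> nk cS mu_ mv uv1 J cu cv.
have mJ : measurable J by exact: measurable_itv.
pose U := trig a b; pose V := trig b (fun k => - a k).
have c1 : mu.-integrable J (EFin \o (fun=> 1)).
  by apply: continuous_integrable_itv => y; exact: cvg_cst.
have bi (f : R -> R) : measurable_fun setT f -> (forall t, `|f t| <= 1) ->
  mu.-integrable J (EFin \o f).
  move=> mf f1; apply: (@le_integrable _ _ R mu J _ (EFin \o f) (EFin \o (fun=>
    1))) => //.
  - by apply/measurable_EFinP; apply: measurable_funTS.
  - by move=> x _; rewrite /= lee_fin normr1.
have sqle (x : R) : x ^+ 2 <= 1 -> `|x| <= 1.
  by move=> x1; rewrite -(@ler_sqr _ `|x| 1) ?nnegrE// expr1n real_normK ?num_real.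
have u1 t : `|u t| <= 1 by apply: sqle; apply: le_trans (uv1 t); rewrite lerDl sqr_ge0.
have v1 t : `|v t| <= 1 by apply: sqle; apply: le_trans (uv1 t); rewrite lerDr sqr_ge0.
have ui := bi u mu_ u1; have vi := bi v mv v1.
have Ui N : mu.-integrable J (EFin \o U N 1).
  by apply: continuous_integrable_itv; exact: continuous_trig.
have Vi N : mu.-integrable J (EFin \o V N 1).
  by apply: continuous_integrable_itv; exact: continuous_trig.
have Umi N f : mu.-integrable J (EFin \o f) ->
  mu.-integrable J (EFin \o (fun x => U N 1 x * f x)).
  by apply: integrable_mul_continuous; exact: continuous_trig.
have Vmi N f : mu.-integrable J (EFin \o f) ->
  mu.-integrable J (EFin \o (fun x => V N 1 x * f x)).
  by apply: integrable_mul_continuous; exact: continuous_trig.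
have SE N : series (fun k => a k ^+ 2 + b k ^+ 2) N =
  \sum_(k < N) (a k ^+ 2 + b k ^+ 2).
  by rewrite /series/= big_mkord.
(* The N-th partial sum is bounded, so its pairing with (u, v) is the limit of its pairings with
   later partial sums, and these are constant by Parseval. *)
have P N : (\int[mu]_(x in J) (U N 1 x * u x + V N 1 x * v x) =
    (pi *+ 2) * \sum_(k < N) (a k ^+ 2 + b k ^+ 2))%R.
  have C1 : (fun k => \int[mu]_(x in J) (U N 1 x * U (n_ k) 1 x + V N 1 x * V (n_
    k) 1 x))%R
     @ \oo --> (\int[mu]_(x in J) (U N 1 x * u x + V N 1 x * v x))%R.
    rewrite RintegralD//; [|exact: Umi|exact: Vmi].
    under eq_fun do (rewrite RintegralD//; [|exact: Umi|exact: Vmi]).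
    apply: cvgD.
    - apply: (@Rintegral_mul_cvg _ _ _ (fun k =>
        U (n_ k) 1) (\sum_(k < N) (`|a k| + `|b k|))) => //; do ?by move=> *;
          exact: Umi.
      by move=> x; exact: trig_bound.
    - apply: (@Rintegral_mul_cvg _ _ _ (fun k =>
        V (n_ k) 1) (\sum_(k < N) (`|b k| + `|- a k|))) => //; do ?by move=> *;
          exact: Vmi.
      by move=> x; exact: trig_bound.
  have C2 : (fun k => \int[mu]_(x in J) (U N 1 x * U (n_ k) 1 x + V N 1 x * V (n_
    k) 1 x))%R
     @ \oo --> (pi *+ 2) * \sum_(k < N) (a k ^+ 2 + b k ^+ 2).
    apply: cvg_near_cst; exists N => // k /= Nk.
    by apply: trig_parseval; exact: leq_trans (nk k).
  exact: rcvg_unique C1 C2.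
pose h t := 1 - (u t ^+ 2 + v t ^+ 2).
have h0 t : 0 <= h t by rewrite subr_ge0.
have h1 t : `|h t| <= 1.
  by rewrite ger0_norm// /h lerBlDr lerDl addr_ge0 ?sqr_ge0.
have mh : measurable_fun setT h.
  by apply: measurable_funB => //; apply: measurable_funD; exact: measurable_funX.
have hi := bi h mh h1.
have hle : (\int[mu]_(x in J) h x <= 0)%R.
  pose rho k := ((pi *+ 2) * (1 - series (fun k => a k ^+ 2 + b k ^+ 2) (n_ k)) +
    (\int[mu]_(x in J) `|U (n_ k) 1 x - u x| + \int[mu]_(x in J) `|V (n_ k) 1 x - v
      x|))%R.
  apply: (@cvg_le0 rho); last first.
    rewrite -[X in _ --> X](addr0 0); apply: cvgD; last first.
      by rewrite -[X in _ --> X](addr0 0); apply: cvgD.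
    rewrite -[X in _ --> X](mulr0 (pi *+ 2)); apply: cvgM; first exact: cvg_cst.
    rewrite -[X in _ --> X](subrr 1); apply: cvgB; first exact: cvg_cst.
    apply: (cvg_comp n_ (series (fun k => a k ^+ 2 + b k ^+ 2))) cS.
    by move=> Q [N _ HN]; exists N => // k /= Nk; apply: HN => /=;
      exact: leq_trans (nk k).
  move=> k; pose E x := U (n_ k) 1 x * u x + V (n_ k) 1 x * v x.
  have Ei : mu.-integrable J (EFin \o E) by apply: integrable_EFinD;
    [|exact: Umi|exact: Vmi].
  have dU : mu.-integrable J (EFin \o (fun x => `|U (n_ k) 1 x - u x|)).
    by apply: integrable_EFin_norm => //; exact: integrable_EFinB.
  have dV : mu.-integrable J (EFin \o (fun x => `|V (n_ k) 1 x - v x|)).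
    by apply: integrable_EFin_norm => //; exact: integrable_EFinB.
  have -> : rho k = (\int[mu]_(x in J) ((1 - E x) + (`|U (n_ k) 1 x - u x| + `|V
    (n_ k) 1 x - v x|)))%R.
    rewrite RintegralD//; [|exact: integrable_EFinB|exact: integrable_EFinD].
    rewrite RintegralB// P RintegralD// Rintegral_cst_period /rho SE.
    by rewrite mul1r mulrBr mulr1.
  apply: le_Rintegral => //.
    apply: integrable_EFinD => //; first exact: integrable_EFinB.
    exact: integrable_EFinD.
  move=> x _; rewrite /h /E.
  (* Replacing q^2 by p q costs |p - q| |q|; the bound on (u, v) reduces this to the L^1
     distance. *)
  have H (p q : R) : `|q| <= 1 -> p * q - q ^+ 2 <= `|p - q|.
    move=> q1; rewrite expr2 -mulrBl (le_trans (ler_norm _))// normrM ler_piMr//.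
  have := H (U (n_ k) 1 x) (u x) (u1 x); have := H (V (n_ k) 1 x) (v x) (v1 x).
  lra.
have he : (\int[mu]_(x in J) `|(h x)%:E| = 0)%E.
  have -> : (\int[mu]_(x in J) `|(h x)%:E| = \int[mu]_(x in J) (h x)%:E)%E.
    by apply: eq_integral => x _; rewrite /= ger0_norm.
  rewrite integrable_Rintegral//; congr EFin; apply/le_anti.
  by rewrite hle Rintegral_ge0.
have := he => /(ae_eq_integral_abs mu mJ _).1 H.
have := H (ltac:(by apply/measurable_EFinP; apply: measurable_funTS)).
apply: ae_imply => t /[apply] -[ht].
by apply/eqP; rewrite eq_sym -subr_eq0; apply/eqP.
Qed.

Lemma fatou_unimodular a b (W1 W2 : R -> R -> R) :
  series (fun k => a k ^+ 2 + b k ^+ 2) @ \oo --> (1 : R) ->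
  (forall r t, 0 <= r < 1 -> (fun N => trig a b N r t) @ \oo --> W1 r t) ->
  (forall r t, 0 <= r < 1 ->
    (fun N => trig b (fun k => - a k) N r t) @ \oo --> W2 r t) ->
  (forall r t, 0 <= r < 1 -> W1 r t ^+ 2 + W2 r t ^+ 2 <= 1) ->
  {ae mu, forall t, `[0, 2 * pi] t -> exists l1 l2 : R,
    [/\ W1 r t @[r --> (1 : R)^'-] --> l1, W2 r t @[r --> (1 : R)^'-] --> l2 &
       l1 ^+ 2 + l2 ^+ 2 = 1]}.
Proof.
move=> cS c1 c2 W1le.
have [n_ [u [v [nk [mu_ iu cu] [mv iv cv]]]]] := boundary_functions (cvgP _ cS).
have R1 := radial_limit nk mu_ iu cu c1.
have R2 := radial_limit nk mv iv cv c2.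
have RR := ae_conj R1 R2.
(* The modulus is at most 1 only where radial limits exist, while [unimodular_limit] needs it
   everywhere: (u, v) is set to 0 on the exceptional null set. *)
pose ok t := u t ^+ 2 + v t ^+ 2 <= 1.
pose u' t := if ok t then u t else 0.
pose v' t := if ok t then v t else 0.
have mok : measurable_fun setT ok.
  apply: measurable_fun_ler => //.
  by apply: measurable_funD; exact: measurable_funX.
have mu' : measurable_fun setT u' by apply: measurable_fun_ifT.
have mv' : measurable_fun setT v' by apply: measurable_fun_ifT.
have J2 : 0 + pi *+ 2 = 2 * pi :> R by rewrite add0r mulr_natl.
pose J : set R := `[0, (0 + pi *+ 2)].
have mJ : measurable J by exact: measurable_itv.
have okae : {ae mu, forall t, J t -> ok t}.
  apply: ae_imply RR => t + Jt; rewrite -J2 => -[/(_ Jt) r1 /(_ Jt) r2].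
  have cc : W1 r t ^+ 2 + W2 r t ^+ 2 @[r --> (1 : R)^'-] --> u t ^+ 2 + v t ^+ 2.
    by rewrite !expr2; under eq_fun do rewrite !expr2; apply: cvgD; apply: cvgM.
  rewrite /ok -(cvg_lim (@Rhausdorff R) cc); apply: limr_le; first exact: cvgP cc.
  near=> r; apply: W1le; apply/andP; split; near: r; first exact: nbhs_left_ge.
  exact: nbhs_left_lt.
have JD := period_subset.
have L1 (a' b' : nat -> R) (w w' : R -> R) : (forall t, ok t -> w t = w' t) ->
   measurable_fun setT w -> measurable_fun setT w' ->
   mu.-integrable `[- pi, (- pi + pi *+ 4)] (EFin \o w) ->
   (fun k => \int[mu]_(x in `[- pi, (- pi + pi *+ 4)]) `|trig a' b' (n_ k) 1 x - w x|)%R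
         @ \oo --> (0 : R) ->
   (fun k => \int[mu]_(x in J) `|trig a' b' (n_ k) 1 x - w' x|)%R @ \oo --> (0 : R).
  move=> ww' mw mw' iw cw.
  have -> : (fun k => \int[mu]_(x in J) `|trig a' b' (n_ k) 1 x - w' x|)%R =
    (fun k => \int[mu]_(x in J) `|trig a' b' (n_ k) 1 x - w x|)%R.
    apply/funext => k; rewrite /Rintegral; congr fine.
    have mt (g : R -> R) : measurable_fun setT g ->
      measurable_fun J (fun x => `|trig a' b' (n_ k) 1 x - g x|%:E).
      move=> mg; apply/measurable_EFinP; apply: measurable_funTS.
      apply: measurableT_comp => //; apply: measurable_funB => //.
      by apply: continuous_measurable_fun; exact: continuous_trig.
    apply: ae_eq_integral => //; do ?exact: mt.
    by apply: ae_imply okae => t H Jt; rewrite ww'//; exact: H.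
  apply: (Rintegral_dist_cvg0 (D := `[- pi, (- pi + pi *+ 4)]%classic)) => //.
  by move=> k; apply: continuous_integrable_itv; exact: continuous_trig.
have cu' := L1 _ _ u u' (fun t ht => ltac:(by rewrite /u' ht)) mu_ mu' iu cu.
have cv' := L1 _ _ v v' (fun t ht => ltac:(by rewrite /v' ht)) mv mv' iv cv.
have uv1 t : u' t ^+ 2 + v' t ^+ 2 <= 1.
  by rewrite /u' /v'; case: ifPn => // _; rewrite expr0n/= addr0.
have U := unimodular_limit nk cS mu' mv' uv1 cu' cv'.
have := ae_conj RR (ae_conj okae U); apply: ae_imply => t [[r1 r2] [okt Ut]] Jt.
have Jt' : J t by rewrite /J J2.
exists (u t), (v t); split; [exact: r1|exact: r2|].
by have := Ut Jt'; rewrite /u' /v' (okt Jt').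
Unshelve. all: by end_near. Qed.

End Fatou.

(** * Square-summable sequences *)

Section Hilbert.
Context {R : realType}.
Local Notation C := R[i].
Local Notation V := (nat -> R[i]).
Implicit Types (z w v : C) (f g h : V).

(** The real part of z conj(w): the inner product of the plane. *)
Definition dotc z w : R := complex.Re z * complex.Re w + complex.Im z * complex.Im w.
Definition cconj z : C := Complex (complex.Re z) (- complex.Im z).

Lemma cconjE z : Num.conj z = cconj z.
Proof. by case: z. Qed.

Lemma ReM z w : complex.Re (z * w) =
  complex.Re z * complex.Re w - complex.Im z * complex.Im w.
Proof. by case: z w => [a b] [c d]. Qed.
Lemma ImM z w : complex.Im (z * w) =
  complex.Re z * complex.Im w + complex.Im z * complex.Re w.
Proof. by case: z w => [a b] [c d]. Qed.
Lemma ReD z w : complex.Re (z + w) = complex.Re z + complex.Re w.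
Proof. by case: z w => [a b] [c d]. Qed.
Lemma ImD z w : complex.Im (z + w) = complex.Im z + complex.Im w.
Proof. by case: z w => [a b] [c d]. Qed.
Lemma ReN z : complex.Re (- z) = - complex.Re z.
Proof. by case: z => [a b]. Qed.
Lemma ImN z : complex.Im (- z) = - complex.Im z.
Proof. by case: z => [a b]. Qed.
Definition cE := (ReM, ImM, ReD, ImD, ReN, ImN).

Lemma Re_sum n (F : nat ->
  C) : complex.Re (\sum_(k < n) F k) = \sum_(k < n) complex.Re (F k).
Proof. by elim: n => [|n IH]; rewrite ?big_ord0// !big_ord_recr/= ReD IH. Qed.
Lemma Im_sum n (F : nat ->
  C) : complex.Im (\sum_(k < n) F k) = \sum_(k < n) complex.Im (F k).
Proof. by elim: n => [|n IH]; rewrite ?big_ord0// !big_ord_recr/= ImD IH. Qed.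

Lemma complex_eq z w : complex.Re z = complex.Re w ->
  complex.Im z = complex.Im w -> z = w.
Proof. by case: z w => [a b] [c d] /= -> ->. Qed.

Lemma cmod_sqr z : cmod z ^+ 2 = dotc z z.
Proof. by rewrite sqr_sqrtr ?addr_ge0 ?sqr_ge0// !expr2. Qed.

Lemma cmod_ge0 z : 0 <= cmod z. Proof. exact: sqrtr_ge0. Qed.

Lemma cmod_le_sum z : cmod z <= `|complex.Re z| + `|complex.Im z|.
Proof.
rewrite -(@ler_sqr _ (cmod z)) ?nnegrE ?cmod_ge0 ?addr_ge0// cmod_sqr /dotc -!expr2.
rewrite -[X in X + _ <= _]real_normK ?num_real// -[X in _ + X <=
  _]real_normK ?num_real//.
by have := normr_ge0 (complex.Re z); have := normr_ge0 (complex.Im z); nra.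
Qed.

Lemma dotcC z w : dotc z w = dotc w z.
Proof. by rewrite /dotc; ring. Qed.

Lemma dotcDl z w v : dotc (z + w) v = dotc z v + dotc w v.
Proof. by rewrite /dotc !cE; ring. Qed.

Lemma dotcMl z w v : dotc (z * w) v = dotc w (cconj z * v).
Proof. by rewrite /dotc !cE /=; ring. Qed.

Lemma dotcMM z w v : dotc (z * v) (w * v) = dotc z w * dotc v v.
Proof. by rewrite /dotc !cE /=; ring. Qed.

Lemma dotc_ge0 z : 0 <= dotc z z.
Proof. by rewrite /dotc -!expr2 addr_ge0 ?sqr_ge0. Qed.

Lemma dotc_eq0 z : dotc z z <= 0 -> z = 0.
Proof.
rewrite /dotc => h; apply: complex_eq => /=; nra.
Qed.

Lemma dotcM_self z w : dotc (z * w) (z * w) = dotc z z * dotc w w.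
Proof. by rewrite /dotc !cE; ring. Qed.

Lemma dotc_bound z w : `|dotc z w| <= dotc z z + dotc w w.
Proof.
rewrite ler_norml /dotc.
have h (x y : R) : 0 <= (x + y) ^+ 2 by exact: sqr_ge0.
have := h (complex.Re z) (complex.Re w); have := h (complex.Im z) (complex.Im w).
have := h (complex.Re z) (- complex.Re w); have := h (complex.Im z) (- complex.Im w).
by move=> ? ? ? ?; apply/andP; split; nra.
Qed.

Definition lc (a : C) f g : V := fun k => a * f k + g k.
Definition sc (a : C) f : V := fun k => a * f k.
Definition sub f g : V := fun k => f k - g k.
(* The real part of the Hermitian product, whose imaginary part is
   [ip f (sc 'i g)]: orthogonality to a complex subspace only needs [ip]. *)
Definition ip f g : R := limn (series (fun k => dotc (f k) (g k))).
Definition nsq f : R := ip f f.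

Lemma H2E f : is_H2 f = cvgn (series (fun k => dotc (f k) (f k))).
Proof. by rewrite /is_H2; congr (cvg (series _ @ \oo)); apply/funext => k;
  rewrite cmod_sqr. Qed.

Lemma h2normE f : h2norm f = Num.sqrt (nsq f).
Proof. by rewrite /h2norm /nsq /ip; congr (Num.sqrt (limn (series _)));
  apply/funext => k; rewrite cmod_sqr. Qed.

Lemma seriesE (u : nat -> R) N : series u N = \sum_(k < N) u k.
Proof. by rewrite /series/= big_mkord. Qed.

Lemma H2_bound f (B : R) : (forall N, \sum_(k < N) dotc (f k) (f k) <= B) ->
  is_H2 f /\ nsq f <= B.
Proof.
move=> fB; have cf : cvgn (series (fun k => dotc (f k) (f k))).
  apply: nondecreasing_is_cvgn.
    by apply: nondecreasing_series => k _ _; exact: dotc_ge0.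
  by exists B => _ [N _ <-]; rewrite seriesE.
split; first by rewrite H2E.
by apply: limr_le => //; apply: nearW => N; rewrite seriesE.
Qed.

Lemma H2_partial f N : is_H2 f -> \sum_(k < N) dotc (f k) (f k) <= nsq f.
Proof.
rewrite H2E => cf; rewrite -(seriesE (fun k => dotc (f k) (f k)));
  apply: nondecreasing_cvgn_le => //.
by apply: nondecreasing_series => k _ _; exact: dotc_ge0.
Qed.

Lemma H2_ip_cvg f g : is_H2 f -> is_H2 g ->
  series (fun k => dotc (f k) (g k)) @ \oo --> ip f g.
Proof.
move=> Hf Hg; suff : cvgn (series (fun k => dotc (f k) (g k))) by [].
apply: normed_cvg; apply: nondecreasing_is_cvgn;
  first by apply: nondecreasing_series => k _ _; exact: normr_ge0.
exists (nsq f + nsq g) => _ [N _ <-].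
rewrite -[leLHS]/(series (fun k => `|dotc (f k) (g k)|) N) seriesE.
apply: (@le_trans _ _ (\sum_(k < N) (dotc (f k) (f k) + dotc (g k) (g k)))).
  by apply: ler_sum => k _; exact: dotc_bound.
by rewrite big_split/= lerD// H2_partial.
Qed.

Lemma H2_sc a f : is_H2 f -> is_H2 (sc a f).
Proof.
move=> Hf; have [] // := @H2_bound (sc a f) (dotc a a * nsq f).
move=> N; under eq_bigr do rewrite /sc dotcM_self.
by rewrite -mulr_sumr ler_wpM2l ?dotc_ge0// H2_partial.
Qed.

Lemma H2_add f g : is_H2 f -> is_H2 g -> is_H2 (fun k => f k + g k).
Proof.
move=> Hf Hg; have [] // := @H2_bound (fun k => f k + g k) (2 * nsq f + 2 * nsq g).
move=> N; apply: (@le_trans _ _ (\sum_(k < N) (2 * dotc (f k) (f k) + 2 * dotc (g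
  k) (g k)))).
  apply: ler_sum => k _; rewrite /dotc !cE.
  have := sqr_ge0 (complex.Re (f k) - complex.Re (g k)).
  have := sqr_ge0 (complex.Im (f k) - complex.Im (g k)); nra.
by rewrite big_split/= -!mulr_sumr lerD// ler_wpM2l// H2_partial.
Qed.

Lemma H2_lc a f g : is_H2 f -> is_H2 g -> is_H2 (lc a f g).
Proof. by move=> Hf Hg; apply: H2_add => //; exact: H2_sc. Qed.

Lemma subE f g : sub f g = lc (-1) g f.
Proof. by apply/funext => k; rewrite /lc /sub; ring. Qed.

Lemma H2_sub f g : is_H2 f -> is_H2 g -> is_H2 (sub f g).
Proof. by move=> Hf Hg; rewrite subE; exact: H2_lc. Qed.

Lemma H2_0 : is_H2 (fun=> 0 : C).
Proof.
have [] // := @H2_bound (fun=> 0) 0; move=> N.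
by rewrite big1// => k _; rewrite /dotc/= !mulr0 addr0.
Qed.

Lemma ipC f g : ip f g = ip g f.
Proof. by rewrite /ip; congr (limn (series _)); apply/funext => k; rewrite dotcC. Qed.

Lemma ip_lcl a f g h : is_H2 f -> is_H2 g -> is_H2 h ->
  ip (lc a f g) h = ip f (sc (cconj a) h) + ip g h.
Proof.
move=> Hf Hg Hh; apply: (@rcvg_unique R (series (fun k => dotc (lc a f g k) (h k)))).
  by apply: H2_ip_cvg => //; exact: H2_lc.
have -> : series (fun k => dotc (lc a f g k) (h k)) =
    (fun N => series (fun k => dotc (f k) (sc (cconj a) h k)) N + series (fun k =>
      dotc (g k) (h k)) N).
  apply/funext => N; rewrite !seriesE -big_split/=; apply: eq_bigr => k _.
  by rewrite /lc dotcDl dotcMl.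
by apply: cvgD; apply: H2_ip_cvg => //; exact: H2_sc.
Qed.

Lemma ip_scr_real (c : R) f g : is_H2 f -> is_H2 g ->
  ip f (sc (Complex c 0) g) = c * ip f g.
Proof.
move=> Hf Hg; apply: (@rcvg_unique R (series (fun k =>
  dotc (f k) (sc (Complex c 0) g k)))).
  by apply: H2_ip_cvg => //; exact: H2_sc.
have -> : series (fun k => dotc (f k) (sc (Complex c 0) g k)) =
    (fun N => c * series (fun k => dotc (f k) (g k)) N).
  apply/funext => N; rewrite !seriesE mulr_sumr; apply: eq_bigr => k _.
  by rewrite /sc /dotc !cE/=; ring.
by apply: cvgM; [exact: cvg_cst|exact: H2_ip_cvg].
Qed.

Lemma cconj_real (c : R) : cconj (Complex c 0) = Complex c 0.
Proof. by rewrite /cconj/= oppr0. Qed.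

Lemma complexN1 : -1 = Complex (-1) 0 :> C.
Proof. by apply: complex_eq; rewrite !cE//= oppr0. Qed.

Lemma sc1 f : sc 1 f = f. Proof. by apply/funext => k; rewrite /sc mul1r. Qed.
Lemma sc_sc a b f : sc a (sc b f) = sc (a * b) f.
Proof. by apply/funext => k; rewrite /sc mulrA. Qed.

Lemma ip_sc a f g : is_H2 f -> is_H2 g -> ip (sc a f) g = ip f (sc (cconj a) g).
Proof.
move=> Hf Hg; rewrite /ip; congr (limn (series _)); apply/funext => k.
by rewrite /sc dotcMl.
Qed.

Lemma ip_lc_real (c : R) f g h : is_H2 f -> is_H2 g -> is_H2 h ->
  ip (lc (Complex c 0) f g) h = c * ip f h + ip g h.
Proof. by move=> Hf Hg Hh; rewrite ip_lcl// cconj_real ip_scr_real. Qed.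

Lemma ip_subl f g h : is_H2 f -> is_H2 g -> is_H2 h -> ip (sub f g) h = ip f h - ip g h.
Proof. by move=> Hf Hg Hh; rewrite subE complexN1 ip_lc_real//; ring. Qed.

Lemma ip_addl f g h : is_H2 f -> is_H2 g -> is_H2 h ->
  ip (fun k => f k + g k) h = ip f h + ip g h.
Proof.
move=> Hf Hg Hh; have -> : (fun k => f k + g k) = lc (Complex 1 0) f g.
  by apply/funext => k; rewrite /lc; congr (_ + _); rewrite -[LHS]mul1r.
by rewrite ip_lc_real// mul1r.
Qed.

Lemma nsq_lc_real (c : R) f g : is_H2 f -> is_H2 g ->
  nsq (lc (Complex c 0) f g) = c ^+ 2 * nsq f + 2 * c * ip f g + nsq g.
Proof.
move=> Hf Hg; have H := @H2_lc (Complex c 0) _ _ Hf Hg.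
rewrite /nsq ip_lc_real// (ipC f) (ipC g) !ip_lc_real// (ipC g f); ring.
Qed.

Lemma nsq_ge0 f : is_H2 f -> 0 <= nsq f.
Proof. by move=> Hf; have := @H2_partial f 0 Hf; rewrite big_ord0. Qed.

Lemma nsq_coord f k : is_H2 f -> dotc (f k) (f k) <= nsq f.
Proof.
move=> Hf; apply: le_trans (H2_partial k.+1 Hf); rewrite big_ord_recr/= lerDr.
by apply: sumr_ge0 => i _; exact: dotc_ge0.
Qed.

Lemma nsq_sc a f : is_H2 f -> nsq (sc a f) = dotc a a * nsq f.
Proof.
move=> Hf; rewrite /nsq;
  apply: (@rcvg_unique R (series (fun k => dotc (sc a f k) (sc a f k)))).
  by apply: H2_ip_cvg; exact: H2_sc.
have -> : series (fun k => dotc (sc a f k) (sc a f k)) =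
    (fun N => dotc a a * series (fun k => dotc (f k) (f k)) N).
  apply/funext => N; rewrite !seriesE mulr_sumr; apply: eq_bigr => k _.
  by rewrite /sc dotcM_self.
by apply: cvgM; [exact: cvg_cst|exact: H2_ip_cvg].
Qed.

Lemma ip0l f : ip (fun=> 0) f = 0.
Proof.
rewrite /ip (_ : (fun k => dotc 0 (f k)) = (fun=> 0)); last first.
  by apply/funext => k; rewrite /dotc/= !mul0r addr0.
apply: (cvg_lim (@Rhausdorff R)).
rewrite (_ : series _ = (fun=> 0)); first exact: cvg_cst.
by apply/funext => N; rewrite seriesE big1.
Qed.

Lemma nsq_eq0 f : is_H2 f -> nsq f <= 0 -> f = (fun=> 0).
Proof.
move=> Hf f0; apply/funext => k; apply: dotc_eq0; exact: le_trans (nsq_coord k Hf) f0.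
Qed.

Lemma cauchy_schwarz f g : is_H2 f -> is_H2 g -> ip f g ^+ 2 <= nsq f * nsq g.
Proof.
move=> Hf Hg; have [f0|f0] := ltP 0 (nsq f); last first.
  by rewrite (nsq_eq0 Hf f0) /nsq !ip0l mul0r expr0n.
have H := nsq_ge0 (@H2_lc (Complex (- (ip f g / nsq f)) 0) _ _ Hf Hg).
rewrite nsq_lc_real// in H.
have : 0 <= nsq f * ((- (ip f g / nsq f)) ^+ 2 * nsq f + 2 * - (ip f g / nsq f) *
  ip f g + nsq g).
  by rewrite mulr_ge0// ltW.
have -> : nsq f * ((- (ip f g / nsq f)) ^+ 2 * nsq f + 2 * - (ip f g / nsq f) * ip
  f g + nsq g) =
  nsq f * nsq g - ip f g ^+ 2 by field; rewrite lt0r_neq0.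
by rewrite subr_ge0.
Qed.

Lemma nsq_parallelogram f g : is_H2 f -> is_H2 g ->
  nsq (sub f g) + nsq (fun k => f k + g k) = 2 * nsq f + 2 * nsq g.
Proof.
move=> Hf Hg; rewrite subE complexN1 nsq_lc_real//.
have -> : (fun k => f k + g k) = lc (Complex 1 0) f g.
  by apply/funext => k; rewrite /lc; congr (_ + _); rewrite -[LHS]mul1r.
by rewrite nsq_lc_real// (ipC g f); ring.
Qed.

Lemma nsq_subC f g : nsq (sub f g) = nsq (sub g f).
Proof.
rewrite /nsq /ip; congr (limn (series _)); apply/funext => k.
by rewrite /sub /dotc !cE; ring.
Qed.

(** Coordinates are Cauchy; the bounds pass to the coordinatewise limit through finite partial sums.
    The explicit rate [e] is inherited by the limit. *)
Lemma h2_complete (u : nat -> V) (e : nat -> R) : (forall i, is_H2 (u i)) ->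
  e @ \oo --> (0 : R) ->
  (forall i j, (i <= j)%N -> nsq (sub (u i) (u j)) <= e i) ->
  exists2 f, is_H2 f & forall i, nsq (sub (u i) f) <= e i.
Proof.
move=> Hu e0 ue.
(* [p] stands for the real or the imaginary part. *)
have bnd (p : C -> R) : (forall z w, p (z - w) = p z - p w) ->
  (forall z, p z ^+ 2 <= dotc z z) ->
    forall k, cvgn (fun i => p (u i k)).
  move=> pB pd k; apply/cauchy_cvgP/cauchyP => d d0.
  have d2 : 0 < (d / 2) ^+ 2 by rewrite exprn_gt0// divr_gt0.
  have /cvgr0_norm_lt/(_ _ d2)[N _ HN] := e0.
  exists (p (u N k)); exists N => // i /= Ni; rewrite -ball_normE/=.
  have : `|p (u N k) - p (u i k)| ^+ 2 < (d / 2) ^+ 2.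
    rewrite real_normK ?num_real// -pB.
    apply: (le_lt_trans (pd _));
      apply: (le_lt_trans (nsq_coord k (H2_sub (Hu N) (Hu i)))).
    by apply: (le_lt_trans (ue _ _ Ni)); apply: le_lt_trans (HN N (leqnn N));
      exact: ler_norm.
  rewrite ltr_sqr ?nnegrE//; last by rewrite divr_ge0// ltW.
  move=> h; apply: (lt_trans h).
  by rewrite ltr_pdivrMr// ltr_pMr// ltr1n.
have cRe k := bnd (@complex.Re R) (fun z w => ltac:(by rewrite !cE)) (fun z =>
  ltac:(by rewrite /dotc expr2 lerDl -expr2 sqr_ge0)) k.
have cIm k := bnd (@complex.Im R) (fun z w => ltac:(by rewrite !cE)) (fun z =>
  ltac:(by rewrite /dotc expr2 lerDr -expr2 sqr_ge0)) k.
pose f : V := fun k => Complex (limn (fun i => complex.Re (u i k))) (limn (fun i =>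
  complex.Im (u i k))).
have cd i k : (fun j => dotc (sub (u i) (u j) k) (sub (u i) (u j) k)) @ \oo -->
  dotc (sub (u i) f k) (sub (u i) f k).
  have cr : (fun j => complex.Re (sub (u i) (u j) k)) @ \oo -->
    complex.Re (sub (u i) f k).
    by rewrite /sub !cE/=; under eq_fun do rewrite !cE; apply: cvgB;
      [exact: cvg_cst|exact: cRe].
  have ci : (fun j => complex.Im (sub (u i) (u j) k)) @ \oo -->
    complex.Im (sub (u i) f k).
    by rewrite /sub !cE/=; under eq_fun do rewrite !cE; apply: cvgB;
      [exact: cvg_cst|exact: cIm].
  by apply: cvgD; apply: cvgM.
have sl i N : \sum_(k < N) dotc (sub (u i) f k) (sub (u i) f k) <= e i.
  have cs : (fun j => \sum_(k < N) dotc (sub (u i) (u j) k) (sub (u i) (u j) k)) @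
    \oo -->
      \sum_(k < N) dotc (sub (u i) f k) (sub (u i) f k).
    elim: N => [|N IH]; first by under eq_fun do rewrite big_ord0;
      rewrite big_ord0; exact: cvg_cst.
    by under eq_fun do rewrite big_ord_recr; rewrite big_ord_recr/=; apply: cvgD.
  rewrite -(cvg_lim (@Rhausdorff R) cs); apply: limr_le; first exact: cvgP cs.
  exists i => // j /= ij; apply: le_trans (ue i j ij); apply: H2_partial; exact: H2_sub.
exists f; last by move=> i; have [] := H2_bound (sl i).
have -> : f = sub (u 0%N) (sub (u 0%N) f) by apply/funext => k; rewrite /sub; ring.
by apply: H2_sub => //; have [] := H2_bound (sl 0%N).
Qed.

(** * Closed subspaces and orthogonal projection *)

Section Subspace.
Variables (M : set V) (cM : closed_subspace M).

Lemma csH2 f : M f -> is_H2 f. Proof. by case: cM => h _ _ _; exact: h. Qed.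
Lemma cs0 : M (fun=> 0). Proof. by case: cM. Qed.
Lemma cs_lc a f g : M f -> M g -> M (lc a f g). Proof. by case: cM => _ _ h _;
  exact: h. Qed.
Lemma cs_sc a f : M f -> M (sc a f).
Proof.
move=> Mf; have := cs_lc a Mf cs0; congr (M _); apply/funext => k.
by rewrite /lc addr0.
Qed.
Lemma cs_sub f g : M f -> M g -> M (sub f g).
Proof. by move=> Mf Mg; rewrite subE; exact: cs_lc. Qed.
Lemma cs_add f g : M f -> M g -> M (fun k => f k + g k).
Proof.
move=> Mf Mg; have := cs_lc 1 Mf Mg; congr (M _); apply/funext => k.
by rewrite /lc mul1r.
Qed.

Lemma cs_lim (u : nat -> V) (e : nat -> R) f : (forall i, M (u i)) -> is_H2 f ->
  e @ \oo --> (0 : R) -> (forall i, nsq (sub (u i) f) <= e i) -> M f.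
Proof.
move=> Mu Hf e0 ue; case: cM => _ _ _ cl; apply: (cl u f Mu Hf).
apply: (@cvg0_bound R _ (fun i => Num.sqrt (e i))).
  move=> i; rewrite ger0_norm; last by rewrite h2normE sqrtr_ge0.
  by rewrite h2normE ler_wsqrtr// ue.
rewrite -[X in _ --> X](sqrtr0 R).
by apply: (cvg_comp e Num.sqrt e0); exact: sqrt_continuous.
Qed.

Lemma projection f : is_H2 f -> exists2 u, M u & forall m, M m -> ip (sub f u) m = 0.
Proof.
move=> Hf; pose A : set R := [set nsq (sub f m) | m in M].
have lbA : lbound A 0 by move=> _ [m Mm <-]; apply: nsq_ge0; apply: H2_sub => //;
  exact: csH2.
have hA : has_inf A by split; [exists (nsq (sub f (fun=> 0))), (fun=> 0);
  [exact: cs0|]|exists 0].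
have dle m : M m -> inf A <= nsq (sub f m).
  by move=> Mm; apply: ge_inf; [case: hA|exists m].
have /choice[u Hu] : forall i, exists m, M m /\ nsq (sub f m) <= inf A + harmonic i.
  move=> i; have [_ [m Mm <-] lt] := @inf_adherent _ A (harmonic i) (harmonic_gt0 i) hA.
  by exists m; split=> //; exact: ltW.
have Mu i : M (u i) by case: (Hu i).
have Lu i : nsq (sub f (u i)) <= inf A + harmonic i by case: (Hu i).
have H2u i := csH2 (Mu i).
have h0 : harmonic @ \oo --> (0 : R) by exact: cvg_harmonic.
(* Parallelogram law for f - u_i and f - u_j: their sum is twice f minus the midpoint, which lies in
   [M] and so is at distance at least the infimum. *)
have par i j : nsq (sub (u i) (u j)) <= 2 * harmonic i + 2 * harmonic j.
  pose x := sub f (u i); pose y := sub f (u j).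
  have Hx : is_H2 x by exact: H2_sub.
  have Hy : is_H2 y by exact: H2_sub.
  pose m : V := sc 2^-1 (fun k => u i k + u j k).
  have Mm : M m by apply: cs_sc; exact: cs_add.
  have E1 : sub (u i) (u j) = sub y x by apply/funext => k;
    rewrite /sub /x /y /sub; ring.
  have E2 : (fun k => y k + x k) = sc (Complex 2 0) (sub f m).
    apply/funext => k; rewrite /x /y /sub /sc /m /sc.
    have -> : Complex 2 0 = 2 :> C by apply: complex_eq;
      rewrite [in RHS]mulr2n !cE/= ?addr0 -?mulr2n.
    by field.
  have := nsq_parallelogram Hy Hx; rewrite -E1 E2 nsq_sc;
    last by apply: H2_sub => //; exact: csH2.
  have -> : dotc (Complex 2 0) (Complex 2 0) = 4 :> R by rewrite /dotc/=; ring.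
  by have := dle m Mm; have := Lu i; have := Lu j; rewrite -/x -/y; lra.
have [w Hw uw] : exists2 w, is_H2 w & forall i, nsq (sub (u i) w) <= 4 * harmonic i.
  apply: h2_complete => //.
    by rewrite -[X in _ --> X](mulr0 4); apply: cvgM => //; exact: cvg_cst.
  move=> i j ij; apply: (le_trans (par i j)).
  have : harmonic j <= harmonic i :> R by rewrite /harmonic/= lef_pV2 ?posrE// ler_nat.
  lra.
have e0 : (fun i => 4 * harmonic i) @ \oo --> (0 : R).
  by rewrite -[X in _ --> X](mulr0 4); apply: cvgM => //; exact: cvg_cst.
have Mw : M w by exact: cs_lim e0 uw.
exists w => // m Mm; have Hm := csH2 Mm.
(* Moving u_i along [m] by the optimal amount lowers the squared distance by ip^2 / nsq m, but it
   can drop by at most the harmonic error. *)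
have E i : ip (sub f (u i)) m ^+ 2 <= nsq m * harmonic i.
  have Hx : is_H2 (sub f (u i)) by exact: H2_sub.
  have [m0|m0] := ltP 0 (nsq m); last first.
    by rewrite (nsq_eq0 Hm m0) ipC /nsq !ip0l mul0r expr0n.
  pose t := - (ip m (sub f (u i)) / nsq m).
  have D := dle _ (cs_lc (Complex (- t) 0) Mm (Mu i)).
  have E' : sub f (lc (Complex (- t) 0) m (u i)) = lc (Complex t 0) m (sub f (u i)).
    apply/funext => k; rewrite /sub /lc; have -> : Complex (- t) 0 = - Complex t 0 :> C.
      by apply: complex_eq; rewrite !cE//= oppr0.
    by ring.
  rewrite E' nsq_lc_real// in D; have L := Lu i.
  have : t ^+ 2 * nsq m + 2 * t * ip m (sub f (u i)) + harmonic i >= 0 by lra.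
  rewrite (ipC _ m) /t => {}D.
  have : 0 <= nsq m * ((- (ip m (sub f (u i)) / nsq m)) ^+ 2 * nsq m +
      2 * - (ip m (sub f (u i)) / nsq m) * ip m (sub f (u i)) + harmonic i).
    by rewrite mulr_ge0// ltW.
  have -> : nsq m * ((- (ip m (sub f (u i)) / nsq m)) ^+ 2 * nsq m +
      2 * - (ip m (sub f (u i)) / nsq m) * ip m (sub f (u i)) + harmonic i) =
      nsq m * harmonic i - ip m (sub f (u i)) ^+ 2.
    by field; rewrite lt0r_neq0.
  by rewrite subr_ge0.
(* From (p + q)^2 <= 2 p^2 + 2 q^2, with the squares at most 1 and 4 times the error term. *)
have E2 i : ip (sub f w) m ^+ 2 <= 10 * (nsq m * harmonic i).
  have -> : ip (sub f w) m = ip (sub f (u i)) m + ip (sub (u i) w) m.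
    rewrite -ip_addl//; do ?exact: H2_sub.
    by congr ip; apply/funext => k; rewrite /sub; ring.
  have CS := cauchy_schwarz (H2_sub (H2u i) Hw) Hm.
  have := E i; have : nsq (sub (u i) w) * nsq m <= 4 * harmonic i * nsq m.
    by rewrite ler_wpM2r ?nsq_ge0.
  have := sqr_ge0 (ip (sub f (u i)) m - ip (sub (u i) w) m).
  by move: CS; move: (ip (sub f (u i)) m) (ip (sub (u i) w) m) => p q; nra.
have : ip (sub f w) m ^+ 2 <= 0.
  apply: (@cvg_le0 R (fun i => 10 * (nsq m * harmonic i))) => //.
  rewrite -[X in _ --> X](mulr0 10); apply: cvgM; first exact: cvg_cst.
  by rewrite -[X in _ --> X](mulr0 (nsq m)); apply: cvgM => //; exact: cvg_cst.
by rewrite le_eqVlt ltNge sqr_ge0 orbF sqrf_eq0 => /eqP.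
Qed.

End Subspace.

End Hilbert.

(** * The shift and Beurling's theorem *)

Section Shift.
Context {R : realType}.
Local Notation C := R[i].
Local Notation V := (nat -> R[i]).
Implicit Types (z w v : C) (f g h theta : V).

Lemma iter_MzE m f k : iter m Mz f k = if (m <= k)%N then f (k - m)%N else 0.
Proof.
elim: m k => [|m IH] k; first by rewrite subn0.
by case: k => [|k]; rewrite /= ?ltnS//= IH subSS.
Qed.

Lemma Mz_lc a f g : Mz (lc a f g) = lc a (Mz f) (Mz g).
Proof. by apply/funext => -[|k]; rewrite /lc/= ?mulr0 ?addr0. Qed.

Lemma Mz_sc a f : Mz (sc a f) = sc a (Mz f).
Proof. by apply/funext => -[|k]; rewrite /sc/= ?mulr0. Qed.

Lemma Mz_sub f g : Mz (sub f g) = sub (Mz f) (Mz g).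
Proof. by apply/funext => -[|k]; rewrite /sub/= ?subr0. Qed.

Lemma iter_Mz_sc m a f : iter m Mz (sc a f) = sc a (iter m Mz f).
Proof. by elim: m => //= m ->; rewrite Mz_sc. Qed.

Lemma iter_Mz_sub m f g : iter m Mz (sub f g) = sub (iter m Mz f) (iter m Mz g).
Proof. by elim: m => //= m ->; rewrite Mz_sub. Qed.

Lemma iter_Mz_lc m a f g : iter m Mz (lc a f g) = lc a (iter m Mz f) (iter m Mz g).
Proof. by elim: m => //= m ->; rewrite Mz_lc. Qed.

Lemma sum_Mz f g N :
  \sum_(k < N.+1) dotc (Mz f k) (Mz g k) = \sum_(k < N) dotc (f k) (g k).
Proof. by rewrite big_ord_recl/= {1}/dotc/= !mulr0 !add0r. Qed.

Lemma H2_Mz f : is_H2 f -> is_H2 (Mz f).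
Proof.
move=> Hf; have [] // := @H2_bound R (Mz f) (nsq f); case=> [|N].
  by rewrite big_ord0 nsq_ge0.
by rewrite sum_Mz H2_partial.
Qed.

Lemma ip_Mz f g : is_H2 f -> is_H2 g -> ip (Mz f) (Mz g) = ip f g.
Proof.
move=> Hf Hg; apply: (@rcvg_unique R (fun N => series (fun k =>
  dotc (Mz f k) (Mz g k)) N.+1)).
  have := H2_ip_cvg (H2_Mz Hf) (H2_Mz Hg).
  by rewrite -(cvg_shiftS (series (fun k => dotc (Mz f k) (Mz g k)))).
have -> : (fun N => series (fun k => dotc (Mz f k) (Mz g k)) N.+1) =
  series (fun k => dotc (f k) (g k)).
  by apply/funext => N; rewrite !seriesE sum_Mz.
exact: H2_ip_cvg.
Qed.

Lemma H2_iter_Mz m f : is_H2 f -> is_H2 (iter m Mz f).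
Proof. by move=> Hf; elim: m => //= m; exact: H2_Mz. Qed.

Lemma ip_iter_Mz m f g : is_H2 f -> is_H2 g -> ip (iter m Mz f) (iter m Mz g) = ip f g.
Proof. by move=> Hf Hg; elim: m => //= m IH; rewrite ip_Mz//; exact: H2_iter_Mz. Qed.

Lemma H2_Mz_inv f : is_H2 (Mz f) -> is_H2 f.
Proof.
move=> Hf; have [] // := @H2_bound R f (nsq (Mz f)) => N.
by rewrite -sum_Mz H2_partial.
Qed.

Lemma cmulC f g : cmul f g = cmul g f.
Proof.
apply/funext => k; rewrite /cmul (reindex_inj rev_ord_inj)/=; apply: eq_bigr => j _.
by rewrite subSS mulrC subKn// -ltnS.
Qed.

Lemma cmul_lc a f g h : cmul h (lc a f g) = lc a (cmul h f) (cmul h g).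
Proof.
apply/funext => k; rewrite /cmul /lc mulr_sumr -big_split/=; apply: eq_bigr => j _.
by ring.
Qed.

Lemma cmul_sub f g h : cmul h (sub f g) = sub (cmul h f) (cmul h g).
Proof. by rewrite !subE cmul_lc. Qed.

Lemma cmul_Mz f h : cmul h (Mz f) = Mz (cmul h f).
Proof.
apply/funext => -[|k]; rewrite /cmul/=;
  first by rewrite big_ord_recl big_ord0/= mulr0 addr0.
rewrite big_ord_recr/= subnn/= mulr0 addr0; apply: eq_bigr => j _.
by rewrite subSn// -ltnS.
Qed.

Lemma cmul_iter_Mz m f h : cmul h (iter m Mz f) = iter m Mz (cmul h f).
Proof. by elim: m => //= m <-; rewrite cmul_Mz. Qed.

Lemma coefs_XnM m (p : {poly C}) : coefs ('X^m * p) = iter m Mz (coefs p).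
Proof.
apply/funext => k; rewrite /coefs coefXnM iter_MzE ltnNge.
by case: (m <= k)%N.
Qed.

Lemma cmul_coefs1 f : cmul (coefs 1) f = f.
Proof.
apply/funext => k; rewrite /cmul big_ord_recl/= /coefs coefC eqxx mul1r subn0.
by rewrite big1 ?addr0// => j _; rewrite coefC/= mul0r.
Qed.

Lemma cmul_XnM m (p : {poly C}) f : cmul (coefs ('X^m * p)) f =
  iter m Mz (cmul (coefs p) f).
Proof. by rewrite coefs_XnM cmulC cmul_iter_Mz cmulC. Qed.

Lemma cmul_Xn m f : cmul (coefs 'X^m) f = iter m Mz f.
Proof. by rewrite -[X in coefs X]mulr1 cmul_XnM cmul_coefs1. Qed.

Lemma coefs_Xn m : coefs ('X^m : {poly C}) = zpow m.
Proof. by apply/funext => k; rewrite /coefs coefXn. Qed.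

Definition htrunc N h : V := fun k => if (k < N)%N then h k else 0.

Lemma htruncS N h : htrunc N.+1 h = lc (h N) (zpow N) (htrunc N h).
Proof.
apply/funext => k; rewrite /htrunc /lc /zpow ltnS.
by case: ltngtP => [_|_|->]; rewrite ?mulr0 ?mulr1 ?addr0 ?add0r.
Qed.

Lemma htrunc0 h : htrunc 0 h = (fun=> 0). Proof. by apply/funext. Qed.

Lemma cmul0 f : cmul f (fun=> 0) = (fun=> 0).
Proof. by apply/funext => k; rewrite /cmul big1// => j _; rewrite mulr0. Qed.

Lemma cmul_truncS theta N h :
  cmul theta (htrunc N.+1 h) = lc (h N) (iter N Mz theta) (cmul theta (htrunc N h)).
Proof. by rewrite htruncS cmul_lc (cmulC _ (zpow N)) -coefs_Xn cmul_Xn. Qed.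

(** Coefficient k of a Cauchy product sees only h_0, ..., h_k. Products with H^2 sequences are thus
    read off from finite combinations of shifts of theta. *)
Lemma cmul_trunc theta N h k : (k < N)%N -> cmul theta (htrunc N h) k = cmul theta h k.
Proof.
move=> kN; rewrite /cmul; apply: eq_bigr => j _; rewrite /htrunc.
by rewrite (leq_ltn_trans (leq_subr _ _) kN).
Qed.

Lemma H2_trunc N h : is_H2 h -> is_H2 (htrunc N h).
Proof.
move=> Hh; have [] // := @H2_bound R (htrunc N h) (nsq h) => K.
apply: le_trans (H2_partial K Hh); apply: ler_sum => k _; rewrite /htrunc.
by case: ifP => // _; rewrite {1}/dotc/= !mulr0 addr0 dotc_ge0.
Qed.

Definition tail_nsq h N : R := nsq h - \sum_(k < N) dotc (h k) (h k).

Lemma nsq_tail h N : is_H2 h -> nsq (sub h (htrunc N h)) <= tail_nsq h N.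
Proof.
move=> Hh; have [] // := @H2_bound R (sub h (htrunc N h)) (tail_nsq h N) => K.
rewrite lerBrDr; apply: le_trans (H2_partial (N + K) Hh).
pose d k := dotc (sub h (htrunc N h) k) (sub h (htrunc N h) k).
have d0 k : 0 <= d k by exact: dotc_ge0.
apply: (@le_trans _ _ (\sum_(k < N + K) d k + \sum_(k < N) dotc (h k) (h k))).
  by rewrite lerD2r addnC big_split_ord/= lerDl; apply: sumr_ge0.
have z : \sum_(i < N) d i = 0.
  by apply: big1 => i _; rewrite /d /sub /htrunc ltn_ord subrr /dotc/= !mulr0 addr0.
rewrite !big_split_ord/= z add0r.
rewrite [leLHS]addrC lerD2l; apply: ler_sum => i _; rewrite /d /sub /htrunc.
by rewrite ltnNge leq_addr/= subr0.
Qed.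

Lemma tail_nsq_cvg h : is_H2 h -> tail_nsq h @ \oo --> (0 : R).
Proof.
move=> Hh; rewrite -[X in _ --> X](subrr (nsq h)).
rewrite (_ : tail_nsq h = (fun N => nsq h - series (fun k => dotc (h k) (h k)) N)).
  by apply: cvgB; [exact: cvg_cst|exact: H2_ip_cvg].
by apply/funext => N; rewrite seriesE.
Qed.

Lemma ip_lc a f g h : is_H2 f -> is_H2 g -> is_H2 h ->
  ip (lc a f g) h = ip (sc a f) h + ip g h.
Proof. by move=> Hf Hg Hh; rewrite -ip_addl//; exact: H2_sc. Qed.

Lemma nsq_lc a f g : is_H2 f -> is_H2 g ->
  nsq (lc a f g) = nsq (sc a f) + 2 * ip g (sc a f) + nsq g.
Proof.
move=> Hf Hg; have Hs := @H2_sc R a _ Hf; have Hl := @H2_lc R a _ _ Hf Hg.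
by rewrite /nsq ip_lc// (ipC _ (lc a f g)) (ipC g (lc a f g)) !ip_lc// (ipC (sc a
  f) g); ring.
Qed.

(** The scalars [a] and [b] make the real product [ip] express Hermitian orthonormality of the z^j
    theta. *)
Definition orthonormal_shifts theta := is_H2 theta /\ forall j k (a b : C),
  ip (sc a (iter j Mz theta)) (sc b (iter k Mz theta)) = (j == k)%:R * dotc a b.

(** * Multiplication by a sequence with orthonormal shifts *)

Section Multiplier.
Variables (theta : V) (Ot : orthonormal_shifts theta).

Let Ht : is_H2 theta. Proof. by case: Ot. Qed.
Let Hz j : is_H2 (iter j Mz theta). Proof. exact: H2_iter_Mz. Qed.

Lemma H2_cmul_trunc N h : is_H2 (cmul theta (htrunc N h)).
Proof.
elim: N => [|N IH]; first by rewrite htrunc0 cmul0; exact: H2_0.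
by rewrite cmul_truncS; exact: H2_lc.
Qed.

Lemma ip_cmul_trunc N h j b :
  ip (cmul theta (htrunc N h)) (sc b (iter j Mz theta)) = (j < N)%:R * dotc (h j) b.
Proof.
have Hb : is_H2 (sc b (iter j Mz theta)) by exact: H2_sc.
elim: N => [|N IH]; first by rewrite htrunc0 cmul0 ip0l mul0r.
rewrite cmul_truncS ip_lc//; last exact: H2_cmul_trunc.
rewrite IH (proj2 Ot) ltnS.
by case: ltngtP => [_|_|->]; rewrite ?mul0r ?mul1r ?add0r ?addr0.
Qed.

Lemma nsq_cmul_trunc N h : nsq (cmul theta (htrunc N h)) =
  \sum_(k < N) dotc (h k) (h k).
Proof.
elim: N => [|N IH]; first by rewrite htrunc0 cmul0 /nsq ip0l big_ord0.
rewrite cmul_truncS nsq_lc//; last exact: H2_cmul_trunc.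
rewrite ip_cmul_trunc ltnn mul0r mulr0 addr0 IH big_ord_recr/= addrC; congr (_ + _).
by rewrite /nsq (proj2 Ot) eqxx mul1r.
Qed.

Lemma cmul_contraction h : is_H2 h ->
  is_H2 (cmul theta h) /\ nsq (cmul theta h) <= nsq h.
Proof.
move=> Hh; apply: H2_bound => N.
apply: (@le_trans _ _ (\sum_(k < N) dotc (cmul theta (htrunc N h) k) (cmul theta
  (htrunc N h) k))).
  by apply: ler_sum => k _; rewrite cmul_trunc.
apply: (le_trans (H2_partial N (@H2_cmul_trunc N h))).
by rewrite nsq_cmul_trunc H2_partial.
Qed.

Lemma H2_cmul h : is_H2 h -> is_H2 (cmul theta h).
Proof. by move=> /cmul_contraction[]. Qed.

Lemma nsq_cmul_tail N h : is_H2 h ->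
  nsq (sub (cmul theta (htrunc N h)) (cmul theta h)) <= tail_nsq h N.
Proof.
move=> Hh; rewrite nsq_subC -cmul_sub.
have [_ le] := cmul_contraction (H2_sub Hh (@H2_trunc N _ Hh)).
exact: le_trans le (nsq_tail N Hh).
Qed.

(** The coefficients of h are the Fourier coefficients of theta h along the shifts of theta;
    truncations give this exactly, and Cauchy-Schwarz passes to the limit. *)
Lemma ip_cmul h j b : is_H2 h ->
  ip (cmul theta h) (sc b (iter j Mz theta)) = dotc (h j) b.
Proof.
move=> Hh; set x := sc b _; have Hx : is_H2 x by exact: H2_sc.
have Hc := H2_cmul Hh.
have : (ip (cmul theta h) x - dotc (h j) b) ^+ 2 <= 0.
  (* The offset [j.+1] keeps the index j inside every truncation. *)
  apply: (@cvg_le0 R (fun N => tail_nsq h (N + j.+1) * nsq x)).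
    move=> N; have -> : dotc (h j) b = ip (cmul theta (htrunc (N + j.+1) h)) x.
      by rewrite ip_cmul_trunc addnS ltnS leq_addl mul1r.
    have HT := @H2_cmul_trunc (N + j.+1) h.
    rewrite -ip_subl//; apply: (le_trans (cauchy_schwarz (H2_sub Hc HT) Hx)).
    by rewrite ler_wpM2r ?nsq_ge0// nsq_subC nsq_cmul_tail.
  rewrite -[X in _ --> X](mul0r (nsq x)); apply: cvgM; last exact: cvg_cst.
  by have := tail_nsq_cvg Hh; rewrite -(cvg_shiftn j.+1 (tail_nsq h)).
by rewrite le_eqVlt ltNge sqr_ge0 orbF sqrf_eq0 subr_eq0 => /eqP.
Qed.

Lemma cmul_subspace (M : set V) h : closed_subspace M ->
  (forall f, M f -> M (Mz f)) -> M theta -> is_H2 h -> M (cmul theta h).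
Proof.
move=> cM zM Mt Hh.
have Mz_ j : M (iter j Mz theta) by elim: j => //= j; exact: zM.
apply: (@cs_lim R M cM (fun N => cmul theta (htrunc N h)) (tail_nsq h)).
- elim=> [|N IH]; first by rewrite htrunc0 cmul0; exact: cs0.
  by rewrite cmul_truncS; exact: cs_lc.
- exact: H2_cmul.
- exact: tail_nsq_cvg.
- by move=> N; exact: nsq_cmul_tail.
Qed.

End Multiplier.

(** The shift is isometric, so z M is closed and can be projected onto in [wandering]. *)
Lemma Mz_closed_subspace (M : set V) : closed_subspace M ->
  closed_subspace [set f | exists2 g, M g & f = Mz g].
Proof.
move=> cM; split.
- by move=> _ [g Mg ->]; apply: H2_Mz; exact: (csH2 cM).
- by exists (fun=> 0); [exact: cs0|apply/funext => -[]].
- move=> a _ _ [f Mf ->] [g Mg ->]; exists (lc a f g); first exact: cs_lc.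
  by rewrite Mz_lc.
- move=> u f Hu Hf cu.
  have /choice[g Hg] : forall i, exists g, M g /\ u i = Mz g.
    by move=> i; have [g Mg ->] := Hu i; exists g.
  have f0 : f 0%N = 0.
    apply: dotc_eq0; apply: (@cvg_le0 R (fun i => h2norm (fun k => u i k - f k) ^+ 2)).
      move=> i; have Hui : is_H2 (u i) by rewrite (proj2 (Hg i)); apply: H2_Mz;
        exact: (csH2 cM (proj1 (Hg i))).
      have Hs := H2_sub Hui Hf.
      rewrite h2normE sqr_sqrtr ?nsq_ge0//; apply: le_trans (nsq_coord 0 Hs).
      by rewrite /sub (proj2 (Hg i))/= /dotc !cE/=; nra.
    rewrite -[X in _ --> X](mul0r 0); under eq_fun do rewrite expr2.
    exact: cvgM.
  pose f' : V := fun k => f k.+1.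
  have fE : f = Mz f' by apply/funext => -[|k].
  have Hf' : is_H2 f' by apply: H2_Mz_inv; rewrite -fE.
  exists f' => //; case: (cM) => _ _ _; apply; [by move=> i; exact: proj1 (Hg i)| |].
  + exact: Hf'.
  + have -> // : (fun i => h2norm (fun k => g i k - f' k)) =
      (fun i => h2norm (fun k => u i k - f k)).
    apply/funext => i.
    have Hgi := csH2 cM (proj1 (Hg i)).
    rewrite !h2normE; congr Num.sqrt.
    rewrite -[RHS]/(nsq (sub (u i) f)) -[LHS]/(nsq (sub (g i) f')).
    rewrite (proj2 (Hg i)) fE -Mz_sub /nsq ip_Mz//; exact: H2_sub.
Qed.

Lemma wandering (M : set V) : closed_subspace M -> (forall f, M f -> M (Mz f)) ->
  (exists f, M f /\ f <> (fun=> 0)) ->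
  exists theta, [/\ M theta, orthonormal_shifts theta &
    forall g, M g -> ip theta (Mz g) = 0].
Proof.
move=> cM zM [f1 [Mf1 f1n0]].
(* [m] is the least order of vanishing in [M]. Elements of z M have coefficient m equal to 0, so
   removing from f its projection onto z M cannot kill that coefficient. *)
have [m [[f [Mf fm]] mmin]] : exists m, (exists f, M f /\ f m != 0) /\
    forall k, (k < m)%N -> forall g, M g -> g k = 0.
  have ex : exists m, `[< exists f, M f /\ f m != 0 >].
    apply: contrapT => /forallNP nex; apply: f1n0; apply/funext => k.
    apply/eqP; apply: contrapT => /negP fk; apply: (nex k); apply/asboolP; by exists f1.
  have [m /asboolP Hm mmin] := ex_minnP ex.
  exists m; split=> // k km g Mg; apply/eqP; apply: contrapT => /negP gk.
  have : (m <= k)%N by apply: mmin; apply/asboolP; exists g.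
  by rewrite leqNgt km.
have czM := Mz_closed_subspace cM.
have [_ [g Mg ->] orth] := projection czM (csH2 cM Mf).
pose psi := sub f (Mz g).
have Mpsi : M psi by apply: cs_sub => //; exact: zM.
have psim : psi m != 0.
  rewrite /psi /sub; case: (m) fm mmin => [|m'] fm mmin /=; first by rewrite subr0.
  by rewrite (mmin m' (ltnSn _) g Mg) subr0.
have Hpsi := csH2 cM Mpsi.
have n0 : 0 < nsq psi.
  rewrite lt_neqAle nsq_ge0// andbT eq_sym; apply/negP => /eqP p0.
  by move/negP: psim; apply; rewrite (nsq_eq0 Hpsi) ?p0.
pose c := (Num.sqrt (nsq psi))^-1.
pose theta := sc (Complex c 0) psi.
have Mt : M theta by exact: cs_sc.
have Ht := csH2 cM Mt.
have nt : nsq theta = 1.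
  rewrite nsq_sc// /dotc/= mulr0 addr0 -expr2 exprVn sqr_sqrtr ?nsq_ge0//.
  by rewrite mulVf// lt0r_neq0.
have ort h : M h -> ip theta (Mz h) = 0.
  move=> Mh; have Hh := csH2 cM Mh.
  rewrite ipC ip_scr_real//; last exact: H2_Mz.
  by rewrite ipC orth ?mulr0//; exists h.
exists theta; split=> //; split=> // j k a b.
have Mi i : M (iter i Mz theta) by elim: i => //= i; exact: zM.
have Hi i := csH2 cM (Mi i).
(* Cancelling the common shift leaves theta against an element of z M. *)
have lt (j' k' : nat) a' b' : (j' < k')%N ->
  ip (sc a' (iter j' Mz theta)) (sc b' (iter k' Mz theta)) = 0.
  move=> jk; rewrite -(subnK (ltnW jk)) addnC iterD -!iter_Mz_sc.
  have Hs := @H2_sc R b' _ Ht; have Hs' := @H2_sc R a' _ Ht.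
  rewrite (ip_iter_Mz _ Hs' (@H2_iter_Mz _ _ Hs)) (ip_sc _ Ht (@H2_iter_Mz _ _ Hs)).
  rewrite -iter_Mz_sc sc_sc.
  have -> : (k' - j')%N = (k' - j').-1.+1 by rewrite prednK// subn_gt0.
  rewrite [X in ip _ X]/=; apply: ort.
  by elim: _.-1 => [|i IH]; [exact: cs_sc|exact: zM].
have [jk|kj|->] := ltngtP j k.
- by rewrite mul0r; exact: lt.
- by rewrite mul0r ipC; exact: lt.
- rewrite mul1r -!iter_Mz_sc (ip_iter_Mz _ (@H2_sc R a _ Ht) (@H2_sc R b _ Ht)).
  rewrite -[RHS]mulr1 -nt.
  apply: (@rcvg_unique R (series (fun i => dotc (sc a theta i) (sc b theta i)))).
    by apply: H2_ip_cvg; exact: H2_sc.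
  have -> : series (fun i => dotc (sc a theta i) (sc b theta i)) =
     (fun N => dotc a b * series (fun i => dotc (theta i) (theta i)) N).
    apply/funext => N; rewrite !seriesE mulr_sumr; apply: eq_bigr => i _.
    by rewrite /sc dotcMM.
  by apply: cvgM; [exact: cvg_cst|exact: H2_ip_cvg].
Qed.

(* The Hermitian product of [g] and [f], rebuilt from its real part [ip]. *)
Definition cip g f : C := Complex (ip g f) (ip g (sc (Complex 0 1) f)).

Lemma dotc_cip g f b : is_H2 g -> is_H2 f -> dotc (cip g f) b = ip g (sc b f).
Proof.
move=> Hg Hf; have -> : sc b f = lc (Complex (complex.Re b) 0) f
    (sc (Complex (complex.Im b) 0) (sc (Complex 0 1) f)).
  apply/funext => k; rewrite /sc /lc; apply: complex_eq; rewrite !cE/=; ring.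
rewrite ipC ip_lc_real//; last by apply: H2_sc; exact: H2_sc.
rewrite (ipC f g) (ipC _ g) ip_scr_real//; last exact: H2_sc.
by rewrite /dotc/=; ring.
Qed.

Lemma bessel theta g N : orthonormal_shifts theta -> is_H2 g ->
  \sum_(k < N) dotc (cip g (iter k Mz theta)) (cip g (iter k Mz theta)) <= nsq g.
Proof.
move=> Ot Hg; pose h k := cip g (iter k Mz theta).
have Ht : is_H2 theta by case: Ot.
have HTn n : is_H2 (cmul theta (htrunc n h)) by exact: H2_cmul_trunc.
have Hz n : is_H2 (iter n Mz theta) by exact: H2_iter_Mz.
have HT := HTn N.
have E : ip g (cmul theta (htrunc N h)) = \sum_(k < N) dotc (h k) (h k).
  elim: N {HT} => [|N IH]; first by rewrite htrunc0 cmul0 ipC ip0l big_ord0.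
  rewrite cmul_truncS ipC (ip_lc _ (Hz N) (HTn N) Hg) ipC -(dotc_cip _ Hg (Hz N)).
  by rewrite (ipC _ g) IH big_ord_recr/= addrC.
have := nsq_ge0 (H2_sub Hg HT).
rewrite subE complexN1 nsq_lc_real// (ipC _ g) E (nsq_cmul_trunc Ot).
by rewrite /h; lra.
Qed.

(* The part [K] of [M] orthogonal to [theta H^2] is again shift invariant.
   A nonzero [K] would contain [theta' H^2] for some [theta'], and the product of
   [theta] and [theta'] would lie both in [K] and in [theta H^2]. *)
Lemma beurling (M : set V) : closed_subspace M -> (forall f, M f -> M (Mz f)) ->
  (exists f, M f /\ f <> (fun=> 0)) ->
  exists2 theta, orthonormal_shifts theta &
    forall f, M f <-> exists2 h, is_H2 h & f = cmul theta h.
Proof.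
move=> cM zM Mn0; have [theta [Mt Ot ort]] := wandering cM zM Mn0.
have Ht : is_H2 theta by case: Ot.
exists theta => // f; split; last by move=> [h Hh ->]; exact: cmul_subspace.
have Hz j : is_H2 (iter j Mz theta) by exact: H2_iter_Mz.
pose K : set V := [set g | M g /\ forall j b, ip g (sc b (iter j Mz theta)) = 0].
have Hsc j b : is_H2 (sc b (iter j Mz theta)) by exact: H2_sc.
have cK : closed_subspace K.
  split.
  - by move=> g [Mg _]; exact: csH2 cM _ Mg.
  - by split; [exact: cs0|move=> j b; rewrite ip0l].
  - move=> a g1 g2 [Mg1 o1] [Mg2 o2]; split; first exact: cs_lc.
    move=> j b; have H1 := csH2 cM Mg1; have H2 := csH2 cM Mg2.
    by rewrite -/(lc a g1 g2) ip_lc// o2 addr0 ip_sc// sc_sc o1.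
  - move=> u g Ku Hg cu; split.
      by case: (cM) => _ _ _; apply; [move=> i; exact: proj1 (Ku i)| |exact: cu].
    move=> j b; have : ip g (sc b (iter j Mz theta)) ^+ 2 <= 0.
      apply: (@cvg_le0 R (fun i => h2norm (fun k =>
        u i k - g k) ^+ 2 * nsq (sc b (iter j Mz theta)))).
        move=> i; have Hui := csH2 cM (proj1 (Ku i)).
        rewrite h2normE sqr_sqrtr; last by apply: nsq_ge0; exact: H2_sub.
        apply: le_trans (cauchy_schwarz (H2_sub Hui Hg) (Hsc j b)).
        by rewrite ip_subl// (proj2 (Ku i)) sub0r sqrrN.
      rewrite -[X in _ --> X](mul0r (nsq (sc b (iter j Mz theta)))).
      apply: cvgM; last exact: cvg_cst.
      by rewrite -[X in _ --> X](mul0r 0); under eq_fun do rewrite expr2; exact: cvgM.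
    by rewrite le_eqVlt ltNge sqr_ge0 orbF sqrf_eq0 => /eqP.
have zK g : K g -> K (Mz g).
  move=> [Mg og]; have Hg := csH2 cM Mg; split; first exact: zM.
  move=> [|j] b.
    rewrite /= ipC (ip_sc _ Ht (H2_Mz Hg)) -Mz_sc ort//; exact: cs_sc.
  by rewrite /= -Mz_sc (ip_Mz Hg (Hsc j b)); exact: og.
have K0 g : K g -> g = (fun=> 0).
  move=> Kg; apply: contrapT => gn0.
  have [theta' [Kt' Ot' _]] := wandering cK zK (ex_intro _ g (conj Kg gn0)).
  have Ht' : is_H2 theta' by case: Ot'.
  have Kc : K (cmul theta' theta) by exact: cmul_subspace.
  (* Pairing theta theta' with z^j theta returns coefficient j of theta', and membership in [K]
     makes the pairing 0. *)
  have t'0 : theta' = (fun=> 0).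
    apply/funext => j; apply: dotc_eq0.
    by rewrite -(ip_cmul Ot j (theta' j) Ht') cmulC (proj2 Kc).
  have := (proj2 Ot') 0%N 0%N 1 1; rewrite eqxx mul1r /= t'0.
  rewrite (_ : sc 1 _ = (fun=> 0)); last by apply/funext => k; rewrite /sc mulr0.
  by rewrite ip0l /dotc/= mulr0 addr0 mulr1 => /eqP; rewrite eq_sym oner_eq0.
move=> Mf; have Hf := csH2 cM Mf.
pose h k := cip f (iter k Mz theta).
have [Hh _] : is_H2 h /\ nsq h <= nsq f by apply: H2_bound => N; exact: bessel.
exists h => //.
have : K (sub f (cmul theta h)).
  split; first by apply: cs_sub => //; exact: cmul_subspace.
  move=> j b; rewrite ip_subl//; last exact: H2_cmul.
  by rewrite (ip_cmul Ot)// dotc_cip// subrr.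
move=> /K0 E; apply/funext => k; have := congr1 (fun g => g k) E.
by rewrite /sub => /eqP; rewrite subr_eq0 => /eqP.
Qed.

End Shift.

(** * Orthonormal shifts define inner functions *)

Section Inner.
Context {R : realType}.
Local Notation C := R[i].
Local Notation V := (nat -> R[i]).
Implicit Types (z w v : C) (f g h theta : V).

Lemma dotc_ext z w : (forall b, dotc z b = dotc w b) -> z = w.
Proof.
move=> h; apply: complex_eq.
- by have := h 1; rewrite /dotc/= !mulr1 !mulr0 !addr0.
- by have := h (Complex 0 1); rewrite /dotc/= !mulr1 !mulr0 !add0r.
Qed.

Lemma cip_lc a f g x : is_H2 f -> is_H2 g -> is_H2 x ->
  cip (lc a f g) x = a * cip f x + cip g x.
Proof.
move=> Hf Hg Hx; apply: dotc_ext => b.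
have Hb := @H2_sc R b _ Hx.
rewrite (dotc_cip _ (@H2_lc R a _ _ Hf Hg) Hx) (ip_lcl _ Hf Hg Hb) sc_sc.
by rewrite dotcDl dotcMl (dotc_cip _ Hf Hx) (dotc_cip _ Hg Hx).
Qed.

(** Scaling g by c = [cip f g] turns the real product into |c|^2, so the real inequality
    suffices. *)
Lemma cip_cauchy_schwarz f g : is_H2 f -> is_H2 g ->
  dotc (cip f g) (cip f g) <= nsq f * nsq g.
Proof.
move=> Hf Hg; set c := cip f g; have [c0|c0] := ltP 0 (dotc c c); last first.
  by apply: (le_trans c0); rewrite mulr_ge0 ?nsq_ge0.
have := cauchy_schwarz Hf (@H2_sc R c _ Hg).
rewrite -(dotc_cip c Hf Hg) -/c (nsq_sc c Hg) mulrCA expr2.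
by rewrite ler_pM2l.
Qed.

Lemma H2_behead g : is_H2 g -> is_H2 (fun k => g k.+1).
Proof.
move=> Hg; have [] // := @H2_bound R (fun k => g k.+1) (nsq g) => N.
by apply: le_trans (H2_partial N.+1 Hg); rewrite big_ord_recl/= lerDr dotc_ge0.
Qed.

Lemma ip_Mz_behead f g : is_H2 f -> is_H2 g -> ip (Mz f) g = ip f (fun k => g k.+1).
Proof.
move=> Hf Hg; apply: (@rcvg_unique R (fun N => series (fun k =>
  dotc (Mz f k) (g k)) N.+1)).
  have := H2_ip_cvg (H2_Mz Hf) Hg.
  by rewrite -(cvg_shiftS (series (fun k => dotc (Mz f k) (g k)))).
have -> : (fun N => series (fun k => dotc (Mz f k) (g k)) N.+1) =
    series (fun k => dotc (f k) (g k.+1)).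
  by apply/funext => N; rewrite !seriesE big_ord_recl/= {1}/dotc/= !mul0r !add0r.
by apply: H2_ip_cvg => //; exact: H2_behead.
Qed.

(* The reproducing kernel of [H^2]: [cip f (szego z)] is the value of [f] at [z]. *)
Definition szego z : V := fun k => cconj (z ^+ k).

Lemma cconjM z w : cconj (z * w) = cconj z * cconj w.
Proof. by apply: complex_eq; rewrite /cconj/= !cE/=; ring. Qed.

Lemma dotc_szego z k : dotc (szego z k) (szego z k) = dotc z z ^+ k.
Proof.
elim: k => [|k IH]; first by rewrite /szego expr0 /dotc/= oppr0 mulr0 addr0 mulr1.
by rewrite /szego !exprS cconjM dotcM_self IH; congr (_ * _); rewrite /dotc/= mulrNN.
Qed.

Lemma cmod_lt1 z : (cmod z < 1) = (dotc z z < 1).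
Proof. by rewrite -cmod_sqr -{2}(expr1n _ 2) ltr_sqr ?nnegrE ?cmod_ge0. Qed.

Lemma H2_szego z : dotc z z < 1 -> is_H2 (szego z).
Proof.
move=> z1; have [] // := @H2_bound R (szego z) (1 - dotc z z)^-1 => N.
have z0 := dotc_ge0 z; move: (dotc z z) z0 z1 (dotc_szego z) => q q0 q1 qE.
under eq_bigr do rewrite qE.
have d0 : 0 < 1 - q by rewrite subr_gt0.
rewrite -(ler_pM2l d0) divff ?lt0r_neq0//.
have -> : (1 - q) * \sum_(i < N) q ^+ i = 1 - q ^+ N
  by rewrite -[LHS]opprK -mulNr opprB -subrX1 opprB.
by rewrite lerBlDr lerDl exprn_ge0.
Qed.

Lemma szego_cvg f z : is_H2 f -> dotc z z < 1 ->
  ((fun N => \sum_(k < N) complex.Re (f k * z ^+ k)) @ \oo -->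
    complex.Re (cip f (szego z))) /\
  ((fun N => \sum_(k < N) complex.Im (f k * z ^+ k)) @ \oo -->
    complex.Im (cip f (szego z))).
Proof.
move=> Hf z1; have Hz := H2_szego z1; split.
- apply: eq_cvgn (H2_ip_cvg Hf Hz) => N.
  rewrite seriesE; apply: eq_bigr => k _.
  by rewrite /szego /dotc !cE/=; ring.
- apply: eq_cvgn (H2_ip_cvg Hf (@H2_sc R (Complex 0 1) _ Hz)) => N.
  rewrite seriesE; apply: eq_bigr => k _.
  by rewrite /szego /sc /dotc !cE/=; ring.
Qed.

Lemma cmod_cvg0 {T : Type} (F : set_system T) {FF : Filter F} (u : T -> C) :
  (fun x => complex.Re (u x)) @ F --> (0 : R) ->
    (fun x => complex.Im (u x)) @ F --> (0 : R) ->
  (fun x => cmod (u x)) @ F --> (0 : R).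
Proof.
move=> cr ci.
apply: (@squeeze_cvgr _ _ _ _ (fun=> 0) (fun x =>
  `|complex.Re (u x)| + `|complex.Im (u x)|)).
- by apply: nearW => x; rewrite cmod_ge0 cmod_le_sum.
- exact: cvg_cst.
- by rewrite -[X in _ --> X](addr0 0); apply: cvgD; apply/norm_cvg0P.
Qed.

Lemma cmod_sub_cvg0 {T : Type} (F : set_system T) {FF : Filter F} (u : T -> C) (l : C) :
  (fun x => complex.Re (u x)) @ F --> complex.Re l ->
  (fun x => complex.Im (u x)) @ F --> complex.Im l ->
  (fun x => cmod (u x - l)) @ F --> (0 : R).
Proof.
move=> cr ci; apply: cmod_cvg0.
- rewrite (_ : (fun x => complex.Re (u x - l)) =
    (fun x => complex.Re (u x) - complex.Re l)).
    by rewrite -[X in _ --> X](subrr (complex.Re l)); apply: cvgB => //; exact: cvg_cst.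
  by apply/funext => x; rewrite !cE.
- rewrite (_ : (fun x => complex.Im (u x - l)) =
    (fun x => complex.Im (u x) - complex.Im l)).
    by rewrite -[X in _ --> X](subrr (complex.Im l)); apply: cvgB => //; exact: cvg_cst.
  by apply/funext => x; rewrite !cE.
Qed.

Lemma cseries_szego f z : is_H2 f -> dotc z z < 1 ->
  cseries_to (fun k => f k * z ^+ k) (cip f (szego z)).
Proof.
move=> Hf z1; have [cr ci] := szego_cvg Hf z1; apply: cmod_sub_cvg0.
- by apply: eq_cvgn cr => N; rewrite (Re_sum N (fun k => f k * z ^+ k)).
- by apply: eq_cvgn ci => N; rewrite (Im_sum N (fun k => f k * z ^+ k)).
Qed.

(** The kernel is an eigenvector of the backward shift, the adjoint of [Mz]. *)
Lemma cip_Mz_szego f z : is_H2 f -> dotc z z < 1 ->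
  cip (Mz f) (szego z) = z * cip f (szego z).
Proof.
move=> Hf z1; have Hz := H2_szego z1; apply: dotc_ext => b.
rewrite (dotc_cip b (H2_Mz Hf) Hz) (ip_Mz_behead Hf (@H2_sc R b _ Hz)) dotcMl
  (dotc_cip _ Hf Hz).
congr ip; apply/funext => k; rewrite /sc /szego exprS cconjM; ring.
Qed.

(** Let k_N be the truncated kernel and s_N its squared norm, which is also its value at z. Then
    theta k_N has squared norm s_N and value theta(z) s_N at z, so Cauchy-Schwarz gives |theta(z)|^2
    s_N <= nsq k, and s_N tends to nsq k > 0. *)
Lemma orthonormal_bound theta z : orthonormal_shifts theta -> dotc z z < 1 ->
  dotc (cip theta (szego z)) (cip theta (szego z)) <= 1.
Proof.
move=> Ot z1; have Ht : is_H2 theta by case: Ot.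
have Hz := H2_szego z1; set k := szego z in Hz *; set c := cip theta k.
pose s N := \sum_(i < N) dotc (k i) (k i).
have HTn N : is_H2 (cmul theta (htrunc N k)) by exact: H2_cmul_trunc.
have Hi n : is_H2 (iter n Mz theta) by exact: H2_iter_Mz.
have ci n : cip (iter n Mz theta) k = z ^+ n * c.
  elim: n => [|n IH]; first by rewrite mul1r.
  by rewrite iterS (cip_Mz_szego (Hi n) z1) IH exprS mulrA.
have E N : cip (cmul theta (htrunc N k)) k = Complex (s N) 0 * c.
  elim: N => [|N IH].
    rewrite htrunc0 cmul0 /s big_ord0 (_ : Complex 0 0 = 0)// mul0r.
    by apply: complex_eq; rewrite /= ip0l.
  rewrite cmul_truncS (cip_lc _ (Hi N) (HTn N) Hz) IH ci mulrA -mulrDl; congr (_ * _).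
  rewrite /s big_ord_recr/=; apply: complex_eq; rewrite !cE /k /szego /dotc/= ; ring.
have ineq N : dotc c c * s N.+1 <= nsq k.
  have s0 : 0 < s N.+1.
    rewrite /s big_ord_recl/= ltr_pwDl//; last by apply: sumr_ge0 => i _;
      exact: dotc_ge0.
    by rewrite /k dotc_szego expr0.
  have := cip_cauchy_schwarz (HTn N.+1) Hz.
  rewrite E dotcM_self (nsq_cmul_trunc Ot) -/(s N.+1).
  have -> : dotc (Complex (s N.+1) 0) (Complex (s N.+1) 0) = s N.+1 * s N.+1.
    by rewrite /dotc/= mulr0 addr0.
  by rewrite -mulrA ler_pM2l// mulrC.
have k1 : 0 < nsq k.
  apply: lt_le_trans (nsq_coord 0 Hz); by rewrite /k dotc_szego expr0.
have : dotc c c * nsq k <= nsq k.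
  have cs : (fun N => dotc c c * s N.+1) @ \oo --> dotc c c * nsq k.
    apply: cvgM; first exact: cvg_cst.
    have := H2_ip_cvg Hz Hz; rewrite -(cvg_shiftS (series (fun i => dotc (k i) (k i)))).
    by apply: eq_cvgn => N; rewrite /= seriesE.
  rewrite -(cvg_lim (@Rhausdorff R) cs); apply: limr_le; first exact: cvgP cs.
  by apply: nearW => N; exact: ineq.
by rewrite -[leRHS]mul1r ler_pM2r.
Qed.

Lemma polar_exp (r t : R) k :
  Complex (r * cos t) (r * sin t) ^+ k =
    Complex (r ^+ k * cos (k%:R * t)) (r ^+ k * sin (k%:R * t)).
Proof.
elim: k => [|k IH]; first by rewrite !expr0 mul0r cos0 sin0 mulr1 mulr0.
rewrite exprS IH -natr1 mulrDl mul1r cosD sinD exprS.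
by apply: complex_eq; rewrite !cE/=; ring.
Qed.

Lemma dotc_polar (r t : R) :
  dotc (Complex (r * cos t) (r * sin t)) (Complex (r * cos t) (r * sin t)) = r ^+ 2.
Proof.
rewrite /dotc/= -[RHS]mulr1 -(cos2Dsin2 t); ring.
Qed.

Lemma orthonormal_inner theta : orthonormal_shifts theta -> inner theta.
Proof.
move=> Ot; have Ht : is_H2 theta by case: Ot.
pose F z := cip theta (szego z); exists F; split.
  split; first by move=> z; rewrite cmod_lt1; exact: cseries_szego.
  exists 1 => z; rewrite cmod_lt1 => z1.
  rewrite -(@ler_sqr _ (cmod _)) ?nnegrE ?cmod_ge0// cmod_sqr expr1n.
  exact: orthonormal_bound.
pose a k := complex.Re (theta k); pose b k := complex.Im (theta k).
pose z (r t : R) : C := Complex (r * cos t) (r * sin t).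
have z1 r t : 0 <= r < 1 -> dotc (z r t) (z r t) < 1.
  by move=> /andP[r0 r1]; rewrite dotc_polar expr_lt1.
have c1 : series (fun k => a k ^+ 2 + b k ^+ 2) @ \oo --> (1 : R).
  have n1 : ip theta theta = 1.
    have := (proj2 Ot) 0%N 0%N 1 1; rewrite eqxx mul1r /= !sc1 => ->.
    by rewrite /dotc/= mulr0 addr0 mulr1.
  rewrite -n1; apply: eq_cvgn (H2_ip_cvg Ht Ht) => N; rewrite !seriesE.
  by apply: eq_bigr => k _; rewrite /a /b /dotc -!expr2.
have W1 r t : 0 <= r < 1 -> (fun N => trig a b N r t) @ \oo --> complex.Re (F (z r t)).
  move=> r01; have [cr _] := szego_cvg Ht (z1 r t r01); apply: eq_cvgn cr => N;
    apply: eq_bigr => k _.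
  by rewrite /z polar_exp !cE/= /a /b; ring.
have W2 r t : 0 <= r < 1 ->
  (fun N => trig b (fun k => - a k) N r t) @ \oo --> complex.Im (F (z r t)).
  move=> r01; have [_ ci] := szego_cvg Ht (z1 r t r01); apply: eq_cvgn ci => N;
    apply: eq_bigr => k _.
  by rewrite /z polar_exp !cE/= /a /b; ring.
have B r t : 0 <= r < 1 ->
  complex.Re (F (z r t)) ^+ 2 + complex.Im (F (z r t)) ^+ 2 <= 1.
  by move=> r01; have := orthonormal_bound Ot (z1 r t r01); rewrite /dotc -!expr2.
have := fatou_unimodular c1 W1 W2 B.
apply: ae_imply => t /[apply] -[l1 [l2 [cr ci l12]]].
exists (Complex l1 l2); split; last by rewrite /cmod/= l12 sqrtr1.
exact: cmod_sub_cvg0.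
Qed.

Lemma ip_h2orth f g : is_H2 f -> is_H2 g -> ip f g = 0 ->
  ip f (sc (Complex 0 1) g) = 0 -> h2orth f g.
Proof.
move=> Hf Hg o1 o2; apply: cmod_cvg0.
- have := H2_ip_cvg Hf Hg; rewrite o1; apply: eq_cvgn => N.
  rewrite seriesE subr0 (Re_sum N (fun k => f k * Num.conj (g k)));
    apply: eq_bigr => k _.
  by rewrite cconjE /dotc !cE/=; ring.
- have := H2_ip_cvg Hf (@H2_sc R (Complex 0 1) _ Hg); rewrite o2; apply: eq_cvgn => N.
  rewrite seriesE subr0 (Im_sum N (fun k => f k * Num.conj (g k)));
    apply: eq_bigr => k _.
  by rewrite cconjE /sc /dotc !cE/=; ring.
Qed.

End Inner.

(** * Invariant subspaces of perturbed shifts *)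

Section Perturbation.
Context {R : realType}.
Local Notation C := R[i].
Local Notation V := (nat -> R[i]).
Implicit Types (f g h theta : V).

Definition vanish (m : nat) f := forall k, (k < m)%N -> f k = 0.

Lemma ip_eq0 f g : (forall k, dotc (f k) (g k) = 0) -> ip f g = 0.
Proof.
move=> fg; apply: (cvg_lim (@Rhausdorff R)); rewrite (_ : series _ = (fun=> 0));
  first exact: cvg_cst.
by apply/funext => N; rewrite seriesE big1.
Qed.

Lemma H2_zpow m : is_H2 (zpow m : V).
Proof.
have H0 : is_H2 (zpow 0 : V).
  have [] // := @H2_bound R (zpow 0) 1; case=> [|N]; first by rewrite big_ord0.
  rewrite big_ord_recl/= big1 ?addr0; first by rewrite /dotc/= mulr0 addr0 mulr1.
  by move=> i _; rewrite /dotc/= !mulr0 addr0.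
rewrite -coefs_Xn -[X in coefs X]mulr1 coefs_XnM; apply: H2_iter_Mz.
by rewrite -[X in coefs X](expr0 'X) coefs_Xn.
Qed.

Lemma H2_htrunc_any N h : is_H2 (htrunc N h).
Proof.
elim: N => [|N IH]; first by rewrite htrunc0; exact: H2_0.
by rewrite htruncS; apply: H2_lc => //; exact: H2_zpow.
Qed.

Lemma H2_coefs (p : {poly C}) : is_H2 (coefs p).
Proof.
have -> : coefs p = htrunc (size p) (coefs p); last exact: H2_htrunc_any.
apply/funext => k; rewrite /htrunc; case: ltnP => // le.
by rewrite /coefs nth_default.
Qed.

Lemma vanish_Mz m f : vanish m f -> vanish m.+1 (Mz f).
Proof. by move=> vf [|k]//=; rewrite ltnS; exact: vf. Qed.

Lemma vanish_iter_Mz m f : vanish m (iter m Mz f).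
Proof. by move=> k km; rewrite iter_MzE leqNgt km. Qed.

Lemma vanish_unshift m f : vanish m f -> f = iter m Mz (fun k => f (k + m)%N).
Proof.
move=> vf; apply/funext => k; rewrite iter_MzE; case: leqP => [mk|]; last exact: vf.
by rewrite subnK.
Qed.

Lemma H2_iter_Mz_inv m f : is_H2 (iter m Mz f) -> is_H2 f.
Proof. by elim: m => //= m IH /H2_Mz_inv. Qed.

Lemma iter_Mz0 m : iter m Mz (fun=> 0) = (fun=> 0) :> V.
Proof. by apply/funext => k; rewrite iter_MzE; case: ifP. Qed.

Lemma h2norm_iter_Mz m f : is_H2 f -> h2norm (iter m Mz f) = h2norm f.
Proof. by move=> Hf; rewrite !h2normE /nsq (ip_iter_Mz m Hf Hf). Qed.

(** [P] need not be closed: taken as the vectors of [M] whose image under [S] is in [M], it yields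
    invariance from the generators alone. *)
Lemma comb_closed (P : set V) (phi : nat -> V) (a : nat -> C) w m n :
  (forall c f g, P f -> P g -> P (lc c f g)) -> P w ->
  (forall i, (m <= i < n)%N -> P (phi i)) ->
  P (fun k => \sum_(m <= i < n) a i * phi i k + w k).
Proof.
move=> Plc Pw; elim: n => [|n IH] Pphi.
  rewrite (_ : (fun k => _) = w)//; apply/funext => k.
  by rewrite big_geq ?add0r.
have [mn|nm] := leqP m n; last first.
  rewrite (_ : (fun k => _) = w)//; apply/funext => k.
  by rewrite big_geq ?add0r.
rewrite (_ : (fun k => _) =
  lc (a n) (phi n) (fun k => \sum_(m <= i < n) a i * phi i k + w k)).
  apply: Plc; first by apply: Pphi; rewrite mn ltnSn.
  by apply: IH => i /andP[mi ni]; apply: Pphi; rewrite mi ltnW.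
by apply/funext => k; rewrite /lc big_nat_recr//= addrA (addrC (a n * _)).
Qed.

Lemma bounded_op0 (T : V -> V) : bounded_op T -> T (fun=> 0) = (fun=> 0).
Proof.
case=> _ lin _; have := lin 1 _ _ (@H2_0 R) (@H2_0 R).
rewrite (_ : (fun k => 1 * 0 + 0) = (fun=> 0)); last by apply/funext => k;
  rewrite mulr0 addr0.
move=> E; apply/funext => k; have := congr1 (fun h => h k) E.
by rewrite mul1r => /eqP; rewrite -[X in X == _]addr0 (can_eq (addKr _)) eq_sym => /eqP.
Qed.

(** * The filtration by order of vanishing *)

Section Filtration.
Variables (M : set V) (cM : closed_subspace M).

Definition ord_ge (i : nat) : set V := [set f | M f /\ vanish i f].

Lemma ord_ge_closed i : closed_subspace (ord_ge i).
Proof.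
split.
- by move=> f [Mf _]; exact: (csH2 cM).
- by split=> //; exact: cs0.
- move=> a f g [Mf vf] [Mg vg]; split; first exact: (cs_lc cM).
  by move=> k ki; rewrite vf// vg// mulr0 addr0.
- move=> u f Hu Hf cu; split.
    by case: (cM) => _ _ _; apply; [move=> j;
      exact: (proj1 (Hu j))|exact: Hf|exact: cu].
  move=> k ki; apply: dotc_eq0.
  apply: (@cvg_le0 R (fun i => h2norm (fun k => u i k - f k) ^+ 2)).
    move=> j; have Hs := H2_sub (csH2 cM (proj1 (Hu j))) Hf.
    rewrite h2normE sqr_sqrtr ?nsq_ge0//; apply: le_trans (nsq_coord k Hs).
    by rewrite /sub (proj2 (Hu j) k ki) sub0r /dotc !cE !mulrNN.
  rewrite -[X in _ --> X](mul0r 0); under eq_fun do rewrite expr2.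
  exact: cvgM.
Qed.

(** Beurling's theorem will be applied to this space, M_n divided by z^n. *)
Lemma unshift_closed n : closed_subspace [set g | M (iter n Mz g)].
Proof.
split.
- by move=> g /= Mg; apply: (@H2_iter_Mz_inv n); exact: (csH2 cM).
- by rewrite /= iter_Mz0; exact: cs0.
- move=> a f g Mf Mg; rewrite -/(lc a f g) /= iter_Mz_lc; exact: (cs_lc cM).
- move=> u f Hu Hf cu; case: (cM) => _ _ _; apply.
  + exact: Hu.
  + exact: H2_iter_Mz.
  + have -> // : (fun i => h2norm (fun k => iter n Mz (u i) k - iter n Mz f k)) =
      (fun i => h2norm (fun k => u i k - f k)).
    apply/funext => i; rewrite -[LHS]/(h2norm (sub (iter n Mz (u i)) (iter n Mz f))).
    rewrite -iter_Mz_sub h2norm_iter_Mz//; apply: H2_sub => //.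
    by apply: (@H2_iter_Mz_inv n); apply: (csH2 cM); exact: Hu.
Qed.

(* A generator of [ord_ge i] modulo [ord_ge i.+1], a space of dimension at most one;
   it is [0] when the two spaces coincide. *)
Lemma graded_generator i : exists phi, [/\ ord_ge i phi,
  forall m, ord_ge i.+1 m -> ip phi m = 0 &
  forall f, ord_ge i f -> exists a : C, ord_ge i.+1 (sub f (sc a phi))].
Proof.
have vS f : ord_ge i f -> f i = 0 -> ord_ge i.+1 f.
  move=> [Mf vf] fi; split=> // k; rewrite ltnS leq_eqVlt => /orP[/eqP ->//|];
    exact: vf.
have [[e [[Me ve] ei]]|ne] := pselect (exists e, ord_ge i e /\ e i <> 0); last first.
  exists (fun=> 0); split; first by split=> //; exact: cs0.
  - by move=> m _; rewrite ip0l.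
  - move=> f If; exists 0; rewrite (_ : sub _ _ = f).
      by apply: vS => //; apply: contrapT => fi; apply: ne; exists f.
    by apply/funext => k; rewrite /sub /sc mul0r subr0.
have [u Iu orth] := projection (ord_ge_closed i.+1) (csH2 cM Me).
have Ie : ord_ge i (sub e u).
  case: Iu => Mu vu; split; first exact: (cs_sub cM).
  by move=> k ki; rewrite /sub ve// vu ?subr0// ltnW.
have pi : sub e u i <> 0 by rewrite /sub (proj2 Iu)// subr0.
exists (sub e u); split=> // f If; exists (f i / sub e u i); apply: vS.
  split; first by apply: (cs_sub cM); [exact: proj1 If|apply: (cs_sc cM);
    exact: proj1 Ie].
  move=> k ki; rewrite -[LHS]/(f k - f i / sub e u i * sub e u k).
  by rewrite (proj2 If k ki) (proj2 Ie k ki) mulr0 subr0.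
by rewrite {1}/sub /sc divfK ?subrr//; apply/eqP.
Qed.

Lemma ord_ge_le i j f : (i <= j)%N -> ord_ge j f -> ord_ge i f.
Proof. by move=> ij [Mf vf]; split=> // k ki; apply: vf; exact: leq_trans ij. Qed.

End Filtration.

Section Operator.
Variables (n : nat) (F : V -> V) (nF : n_perturbation n F).
Local Notation S := (Sop F).

Let bF : bounded_op F. Proof. by case: nF. Qed.
Let FX m : (n <= m)%N -> F (zpow m) = (fun=> 0). Proof. by case: nF => _ h _ _;
  exact: h. Qed.
Let Fraise m f : is_H2 f -> vanish m f ->
  exists p : {poly C}, F f = coefs p /\ forall k, (k < m.+1)%N -> p`_k = 0.
Proof. by case: nF => _ _ h _; exact: h. Qed.
Let FH2 f : is_H2 f -> is_H2 (F f). Proof. by case: bF => h _ _; exact: h. Qed.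
Let Flc a f g : is_H2 f -> is_H2 g -> F (lc a f g) = lc a (F f) (F g).
Proof. by case: bF => _ h _; exact: h. Qed.

(* Truncating [f] below degree [N] does not change [F f], so [F f] lies in
   [z^(N+1) C[z]] for all [N]. *)
Lemma perturbation_vanish f : is_H2 f -> vanish n f -> F f = (fun=> 0).
Proof.
move=> Hf vf.
have Ft N : F (htrunc N f) = (fun=> 0).
  elim: N => [|N IH]; first by rewrite htrunc0 bounded_op0.
  rewrite htruncS Flc; [|exact: H2_zpow|exact: H2_htrunc_any].
  rewrite IH; apply/funext => k; rewrite /lc addr0.
  have [nN|Nn] := leqP n N; first by rewrite FX// mulr0.
  by rewrite vf// mul0r.
apply/funext => k; pose g := sub f (htrunc k f).
have Hg : is_H2 g by apply: H2_sub => //; exact: H2_htrunc_any.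
have fE : f = lc 1 (htrunc k f) g.
  by apply/funext => j; rewrite /lc /g /sub mul1r addrC subrK.
have [p [Fp p0]] : exists p : {poly C}, F g = coefs p /\ forall j, (j < k.+1)%N ->
  p`_j = 0.
  by apply: Fraise => // j jk; rewrite /g /sub /htrunc jk subrr.
rewrite [in LHS]fE Flc//; last exact: H2_htrunc_any.
by rewrite Ft /lc mulr0 add0r Fp /coefs p0.
Qed.

Lemma Sop_lc a f g : is_H2 f -> is_H2 g -> S (lc a f g) = lc a (S f) (S g).
Proof.
move=> Hf Hg; apply/funext => k; rewrite /Sop Flc// Mz_lc /lc; ring.
Qed.

Lemma Sop_H2 f : is_H2 f -> is_H2 (S f).
Proof. by move=> Hf; apply: H2_add; [exact: H2_Mz|exact: FH2]. Qed.

Lemma Sop_vanish f : is_H2 f -> vanish n f -> S f = Mz f.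
Proof. by move=> Hf vf; apply/funext => k;
  rewrite /Sop perturbation_vanish// addr0. Qed.

Lemma Sop_raise m f : is_H2 f -> vanish m f -> vanish m.+1 (S f).
Proof.
move=> Hf vf k km; rewrite /Sop (vanish_Mz vf)// add0r.
by have [p [-> p0]] := Fraise Hf vf; rewrite /coefs p0.
Qed.

Lemma iter_Sop_H2 k f : is_H2 f -> is_H2 (iter k S f).
Proof. by move=> Hf; elim: k => //= k; exact: Sop_H2. Qed.

Lemma iter_Sop_raise k m f : is_H2 f -> vanish m f -> vanish (m + k) (iter k S f).
Proof.
move=> Hf vf; elim: k => [|k IH]; first by rewrite addn0.
by rewrite addnS /=; apply: Sop_raise => //; exact: iter_Sop_H2.
Qed.

(** Each application of [F] contributes a polynomial, by condition (b) with m = 0, and shifting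
    keeps it a polynomial. *)
Lemma iter_Sop_poly k f : is_H2 f ->
  exists r : {poly C}, iter k S f = (fun j => iter k Mz f j + coefs r j).
Proof.
move=> Hf; elim: k => [|k [r IH]].
  by exists 0; apply/funext => j; rewrite /coefs coef0 addr0.
have [p [Fp _]] : exists p : {poly C}, F (iter k S f) =
  coefs p /\ forall j, (j < 1)%N -> p`_j = 0.
  by apply: Fraise => //; exact: iter_Sop_H2.
exists ('X * r + p); apply/funext => j; rewrite /= {1}/Sop Fp IH /coefs coefD coefXM.
by case: j => [|j] /=; rewrite ?add0r ?addr0// addrA.
Qed.

Lemma Sop_inj f : is_H2 f -> S f = (fun=> 0) -> f = (fun=> 0).
Proof.
move=> Hf S0; case: nF => _ _ _ [L [bL LS]].
by rewrite -(LS f Hf) S0 bounded_op0.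
Qed.

Section Invariant.
Variables (M : set V) (cM : closed_subspace M).

Hypothesis inv : forall f, M f -> M (S f).

Lemma iter_Sop_inv k f : M f -> M (iter k S f).
Proof. by move=> Mf; elim: k => //= k; exact: inv. Qed.

Lemma ord_ge_beurling : (exists f, M f /\ f <> (fun=> 0)) ->
  exists2 theta, orthonormal_shifts theta &
  forall f, ord_ge M n f <-> exists2 h, is_H2 h & f = iter n Mz (cmul theta h).
Proof.
move=> Mn0; have [||theta Ot NE] := beurling (unshift_closed cM n).
- move=> g /= Mg; rewrite -iterSr iterS -Sop_vanish; first exact: inv.
    exact: (csH2 cM).
  exact: vanish_iter_Mz.
(* S^n f lies in M_n because [S] raises the order of vanishing, and is nonzero because [S] is
   injective. *)
- have [f [Mf fn0]] := Mn0; have Hf := csH2 cM Mf.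
  have v : vanish n (iter n S f) by rewrite -[n in vanish n]add0n;
    apply: iter_Sop_raise.
  exists (fun k => iter n S f (k + n)%N); split.
    by rewrite /= -vanish_unshift//; exact: iter_Sop_inv.
  move=> E; apply: fn0.
  have inj k : iter k S f = (fun=> 0) -> f = (fun=> 0).
    by elim: k => //= k IH E0; apply: IH; apply: (Sop_inj _ E0); exact: iter_Sop_H2.
  by apply: (inj n); rewrite (vanish_unshift v) E iter_Mz0.
- exists theta => // f; split.
    move=> [Mf vf]; rewrite (vanish_unshift vf).
    have /NE[h Hh hE] : [set g | M (iter n Mz g)] (fun k => f (k + n)%N).
      by rewrite /= -vanish_unshift.
    by exists h => //; rewrite hE.
  move=> [h Hh ->]; split; last exact: vanish_iter_Mz.
  by apply/(NE (cmul theta h)); exists h.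
Qed.

Section Representation.
Variables (theta : V) (Ot : orthonormal_shifts theta).
Hypothesis thetaE : forall f, ord_ge M n f <-> exists2 h, is_H2 h & f =
  iter n Mz (cmul theta h).

Let Ht : is_H2 theta. Proof. by case: Ot. Qed.

Lemma ord_ge_shift b j : (n <= j)%N -> ord_ge M n (sc b (iter j Mz theta)).
Proof.
move=> nj; apply/thetaE; exists (sc b (zpow (j - n))); first by apply: H2_sc;
  exact: H2_zpow.
have -> : cmul theta (sc b (zpow (j - n))) = sc b (cmul theta (zpow (j - n))).
  apply/funext => k; rewrite /cmul /sc mulr_sumr; apply: eq_bigr => i _; ring.
by rewrite cmulC -coefs_Xn cmul_Xn iter_Mz_sc -iterD subnKC.
Qed.

Lemma generator_poly i phi : (i < n)%N -> ord_ge M i phi ->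
  (forall m, ord_ge M i.+1 m -> ip phi m = 0) ->
  exists pq : {poly C} * {poly C},
    phi = (fun k => cmul (coefs ('X^i * pq.1)) theta k - coefs pq.2 k) /\
    iter (n - i) S phi = cmul (coefs ('X^n * pq.1)) theta.
Proof.
move=> ni [Mphi vphi] orth; have Hphi := csH2 cM Mphi.
have [h Hh hE] : exists2 h, is_H2 h & iter (n - i) S phi = iter n Mz (cmul theta h).
  apply/thetaE; split; first exact: iter_Sop_inv.
  by rewrite -{1}(subnKC (ltnW ni)); apply: iter_Sop_raise.
have [r rE] := iter_Sop_poly (n - i) Hphi.
(* Comparing S^(n-i) phi = z^n theta h with z^(n-i) phi + r and dividing by z^(n-i); only
   coefficients from n - i on are compared, so the low part of [r] is dropped. *)
pose q := drop_poly (n - i) r.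
have phiE : phi = sub (iter i Mz (cmul theta h)) (coefs q).
  apply/funext => k; have := congr1 (fun g => g (k + (n - i))%N) (etrans (esym rE) hE).
  have -> : iter n Mz (cmul theta h) = iter (n - i) Mz (iter i Mz (cmul theta h)).
    by rewrite -iterD subnK// ltnW.
  rewrite !(iter_MzE (n - i)) leq_addl addnK => E.
  by rewrite /sub -E /q /coefs coef_drop_poly addrK.
have Hc : is_H2 (cmul theta h) by exact: H2_cmul.
have Hi j : is_H2 (iter j Mz theta) by exact: H2_iter_Mz.
(* For j >= n the vector z^(i+j) theta lies in M_n, hence is orthogonal to phi; for j >= [size q] it
   has no coefficient in common with q. Since phi + q = z^i theta h, both together give h_j = 0. *)
pose K := maxn n (size q).
have h0 j : (K <= j)%N -> h j = 0.
  rewrite geq_max => /andP[nj qj]; apply: dotc_eq0; set b := h j.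
  rewrite -(ip_cmul Ot j b Hh) -(ip_iter_Mz i Hc (@H2_sc R b _ (Hi j))) iter_Mz_sc
    -iterD.
  have Hij : is_H2 (sc b (iter (i + j) Mz theta)) by apply: H2_sc.
  have -> : iter i Mz (cmul theta h) = (fun k => phi k + coefs q k).
    by rewrite phiE; apply/funext => k; rewrite /sub subrK.
  rewrite (ip_addl Hphi (@H2_coefs q) Hij) orth; last first.
    by apply: (ord_ge_le ni); apply: ord_ge_shift; exact: leq_trans (leq_addl _ _).
  rewrite add0r ip_eq0// => k.
  have [kq|kq] := ltnP k (size q); last first.
    by rewrite /coefs nth_default// /dotc/= !mul0r addr0.
  rewrite /sc iter_MzE leqNgt (leq_trans kq) ?(leq_trans qj) ?leq_addl//=.
  by rewrite mulr0 /dotc/= !mulr0 addr0.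
pose p := \poly_(k < K) h k.
have hp : h = coefs p.
  by apply/funext => k; rewrite /coefs coef_poly; case: ltnP => // /h0.
exists (p, q); rewrite /= !cmul_XnM -hp cmulC; split=> //.
Qed.

(** Generators are peeled off one order at a time until M_n = z^n theta H^2 remains. Starting at j =
    0 this decomposes [M], and starting at j + 1 it decomposes S phi_j. *)
Lemma ord_ge_decomp (phi : nat -> V) :
  (forall i f, ord_ge M i f -> exists a : C, ord_ge M i.+1 (sub f (sc a (phi i)))) ->
  forall d j f, (j + d)%N = n -> ord_ge M j f -> exists (a : nat -> C) h,
    is_H2 h /\ f = (fun k => \sum_(j <=
      i < n) a i * phi i k + iter n Mz (cmul theta h) k).
Proof.
move=> gen; elim=> [|d IH] j f.
  rewrite addn0 => -> /thetaE[h Hh ->]; exists (fun=> 0), h; split=> //.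
  by apply/funext => k; rewrite big_geq// add0r.
move=> jd If; have [c Ic] := gen j f If.
have [|a [h [Hh E]]] := IH j.+1 _ _ Ic; first by rewrite addSn -addnS.
exists (fun i => if i == j then c else a i), h; split=> //.
have jn : (j < n)%N by rewrite -jd addnS ltnS leq_addr.
apply/funext => k; rewrite big_ltn// eqxx.
have -> : \sum_(j.+1 <= i < n) (if i == j then c else a i) * phi i k =
  \sum_(j.+1 <= i < n) a i * phi i k.
  by apply: eq_big_nat => i /andP[ji _]; rewrite gtn_eqF.
have := congr1 (fun g => g k) E; rewrite /sub /sc => /eqP; rewrite subr_eq => /eqP ->.
by rewrite addrC addrA.
Qed.

End Representation.

End Invariant.

End Operator.

End Perturbation.

Theorem theorem3p2 (R : realType) (n : nat) (F : (nat -> R[i]) -> (nat -> R[i]))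
    (M : set (nat -> R[i])) :
  (1 <= n)%N ->
  n_perturbation n F ->
  closed_subspace M ->
  (exists f, M f /\ f <> (fun _ => 0)) ->
  (forall f, M f -> M (Sop F f))
  <->
  (exists (theta : nat -> R[i]) (p q : nat -> {poly R[i]}),
     let phi := fun i : nat => (fun k => cmul (coefs ('X^i * p i)) theta k - coefs (q i) k) in
     let zth := fun g : nat -> R[i] => cmul (coefs 'X^n) (cmul theta g) in
     inner theta /\ (
         (* M = (C phi_0 (+) ... (+) C phi_(n-1)) (+) z^n theta H^2 *)
         forall f, M f <-> exists (a : nat -> R[i]) (g : nat -> R[i]),
            is_H2 g /\ f = (fun k => \sum_(i < n) a i * phi i k + zth g k)) /\ [/\
         (* the sums are orthogonal *)
         forall i j, (i < n)%N -> (j < n)%N -> i <> j -> h2orth (phi i) (phi j),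
         forall i g, (i < n)%N -> is_H2 g -> h2orth (phi i) (zth g),
         (* S_n phi_j in (C phi_(j+1) (+) ... (+) C phi_(n-1)) (+) z^n theta H^2 *)
         forall j, (j.+1 < n)%N -> exists (a : nat -> R[i]) (g : nat -> R[i]),
            is_H2 g /\ Sop F (phi j) = (fun k => \sum_(j.+1 <= i < n) a i * phi i k + zth g k)
       & (* S_n phi_(n-1) = z^n p_(n-1) theta *)
         Sop F (phi n.-1) = cmul (coefs ('X^n * p n.-1)) theta]).
Proof.
move=> n1 nF cM Mn0; split=> [inv|[theta [p [q]]]]; last first.
  set phi := fun i k => _; set zth := fun g => _ => -[_ [ME [_ _ Sj Sn]]].
  have M_zth g : is_H2 g -> M (zth g).
    move=> Hg; apply/ME; exists (fun=> 0), g; split=> //.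
    by apply/funext => k; rewrite big1 ?add0r// => i _; rewrite mul0r.
  have zth0 : zth (fun=> 0) = (fun=> 0) by rewrite /zth cmul0 cmul_Xn iter_Mz0.
  have M_phi i : (i < n)%N -> M (phi i).
    move=> ni; apply/ME; exists (fun j => (j == i)%:R), (fun=> 0); split;
      first exact: H2_0.
    apply/funext => k; rewrite zth0 addr0 (bigD1 (Ordinal ni))//= eqxx mul1r big1
      ?addr0//.
    by move=> j ji; rewrite (negbTE (_ : j != i :> nat)) ?mul0r.
  have S_zth g : is_H2 g -> M (Sop F (zth g)).
    move=> Hg; rewrite (Sop_vanish nF (csH2 cM (M_zth g Hg))).
      have -> : Mz (zth g) = zth (Mz g) by rewrite /zth !cmul_Xn cmul_Mz -iterSr.
      by apply: M_zth; exact: H2_Mz.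
    by rewrite /zth cmul_Xn; exact: vanish_iter_Mz.
  have S_phi i : (i < n)%N -> M (Sop F (phi i)).
    move=> ni; have [ni1|] := ltnP i.+1 n.
      have [a [g [Hg ->]]] := Sj i ni1.
      apply: comb_closed; [by move=> c f g'; exact: (cs_lc cM)|exact: M_zth|].
      by move=> j /andP[_]; exact: M_phi.
    move=> ni1; have -> : i = n.-1 by apply/eqP;
      rewrite eqn_leq -ltnS prednK// ni -subn1 leq_subLR add1n.
    (* The polynomial p_(n-1) is itself an element of H^2, so z^n p_(n-1) theta lies in z^n theta
       H^2. *)
    rewrite Sn cmul_XnM cmulC -cmul_Xn; apply: M_zth; exact: H2_coefs.
  move=> f /ME[a [g [Hg ->]]].
  have := @comb_closed R [set f | M f /\ M (Sop F f)] phi a (zth g) 0 n.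
  case.
  - move=> c f1 f2 [Mf1 Sf1] [Mf2 Sf2]; split; first exact: (cs_lc cM).
    by rewrite (Sop_lc nF _ (csH2 cM Mf1) (csH2 cM Mf2)); exact: (cs_lc cM).
  - by split; [exact: M_zth|exact: S_zth].
  - by move=> i /andP[_ ni]; split; [exact: M_phi|exact: S_phi].
  - move=> _; congr (M (Sop F _)); apply/funext => k.
    by rewrite big_mkord.
have [theta Ot thetaE] := ord_ge_beurling nF cM inv Mn0.
have Ht : is_H2 theta by case: Ot.
have /choice[phi Hphi] := graded_generator cM.
have Iphi i : ord_ge M i (phi i) by case: (Hphi i).
have orth i m : ord_ge M i.+1 m -> ip (phi i) m = 0 by case: (Hphi i) => _ h _;
  exact: h.
have gen i f : ord_ge M i f -> exists a : R[i], ord_ge M i.+1 (sub f (sc a (phi i))).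
  by case: (Hphi i) => _ _; exact.
have H2phi i : is_H2 (phi i) by apply: (csH2 cM); exact: (proj1 (Iphi i)).
have /choice[pq Hpq] : forall i, exists pq : {poly R[i]} * {poly R[i]}, (i < n)%N ->
    phi i = (fun k => cmul (coefs ('X^i * pq.1)) theta k - coefs pq.2 k) /\
    iter (n - i) (Sop F) (phi i) = cmul (coefs ('X^n * pq.1)) theta.
  (* Choice needs a pair at every index; from n on it is arbitrary. *)
  move=> i; have [ni|ni] := ltnP i n; last by exists (0, 0).
  by have [pq ?] := generator_poly nF cM inv Ot thetaE ni (Iphi i) (orth i); exists pq.
exists theta, (fun i => (pq i).1), (fun i => (pq i).2) => phi' zth.
have phiE i : (i < n)%N -> phi' i = phi i by move=> ni; rewrite [RHS](proj1 (Hpq i ni)).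
have zthE g : zth g = iter n Mz (cmul theta g) by rewrite /zth cmul_Xn.
have Izth g : is_H2 g -> ord_ge M n (zth g) by move=> Hg; apply/thetaE; exists g.
(* All orthogonality claims reduce to this one: the later generators and z^n theta H^2 lie in
   M_(i+1), which is stable under multiplication by i, so both parts of the Hermitian product
   vanish. *)
have oc i m : ord_ge M i.+1 m -> h2orth (phi i) m.
  move=> Im; have Hm := csH2 cM (proj1 Im); apply: ip_h2orth => //; first exact: orth.
  by apply: orth; exact: (cs_sc (ord_ge_closed cM i.+1)).
have oc' i m : ord_ge M i.+1 m -> h2orth m (phi i).
  move=> Im; have Hm := csH2 cM (proj1 Im); apply: ip_h2orth => //;
    first by rewrite ipC orth.
  rewrite ipC (ip_sc _ (H2phi i) Hm); apply: orth;
    exact: (cs_sc (ord_ge_closed cM i.+1)).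
have dec j f : (j <= n)%N -> ord_ge M j f -> exists (a : nat -> R[i]) g,
    is_H2 g /\ f = (fun k => \sum_(j <= i < n) a i * phi' i k + zth g k).
  move=> jn If; have [a [h [Hh ->]]] := ord_ge_decomp thetaE gen (subnKC jn) If.
  exists a, h; split=> //; apply/funext => k; rewrite zthE; congr (_ + _).
  by apply: eq_big_nat => i /andP[_ ni]; rewrite phiE.
split; [exact: orthonormal_inner|split; [|split]].
- move=> f; split.
    move=> Mf; have [|a [g [Hg ->]]] := dec 0%N f (leq0n n); first by split.
    by exists a, g; split=> //; apply/funext => k; rewrite big_mkord.
  move=> [a [g [Hg ->]]].
  have := @comb_closed R M phi' a (zth g) 0 n (cs_lc cM) (proj1 (Izth g Hg)).
  rewrite (_ : (fun k => \sum_(0 <= i < n) a i * phi' i k + zth g k) =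
    (fun k => \sum_(i < n) a i * phi' i k + zth g k)).
    by apply=> i /andP[_ ni]; rewrite phiE//; exact: (proj1 (Iphi i)).
  by apply/funext => k; rewrite big_mkord.
- move=> i j ni nj ij; rewrite !phiE//.
  have [lt|lt|//] := ltngtP i j.
  + exact/oc/(ord_ge_le lt).
  + exact/oc'/(ord_ge_le lt).
- move=> i g ni Hg; rewrite phiE//; apply: oc; apply: (ord_ge_le ni); exact: Izth.
- move=> j nj; rewrite (phiE j (ltnW nj)); apply: dec; first exact: ltnW.
  split; first by apply: inv; exact: (proj1 (Iphi j)).
  exact: (Sop_raise nF (H2phi j) (proj2 (Iphi j))).
(* At i = n - 1 the iterate S^(n-i) is [S] itself, so the formula for the iterate is the required
   identity. *)
- have n1' : (n.-1 < n)%N by rewrite prednK.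
  rewrite (phiE _ n1') -(proj2 (Hpq _ n1')).
  by have -> : (n - n.-1)%N = 1%N by rewrite -subn1 subKn.
Qed.
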